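(* For $r>0$ set $\mathcal{N}(r):=\#\{ j\in \mathbb{N} : \mu_j(\mathscr{L}_N)\geq \frac{1}{r}\}$. There exist constants $C_2>0$ and $r_0>0$ (independent of $N$) with the following property: for all $k\in\mathbb{N}$ one can find $A_k>0$ such that, for all $N$ sufficiently large, $$\mathbb{P}_N\left(C_2^{-1}N\leq \mathcal{N}(r_0)\leq C_2N\right)\geq 1-\frac{A_k}{N^k}.$$
   Context: Let $\Omega_0\subset\mathbb{C}$ be a bounded, simply connected open set with boundary at least $C^2$ regular. Let $d\ge 2$ and let $\gamma_1,\dots,\gamma_d:\Omega_0\to\Omega_0$ be holomorphic maps, each extending continuously to $\overline{\Omega_0}$ and satisfying $\overline{\gamma_j(\Omega_0)}\subset\Omega_0$. Let $G:\Omega_0\to\mathbb{C}$ be holomorphic on $\Omega_0$ and extend continuously to $\overline{\Omega_0}$. For $N\ge1$ let $U_1,\dots,U_d$ be the permutation matrices of $d$ permutations chosen independently and uniformly at random in the symmetric group $\mathcal{S}_N$; $\mathbb{P}_N$ denotes probability for this random choice. The space $\mathcal{H}_N=H^2(\Omega_0,\mathbb{C}^N)$ is the Bergman space of holomorphic $F:\Omega_0\to\mathbb{C}^N$ with $\int_{\Omega_0}\|F(z)\|^2dm(z)<\infty$ ($m$ is Lebesgue measure on $\mathbb{C}$, $\|\cdot\|$ the Hermitian norm on $\mathbb{C}^N$). The twisted transfer operator $\mathscr{L}_N:\mathcal{H}_N\to\mathcal{H}_N$ is $$\mathscr{L}_N(F)(z)=\sum_{j=1}^d e^{G(\gamma_j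 z)}U_jF(\gamma_j z),$$ a compact, trace class operator. For a compact operator $T$ on a Hilbert space, $\mu_0(T)=\|T\|\ge\mu_1(T)\ge\cdots$ denotes its singular values, i.e. the eigenvalues (with multiplicity) of $\sqrt{T^*T}$. *)

(* Defs.v *)
From HB Require Import structures.
From mathcomp Require Import all_boot all_order all_fingroup all_algebra.
From mathcomp Require Import all_classical all_reals all_analysis.
From mathcomp Require Import complex.
Set Implicit Arguments.
Unset Strict Implicit.
Unset Printing Implicit Defensive.
Import Order.TTheory GRing.Theory Num.Theory numFieldNormedType.Exports.
Local Open Scope classical_set_scope.
Local Open Scope ring_scope.

(* R[i] carries no topology of its own; seen as an abstract numClosedFieldType
   it inherits the normed-module structure over itself, so that derivability
   in the sense of derive.v is complex differentiability. *)
Definition Cplx (R : realType) : numClosedFieldType := R[i].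

Section ComplexPlane.
Variable R : realType.
Local Notation C := (Cplx R).
Implicit Types (Om : set C) (f : C -> C).

Definition Rpart (z : C) : R := complex.Re (z : R[i]).
Definition Ipart (z : C) : R := complex.Im (z : R[i]).
Definition toC (p : R * R) : C := (Complex p.1 p.2 : R[i]).

Definition cexp (z : C) : C :=
  toC (expR (Rpart z) * cos (Ipart z), expR (Rpart z) * sin (Ipart z)).

Definition holomorphic_on Om f := forall z, Om z -> derivable f z 1.

Definition extends_continuously Om f :=
  exists g : C -> C,
    {within closure Om, continuous g} /\ forall z, Om z -> g z = f z.

Definition path_connected Om := forall z w, Om z -> Om w ->
  exists c : R -> C, [/\ {within `[0, 1], continuous c},
    forall t, t \in `[0, 1] -> Om (c t), c 0 = z & c 1 = w].

Definition null_homotopic Om (c : R -> C) :=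
  exists h : R * R -> C,
    [/\ {within `[0, 1] `*` `[0, 1], continuous h},
        forall s t, s \in `[0, 1] -> t \in `[0, 1] -> Om (h (s, t)),
        forall t, t \in `[0, 1] -> h (0, t) = c t,
        forall t, t \in `[0, 1] -> h (1, t) = c 0 &
        forall s, s \in `[0, 1] -> h (s, 0) = c 0 /\ h (s, 1) = c 0].

Definition simply_connected Om :=
  [/\ Om !=set0, path_connected Om &
      forall c : R -> C, {within `[0, 1], continuous c} ->
        (forall t, t \in `[0, 1] -> Om (c t)) -> c 0 = c 1 ->
        null_homotopic Om c].

Definition axis (b : bool) : R * R := if b then (1, 0) else (0, 1).

Fixpoint Ck_on (k : nat) (U : set (R * R)) (f : R * R -> R) : Prop :=
  (forall p, U p -> {for p, continuous f}) /\
  if k is k'.+1 then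
    forall b, (forall p, U p -> derivable f p (axis b)) /\
              Ck_on k' U ('D_(axis b) f)
  else True.

(* Near each boundary point, Om is a sublevel set {rho < 0} of a C^2 function
   rho with nonvanishing gradient there. Om is meant to be open. *)
Definition C2_boundary Om :=
  forall p : R * R, (closure Om `\` Om) (toC p) ->
    exists U : set (R * R), exists rho : R * R -> R,
      [/\ open U, U p, Ck_on 2 U rho,
          exists b, 'D_(axis b) rho p != 0 &
          forall q, U q -> (Om (toC q) <-> rho q < 0)].

Definition leb2 := (@lebesgue_measure R \x @lebesgue_measure R)%E.

Definition cintegral Om f : C :=
  toC (\int[leb2]_(p in toC @^-1` Om) Rpart (f (toC p)),
       \int[leb2]_(p in toC @^-1` Om) Ipart (f (toC p))).

End ComplexPlane.

Section SingularValues.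
Variables (R : realType) (V : lmodType (Cplx R)).
Local Notation C := (Cplx R).
(* The Hilbert space is a subspace H of V; ip need only be meaningful on H,
   and an operator on H is a function V -> V considered on H only. *)
Variables (H : set V) (ip : V -> V -> C).
Implicit Types (S T A : V -> V) (mu : nat -> R).

Definition operator_on T :=
  (forall u, H u -> H (T u)) /\
  (forall (a : C) u v, H u -> H v -> T (a *: u + v) = a *: T u + T v).

Definition is_adjoint T S :=
  [/\ operator_on T, operator_on S &
      forall u v, H u -> H v -> ip (T u) v = ip u (S v)].

Definition positive_operator A :=
  is_adjoint A A /\ forall u, H u -> 0 <= ip (A u) u.

(* A = sqrt (T^* T) *)
Definition is_abs T A :=
  positive_operator A /\
  exists S, is_adjoint T S /\ forall u, H u -> A (A u) = S (T u).

Definition eigenspace_on A (s : R) : set V :=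
  [set u | H u /\ A u = toC (s, 0) *: u].

Definition has_dim (E : set V) (n : nat) :=
  exists e : 'I_n -> V,
    [/\ forall i, E (e i),
        forall c : 'I_n -> C, \sum_i c i *: e i = 0 -> forall i, c i = 0 &
        forall u, E u -> exists c : 'I_n -> C, u = \sum_i c i *: e i].

(* mu lists the eigenvalues of sqrt (T^* T) in nonincreasing order, each
   positive one as often as its multiplicity; the list is completed by zeros
   when there are only finitely many positive ones. *)
Definition is_singular_values T mu :=
  [/\ forall j, 0 <= mu j, nonincreasing_seq mu &
      exists A, is_abs T A /\
        forall s, 0 < s -> exists n,
          has_dim (eigenspace_on A s) n /\ ([set j | mu j = s] #= `I_n)%card].

(* The sequence satisfying is_singular_values is unique when it exists, which
   it does for every compact operator on a Hilbert space. *)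
Definition singular_value T : nat -> R :=
  xget (fun=> 0) [set mu | is_singular_values T mu].

Definition sv_count T (r : R) : \bar R :=
  counting [set j | r^-1 <= singular_value T j].

End SingularValues.

Section TransferOperator.
Variables (R : realType) (Om : set (Cplx R)).
Local Notation C := (Cplx R).

(* Elements of H^2(Om, C^N) are represented by their extension by zero, so
   that equality of functions is equality on Om. *)
Definition bergman N : set (C -> 'cV[C]_N) :=
  [set F | [/\ forall z, ~ Om z -> F z = 0,
               forall i, holomorphic_on Om (fun z => F z i 0) &
               (\int[@leb2 R]_(p in @toC R @^-1` Om)
                  (\sum_i Rpart `|F (toC p) i 0| ^+ 2)%:E < +oo)%E]].

Definition bergman_ip N (F1 F2 : C -> 'cV[C]_N) : C :=
  cintegral Om (fun z => \sum_i F1 z i 0 * (F2 z i 0)^*).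

Definition transfer d N (gam : 'I_d -> C -> C) (G : C -> C)
    (s : {ffun 'I_d -> 'S_N}) (F : C -> 'cV[C]_N) : C -> 'cV[C]_N :=
  fun z => if `[< Om z >]
    then \sum_j cexp (G (gam j z)) *: (perm_mx (s j) *m F (gam j z))
    else 0.

Definition transfer_count d N (gam : 'I_d -> C -> C) (G : C -> C)
    (s : {ffun 'I_d -> 'S_N}) (r : R) : \bar R :=
  sv_count (@bergman N) (@bergman_ip N) (transfer gam G s) r.

End TransferOperator.

(* d independent uniform permutations = a uniform element of (S_N)^d. *)
Definition perm_prob (R : realType) (d N : nat)
    (E : {ffun 'I_d -> 'S_N} -> Prop) : R :=
  #|[pred s : {ffun 'I_d -> 'S_N} | `[< E s >]]|%:R
    / #|{: {ffun 'I_d -> 'S_N}}|%:R.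

(* Main.v *)
Require Import Defs.
From HB Require Import structures.
From mathcomp Require Import all_boot all_order all_fingroup all_algebra.
From mathcomp Require Import all_classical all_reals all_analysis.
From mathcomp Require Import measurable_realfun.
From mathcomp Require Import complex ring lra.
Set Implicit Arguments.
Unset Strict Implicit.
Unset Printing Implicit Defensive.
Import Order.TTheory GRing.Theory Num.Theory numFieldNormedType.Exports.
Local Open Scope classical_set_scope.
Local Open Scope ring_scope.

(** The bounds on the number of singular values hold for every choice of the
    permutations, with constants that do not depend on N; the event in
    question therefore has probability one.

    Upper bound. A Bergman function satisfies |F(w)|^2 <= c |F|^2 at every point
    w around which a square of half-side 2 r fits into the domain
    (L2_pointwise). The closures of the images of the maps gam j are compact
    subsets of the domain, so one r serves for all the points gam j z. Applied
    to F = sum_k conj(f_k(w)_i) f_k, the estimate yields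
    sum_k |f_k(w)_i|^2 <= c for every orthonormal family f
    (bessel_pointwise). Integrating over the domain bounds the Hilbert-Schmidt
    norm of the transfer operator T: sum_k |T f_k|^2 <= K N with K independent
    of N and of the permutations (transfer_HS_bounded). Hence at most K N r0^2
    singular values are at least 1 / r0.

    Lower bound. For v in C^N the operator T maps exp(-G) v to the constant
    function sum_j U_j v. The matrix sum_j U_j can be far from invertible, but
    each of its columns has at most d nonzero entries, and so has each row. A
    maximal set S of columns with disjoint supports therefore has at least
    N / d^2 elements (large_conflict_free), and |sum_j U_j v| >= |v| for v
    supported on S (conflict_free_energy). With |Re G| <= M on the domain,
    |T F| >= exp(-M) |F| on a space of dimension #|S|, and the min-max
    principle provides #|S| singular values that are at least exp(-M).

    Both bounds are about the sequence singular_value, so it has to be shown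
    that some sequence lists the singular values (singular_values_exist), and
    that every sequence that does so obeys the two bounds (sv_count_bounds). For
    a positive contraction B the iterates B^n u converge to a fixed vector
    because <B^n u, u> decreases; if B has finite trace and the supremum of its
    quadratic form is 1, some of these limits are not 0 (contraction_fixed).
    So the supremum of the quadratic form of a positive operator of finite
    trace is an eigenvalue. Repeating this on orthogonal complements
    diagonalizes S T, where S is the adjoint of T given by Riesz
    representation, and square roots of the eigenvalues give |T|.

    The complex analysis starts from Goursat's theorem, proved by bisection of
    rectangles. Cauchy's formula on rectangles follows, and from it the
    pointwise estimate, by a choice of good sides, and the holomorphy of locally
    uniform limits. Together with Fatou's lemma these make the Bergman space
    complete (bergman_complete). *)

(** * Complex numbers with a real modulus *)

Section ComplexBasics.
Variable R : realType.
Local Notation C := (Cplx R).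
Implicit Types (z w : C) (r s : R).

Definition ofR r : C := toC (r, 0).

Lemma ofR_is_additive : additive ofR.
Proof. by move=> x y; apply/eqP; rewrite eq_complex /= subr0 !eqxx. Qed.
HB.instance Definition _ := GRing.isAdditive.Build R C ofR ofR_is_additive.
Lemma ofR_is_multiplicative : multiplicative ofR.
Proof.
by split=> [x y|//]; apply/eqP; rewrite eq_complex /= !mulr0 !mul0r subr0 addr0 !eqxx.
Qed.
HB.instance Definition _ := GRing.isMultiplicative.Build R C ofR ofR_is_multiplicative.

Lemma Rpart_is_additive : additive (@Rpart R).
Proof. by move=> [a b] [c d']. Qed.
HB.instance Definition _ := GRing.isAdditive.Build C R (@Rpart R) Rpart_is_additive.
Lemma Ipart_is_additive : additive (@Ipart R).
Proof. by move=> [a b] [c d']. Qed.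
HB.instance Definition _ := GRing.isAdditive.Build C R (@Ipart R) Ipart_is_additive.

Lemma Rpart_ofR r : Rpart (ofR r) = r. Proof. by []. Qed.
Lemma Ipart_ofR r : Ipart (ofR r) = 0. Proof. by []. Qed.
Lemma ofR_inj : injective ofR. Proof. by move=> x y []. Qed.

Lemma Cext z w : Rpart z = Rpart w -> Ipart z = Ipart w -> z = w.
Proof. by case: z w => [a b] [c d'] /= -> ->. Qed.

Lemma RpartM z w : Rpart (z * w) = Rpart z * Rpart w - Ipart z * Ipart w.
Proof. by case: z w => [a b] [c d']. Qed.
Lemma IpartM z w : Ipart (z * w) = Rpart z * Ipart w + Ipart z * Rpart w.
Proof. by case: z w => [a b] [c d'] /=. Qed.
Lemma RpartZ r z : Rpart (ofR r * z) = r * Rpart z.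
Proof. by rewrite RpartM Rpart_ofR Ipart_ofR mul0r subr0. Qed.
Lemma IpartZ r z : Ipart (ofR r * z) = r * Ipart z.
Proof. by rewrite IpartM Rpart_ofR Ipart_ofR mul0r addr0. Qed.
Lemma Rpart_conj z : Rpart z^* = Rpart z.
Proof. by case: z. Qed.
Lemma Ipart_conj z : Ipart z^* = - Ipart z.
Proof. by case: z. Qed.
Lemma conj_ofR r : (ofR r)^* = ofR r.
Proof. by apply: Cext; rewrite ?Rpart_conj // Ipart_conj Ipart_ofR oppr0. Qed.

Definition Ci : C := toC (0, 1).
Lemma CiM z : Ci * z = toC (- Ipart z, Rpart z).
Proof. by case: z => a b; apply: Cext => /=; rewrite ?RpartM ?IpartM /=; ring. Qed.
Lemma CE z : z = ofR (Rpart z) + Ci * ofR (Ipart z).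
Proof. by rewrite CiM; case: z => a b; apply: Cext => /=; rewrite ?oppr0 ?addr0 ?add0r. Qed.

Lemma ge0P z : 0 <= z -> z = ofR (Rpart z) /\ 0 <= Rpart z.
Proof. by case: z => a b; rewrite lecE /= => /andP[/eqP -> ->]. Qed.
Lemma ofR_ge0 r : (0 <= ofR r) = (0 <= r).
Proof. by rewrite lecE /= eqxx. Qed.
Lemma ler_ofR r s : (ofR r <= ofR s) = (r <= s).
Proof. by rewrite lecE /= eqxx. Qed.
Lemma ltr_ofR r s : (ofR r < ofR s) = (r < s).
Proof. by rewrite ltcE /= eqxx. Qed.

(** The norm of Cplx R takes its values in Cplx R itself; this is the same
    number as an element of the ordered field R. *)
Definition cm z : R := Rpart `|z|.
Lemma cmE z : `|z| = ofR (cm z).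
Proof. by have [] := ge0P (normr_ge0 z). Qed.
Lemma cm_ge0 z : 0 <= cm z.
Proof. by have [] := ge0P (normr_ge0 z). Qed.
Lemma cmM z w : cm (z * w) = cm z * cm w.
Proof. by apply: ofR_inj; rewrite rmorphM /= -!cmE normrM. Qed.
Lemma cmD z w : cm (z + w) <= cm z + cm w.
Proof. by rewrite -ler_ofR rmorphD /= -!cmE ler_normD. Qed.
Lemma cmN z : cm (- z) = cm z.
Proof. by rewrite /cm normrN. Qed.
Lemma cmB z w : cm (z - w) <= cm z + cm w.
Proof. by rewrite -(cmN w) cmD. Qed.
Lemma cm0 : cm 0 = 0. Proof. by rewrite /cm normr0. Qed.
Lemma cm1 : cm 1 = 1. Proof. by rewrite /cm normr1. Qed.
Lemma cm_eq0 z : cm z = 0 -> z = 0.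
Proof. by move=> h; apply/eqP; rewrite -normr_eq0 cmE h raddf0. Qed.
Lemma cm_gt0 z : z != 0 -> 0 < cm z.
Proof.
by move=> z0; rewrite lt_neqAle cm_ge0 andbT eq_sym; apply: contra z0 => /eqP/cm_eq0->.
Qed.
Lemma cmV z : cm z^-1 = (cm z)^-1.
Proof. by apply: ofR_inj; rewrite fmorphV /= -!cmE normfV. Qed.
Lemma cmX z n : cm (z ^+ n) = cm z ^+ n.
Proof. by apply: ofR_inj; rewrite rmorphXn /= -!cmE normrX. Qed.
Lemma cm_conj z : cm z^* = cm z.
Proof. by rewrite /cm norm_conjC. Qed.
Lemma cm_ofR r : cm (ofR r) = `|r|.
Proof.
rewrite /cm; case: (ger0P r) => h; first by rewrite ger0_norm ?ofR_ge0.
by rewrite -normrN -[- ofR r](raddfN (@ofR)) ger0_norm ?ofR_ge0 ?oppr_ge0 ?ltW.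
Qed.
Lemma cm_Ci : cm Ci = 1.
Proof. by rewrite /cm normc_def /= expr0n expr1n add0r sqrtr1. Qed.
Lemma cm_sqr z : cm z ^+ 2 = Rpart z ^+ 2 + Ipart z ^+ 2.
Proof. by apply: ofR_inj; rewrite rmorphXn /= -cmE -add_Re2_Im2. Qed.
Lemma mulJ z : z * z^* = ofR (cm z ^+ 2).
Proof. by rewrite -normCK cmE rmorphXn. Qed.
Lemma Rpart_le z : `|Rpart z| <= cm z.
Proof.
rewrite -ler_sqr ?nnegrE ?cm_ge0 // real_normK ?num_real // cm_sqr.
by rewrite lerDl sqr_ge0.
Qed.
Lemma Ipart_le z : `|Ipart z| <= cm z.
Proof.
rewrite -ler_sqr ?nnegrE ?cm_ge0 // real_normK ?num_real // cm_sqr.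
by rewrite lerDr sqr_ge0.
Qed.
Lemma cm_le z : cm z <= `|Rpart z| + `|Ipart z|.
Proof.
rewrite {1}(CE z); apply: (le_trans (cmD _ _)).
by rewrite cmM cm_Ci mul1r !cm_ofR.
Qed.
Lemma cm_sum (I : Type) (r : seq I) (P : pred I) (F : I -> C) :
  cm (\sum_(i <- r | P i) F i) <= \sum_(i <- r | P i) cm (F i).
Proof.
elim/big_ind2: _ => [|x a y b hx hy|//]; first by rewrite cm0.
by apply: (le_trans (cmD _ _)); apply: lerD.
Qed.

End ComplexBasics.

(** * Hermitian forms on a subspace *)

Section HermitianForms.
Variables (R : realType) (V : lmodType (Cplx R)).
Local Notation C := (Cplx R).

(** Definiteness is left out, so that the form <B u, v> of a positive operator B
    is an instance and obeys the Cauchy-Schwarz inequality. *)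
Record hermitian_on (H : set V) (q : V -> V -> C) : Prop := HermitianOn {
  herm_mem0 : H 0;
  herm_memL : forall (a : C) u v, H u -> H v -> H (a *: u + v);
  herm_lin : forall (a : C) u v w, H u -> H v -> H w ->
    q (a *: u + v) w = a * q u w + q v w;
  herm_sym : forall u v, H u -> H v -> q v u = (q u v)^*;
  herm_ge0 : forall u, H u -> 0 <= q u u }.

Definition nsq (q : V -> V -> C) u : R := Rpart (q u u).

Variables (H : set V) (q : V -> V -> C).
Hypothesis hq : hermitian_on H q.

Lemma memD u v : H u -> H v -> H (u + v).
Proof. by move=> hu hv; rewrite -[u]scale1r; apply: (herm_memL hq). Qed.
Lemma memZ a u : H u -> H (a *: u).
Proof. by move=> hu; rewrite -[_ *: _]addr0; apply: (herm_memL hq) => //; apply: (herm_mem0 hq). Qed.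
Lemma memN u : H u -> H (- u).
Proof. by move=> hu; rewrite -scaleN1r; apply: memZ. Qed.
Lemma memB u v : H u -> H v -> H (u - v).
Proof. by move=> hu hv; apply: memD => //; apply: memN. Qed.
Lemma mem_sum (I : Type) (r : seq I) (P : pred I) (F : I -> V) :
  (forall i, P i -> H (F i)) -> H (\sum_(i <- r | P i) F i).
Proof.
move=> h; elim/big_ind: _ => //; first exact: (herm_mem0 hq).
exact: memD.
Qed.

Lemma formDl u v w : H u -> H v -> H w -> q (u + v) w = q u w + q v w.
Proof. by move=> *; rewrite -{1}[u]scale1r (herm_lin hq) // mul1r. Qed.
Lemma form0l w : H w -> q 0 w = 0.
Proof.
move=> hw; have := @formDl 0 0 w (herm_mem0 hq) (herm_mem0 hq) hw.
by rewrite addr0 => /esym/eqP; rewrite -subr_eq0 addrK => /eqP.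
Qed.
Lemma formZl a u w : H u -> H w -> q (a *: u) w = a * q u w.
Proof.
move=> hu hw; rewrite -[_ *: _]addr0 (herm_lin hq) ?form0l ?addr0 //.
exact: (herm_mem0 hq).
Qed.
Lemma formNl u w : H u -> H w -> q (- u) w = - q u w.
Proof. by move=> *; rewrite -scaleN1r formZl // mulN1r. Qed.
Lemma formBl u v w : H u -> H v -> H w -> q (u - v) w = q u w - q v w.
Proof. by move=> *; rewrite formDl ?formNl //; apply: memN. Qed.
Lemma formDr u v w : H u -> H v -> H w -> q w (u + v) = q w u + q w v.
Proof.
move=> hu hv hw; rewrite (herm_sym hq (memD hu hv) hw) formDl // rmorphD /=.
by rewrite -!(herm_sym hq).
Qed.
Lemma formZr a u w : H u -> H w -> q w (a *: u) = a^* * q w u.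
Proof.
move=> hu hw; rewrite (herm_sym hq (memZ a hu) hw) formZl // rmorphM /=.
by rewrite -(herm_sym hq).
Qed.
Lemma formNr u w : H u -> H w -> q w (- u) = - q w u.
Proof. by move=> *; rewrite -scaleN1r formZr // rmorphN1 mulN1r. Qed.
Lemma form_suml (I : Type) (r : seq I) (P : pred I) (F : I -> V) w :
  (forall i, P i -> H (F i)) -> H w ->
  q (\sum_(i <- r | P i) F i) w = \sum_(i <- r | P i) q (F i) w.
Proof.
move=> hF hw; pose K u (s : C) := H u /\ q u w = s.
suff [] : K (\sum_(i <- r | P i) F i) (\sum_(i <- r | P i) q (F i) w) by [].
elim/big_ind2: _ => [|x a y b [hx <-] [hy <-]|i Pi].
- by split; rewrite ?form0l //; apply: (herm_mem0 hq).
- by split; [exact: memD|rewrite formDl].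
- by split => //; apply: hF.
Qed.
Lemma form_sumr (I : Type) (r : seq I) (P : pred I) (F : I -> V) w :
  (forall i, P i -> H (F i)) -> H w ->
  q w (\sum_(i <- r | P i) F i) = \sum_(i <- r | P i) q w (F i).
Proof.
move=> hF hw; rewrite (herm_sym hq (mem_sum r hF) hw) form_suml // rmorph_sum /=.
by apply: eq_bigr => i Pi; rewrite -(herm_sym hq) //; apply: hF.
Qed.

Lemma nsqE u : H u -> q u u = ofR (nsq q u).
Proof. by move=> /(herm_ge0 hq)/ge0P[]. Qed.
Lemma nsq_ge0 u : H u -> 0 <= nsq q u.
Proof. by move=> /(herm_ge0 hq)/ge0P[]. Qed.
Lemma nsq0 : nsq q 0 = 0.
Proof. by rewrite /nsq form0l //; apply: (herm_mem0 hq). Qed.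
Lemma nsqD u v : H u -> H v ->
  nsq q (u + v) = nsq q u + 2 * Rpart (q u v) + nsq q v.
Proof.
move=> hu hv; rewrite /nsq formDl ?formDr //; last exact: memD.
rewrite (herm_sym hq hu hv) !raddfD /= Rpart_conj; ring.
Qed.
Lemma nsqZ a u : H u -> nsq q (a *: u) = cm a ^+ 2 * nsq q u.
Proof.
by move=> hu; rewrite /nsq formZl ?formZr ?mulrA ?mulJ ?RpartZ //; apply: memZ.
Qed.
Lemma nsqN u : H u -> nsq q (- u) = nsq q u.
Proof. by move=> hu; rewrite -scaleN1r nsqZ // cmN cm1 expr1n mul1r. Qed.
Lemma nsqB u v : H u -> H v ->
  nsq q (u - v) = nsq q u - 2 * Rpart (q u v) + nsq q v.
Proof.
move=> hu hv; rewrite nsqD ?nsqN ?formNr ?raddfN //=; last exact: memN.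
by rewrite mulrN.
Qed.
Lemma nsqBC u v : H u -> H v -> nsq q (u - v) = nsq q (v - u).
Proof. by move=> hu hv; rewrite -opprB nsqN //; apply: memB. Qed.
Lemma parallelogram u v : H u -> H v ->
  nsq q (u + v) + nsq q (u - v) = 2 * nsq q u + 2 * nsq q v.
Proof. by move=> hu hv; rewrite nsqD // nsqB //; ring. Qed.
Lemma nsqD_le u v : H u -> H v -> nsq q (u + v) <= 2 * nsq q u + 2 * nsq q v.
Proof.
move=> hu hv; rewrite -parallelogram // lerDl nsq_ge0 //; exact: memB.
Qed.
Lemma nsqB_le u v w : H u -> H v -> H w ->
  nsq q (u - v) <= 2 * nsq q (u - w) + 2 * nsq q (v - w).
Proof.
move=> hu hv hw; have := nsqD_le (memB hu hw) (memN (memB hv hw)).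
by rewrite nsqN ?opprB ?addrA ?subrK //; apply: memB.
Qed.

(** The square norm of u - s q(u, v) v is a nonnegative polynomial in the real
    number s. As q may be degenerate, the minimizing value s = 1 / q(v, v) has to
    be replaced by a large s when q(v, v) = 0. *)
Lemma cauchy_schwarz u v : H u -> H v ->
  cm (q u v) ^+ 2 <= nsq q u * nsq q v.
Proof.
move=> hu hv; set b := cm (q u v) ^+ 2; set a := nsq q u; set c := nsq q v.
have key s : 0 <= a - 2 * s * b + s ^+ 2 * b * c.
  have hw : H ((ofR s * q u v) *: v) by apply: memZ.
  have := nsq_ge0 (memB hu hw); rewrite nsqB // nsqZ // formZr //.
  rewrite rmorphM /= conj_ofR -mulrA [_^* * _]mulrC mulJ -rmorphM Rpart_ofR.
  by rewrite cmM cm_ofR exprMn real_normK ?num_real // -/a -/b -/c mulrA.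
have b0 : 0 <= b by apply: sqr_ge0.
have c0 : 0 <= c by apply: nsq_ge0.
have a0 : 0 <= a by apply: nsq_ge0.
have [c_eq0|cN0] := eqVneq c 0.
  rewrite c_eq0 mulr0 leNgt; apply/negP => bgt0.
  have := key ((a + 1) / (2 * b)); rewrite c_eq0 mulr0 addr0.
  have -> : 2 * ((a + 1) / (2 * b)) * b = a + 1 by field; lra.
  by rewrite leNgt => /negP; apply; lra.
have cgt0 : 0 < c by rewrite lt_neqAle eq_sym cN0.
have := key c^-1.
have -> : a - 2 * c^-1 * b + c^-1 ^+ 2 * b * c = (a * c - b) / c by field.
by rewrite pmulr_lge0 ?invr_gt0 // subr_ge0.
Qed.

End HermitianForms.

(** * Hilbert subspaces and orthonormal families *)

Lemma decr_cauchy (R : realType) (a : nat -> R) :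
  (forall n, 0 <= a n) -> (forall n, a n.+1 <= a n) ->
  forall eps : R, 0 < eps ->
  exists N, forall p q, (N <= p)%N -> (N <= q)%N -> a p <= a q + eps.
Proof.
move=> a0 adecr eps eps0.
have hi : has_inf (range a).
  by split; [exists (a 0%N), 0%N|exists 0 => _ [n _ <-]].
have [_ [N _ <-] hN] := inf_adherent eps0 hi.
have amono m n : (m <= n)%N -> a n <= a m.
  move=> /subnK <-; elim: (n - m)%N => [//|k IH].
  by rewrite addSn; apply: le_trans IH.
exists N => p q Np Nq; apply: (le_trans (amono _ _ Np)).
apply: (le_trans (ltW hN)); rewrite lerD2r.
by apply: ge_inf; [case: hi|exists q].
Qed.

Section HilbertSpaces.
Variables (R : realType) (V : lmodType (Cplx R)).
Local Notation C := (Cplx R).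
Variable ip : V -> V -> C.
Implicit Types (H : set V) (u v w : V) (f : nat -> V).

(** Completeness is required of sequences only and in terms of the square norm,
    so that V carries no topology. *)
Record hilbert_on H : Prop := HilbertOn {
  hilb_herm : hermitian_on H ip;
  hilb_eq0 : forall u, H u -> ip u u = 0 -> u = 0;
  hilb_complete : forall x : nat -> V, (forall n, H (x n)) ->
    (forall eps : R, 0 < eps -> exists N, forall p q, (N <= p)%N -> (N <= q)%N ->
      nsq ip (x p - x q) <= eps) ->
    exists2 l, H l & forall eps : R, 0 < eps ->
      exists N, forall p, (N <= p)%N -> nsq ip (x p - l) <= eps }.

Lemma nsq_eq0 H u : hilbert_on H -> H u -> nsq ip u <= 0 -> u = 0.
Proof.
move=> hH Hu h; apply: (hilb_eq0 hH) => //.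
rewrite (nsqE (hilb_herm hH)) //; apply/eqP; rewrite fmorph_eq0.
by rewrite eq_le h (nsq_ge0 (hilb_herm hH)).
Qed.

Lemma normalize H u : hilbert_on H -> H u -> u <> 0 ->
  exists a : R, 0 < a /\ nsq ip (ofR a *: u) = 1.
Proof.
move=> hH Hu u0; have n0 : 0 < nsq ip u.
  by rewrite ltNge; apply/negP => /(nsq_eq0 hH Hu).
exists (Num.sqrt (nsq ip u))^-1; rewrite invr_gt0 sqrtr_gt0 n0; split=> //.
rewrite (nsqZ (hilb_herm hH)) // cm_ofR ger0_norm ?invr_ge0 ?sqrtr_ge0 //.
by rewrite exprVn sqr_sqrtr ?ltW // mulVf // gt_eqF.
Qed.

(** Each cross term 2 Re <f_i, f_j> is at most |f_i|^2 + |f_j|^2. *)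
Lemma nsq_sum_le H (m : nat) f : hermitian_on H ip ->
  (forall i, (i < m)%N -> H (f i)) ->
  nsq ip (\sum_(i < m) f i) <= m%:R * \sum_(i < m) nsq ip (f i).
Proof.
move=> hH Hf.
have hs : H (\sum_(i < m) f i) by apply: (mem_sum hH) => i _; exact: Hf.
have -> : nsq ip (\sum_(i < m) f i) = \sum_(i < m) \sum_(j < m) Rpart (ip (f i) (f j)).
  rewrite /nsq (form_suml hH) //; last by move=> i _; exact: Hf.
  rewrite raddf_sum /=; apply: eq_bigr => i _.
  rewrite (form_sumr hH) ?raddf_sum //; [by move=> j _; exact: Hf|exact: Hf].
apply: (@le_trans _ _ (\sum_(i < m) \sum_(j < m)
   (2^-1 * nsq ip (f i) + 2^-1 * nsq ip (f j)))).
  apply: ler_sum => i _; apply: ler_sum => j _.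
  have Hi := Hf i (ltn_ord i); have Hj := Hf j (ltn_ord j).
  have := nsq_ge0 hH (memB hH Hi Hj).
  by rewrite (nsqB hH) //; lra.
under eq_bigr do rewrite big_split /= sumr_const card_ord -mulr_sumr.
rewrite big_split /= sumr_const card_ord sumrMnl -mulr_sumr.
set S := \sum_(i < m) nsq ip (f i).
by rewrite -mulrnDl -[leLHS]mulr_natl ler_wpM2l // [leRHS]splitr; lra.
Qed.

Definition orthonormal H f m :=
  (forall i, (i < m)%N -> H (f i)) /\
  forall i j, (i < m)%N -> (j < m)%N -> ip (f i) (f j) = (i == j)%:R.

Section Projection.
Variables (H : set V) (f : nat -> V) (m : nat).
Hypotheses (hH : hermitian_on H ip) (hf : orthonormal H f m).

Lemma mem_comb (c : nat -> C) : H (\sum_(i < m) c i *: f i).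
Proof. by apply: (mem_sum hH) => i _; apply: (memZ hH); exact: hf.1. Qed.

Lemma form_comb (c : nat -> C) j : (j < m)%N ->
  ip (\sum_(i < m) c i *: f i) (f j) = c j.
Proof.
move=> jm; rewrite (form_suml hH); last 2 first.
- by move=> i _; apply: (memZ hH); exact: hf.1.
- exact: hf.1.
rewrite (bigD1 (Ordinal jm)) //= (formZl hH) ?hf.2 ?eqxx ?mulr1 //; try exact: hf.1.
rewrite big1 ?addr0 // => i ij; rewrite (formZl hH) ?hf.2 ?mulr0 //; try exact: hf.1.
by rewrite -[j]/(val (Ordinal jm)) val_eqE (negbTE ij) mulr0.
Qed.

Lemma nsq_comb (c : nat -> C) :
  nsq ip (\sum_(i < m) c i *: f i) = \sum_(i < m) cm (c i) ^+ 2.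
Proof.
rewrite /nsq (form_sumr hH); last 2 first.
- by move=> i _; apply: (memZ hH); exact: hf.1.
- exact: mem_comb.
rewrite raddf_sum /=; apply: eq_bigr => i _.
rewrite (formZr hH) ?form_comb //; [|exact: hf.1|exact: mem_comb].
by rewrite mulrC mulJ.
Qed.

Definition proj u := \sum_(i < m) ip u (f i) *: f i.

Lemma mem_proj u : H (proj u).
Proof. exact: (mem_comb (fun i => ip u (f i))). Qed.

Lemma proj_orth u j : H u -> (j < m)%N -> ip (u - proj u) (f j) = 0.
Proof.
move=> Hu jm; rewrite (formBl hH) //; [|exact: mem_proj|exact: hf.1].
by rewrite /proj (form_comb (fun i => ip u (f i))) // subrr.
Qed.

Lemma proj_pythagoras u : H u ->
  nsq ip u = \sum_(i < m) cm (ip u (f i)) ^+ 2 + nsq ip (u - proj u).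
Proof.
move=> Hu; rewrite -(nsq_comb (fun i => ip u (f i))) -/(proj u).
have Hp := mem_proj u; have Hup := memB hH Hu Hp.
rewrite -{1}[u](subrK (proj u)) (nsqD hH Hup Hp).
suff -> : ip (u - proj u) (proj u) = 0 by rewrite raddf0; ring.
rewrite (form_sumr hH) //; last by move=> i _; apply: (memZ hH); exact: hf.1.
rewrite big1 // => i _; rewrite (formZr hH) ?proj_orth ?mulr0 //; exact: hf.1.
Qed.

Lemma proj_le u : H u -> nsq ip (u - proj u) <= nsq ip u.
Proof.
by move=> Hu; rewrite [leRHS]proj_pythagoras // lerDr sumr_ge0 // => i _; exact: sqr_ge0.
Qed.

Lemma bessel u : H u -> \sum_(i < m) cm (ip u (f i)) ^+ 2 <= nsq ip u.
Proof.
move=> Hu; rewrite [leRHS]proj_pythagoras // lerDl (nsq_ge0 hH) //.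
by apply: (memB hH) => //; exact: mem_proj.
Qed.

Lemma orthonormal_extend u : H u -> nsq ip u = 1 ->
  (forall i, (i < m)%N -> ip u (f i) = 0) ->
  orthonormal H (fun i => if i == m then u else f i) m.+1.
Proof.
move=> Hu u1 uf; split=> [i|i j]; rewrite !ltnS.
  by case: eqVneq => // im le; apply: hf.1; rewrite ltn_neqAle im.
move=> im jm; have [iem|inm] := eqVneq i m; have [jem|jnm] := eqVneq j m.
- by rewrite iem jem eqxx (nsqE hH) // u1 rmorph1.
- have jm' : (j < m)%N by rewrite ltn_neqAle jnm.
  by rewrite uf // iem eq_sym (negbTE jnm).
- have im' : (i < m)%N by rewrite ltn_neqAle inm.
  by rewrite (herm_sym hH Hu (hf.1 _ im')) uf // rmorph0 jem (negbTE inm).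
- by apply: hf.2; rewrite ltn_neqAle ?inm ?jnm.
Qed.

End Projection.

(** A bound on the size of orthonormal families in P makes P fail on the unit
    vectors orthogonal to a suitable finite family: take one of maximal size. *)
Lemma max_orthonormal H (P : V -> Prop) M : hermitian_on H ip ->
  (forall f m, orthonormal H f m -> (forall i, (i < m)%N -> P (f i)) -> (m <= M)%N) ->
  exists f m, [/\ orthonormal H f m, forall i, (i < m)%N -> P (f i) &
    forall u, H u -> nsq ip u = 1 -> (forall i, (i < m)%N -> ip u (f i) = 0) -> ~ P u].
Proof.
move=> hH hM.
pose Q m := `[< exists f, orthonormal H f m /\ forall i, (i < m)%N -> P (f i) >].
have exQ : exists m, Q m by exists 0%N; apply/asboolP; exists (fun=> 0); split=> //; split.
have boundQ m : Q m -> (m <= M)%N by move=> /asboolP[f [hf Pf]]; exact: hM hf Pf.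
case: (ex_maxnP exQ boundQ) => m /asboolP[f [hf Pf]] hmax.
exists f, m; split=> // u Hu u1 uf Pu.
suff /hmax : Q m.+1 by rewrite ltnn.
apply/asboolP; exists (fun i => if i == m then u else f i); split.
  exact: orthonormal_extend.
move=> i; rewrite ltnS; case: eqVneq => // im le; apply: Pf.
by rewrite ltn_neqAle im.
Qed.

(** Orthogonality to given vectors passes to limits by Cauchy-Schwarz. The next
    eigenvector of an operator is found by working in such a complement. *)
Lemma orthc_hilbert H f n : hilbert_on H -> (forall i, (i < n)%N -> H (f i)) ->
  hilbert_on [set u | H u /\ forall i, (i < n)%N -> ip u (f i) = 0].
Proof.
move=> hH Hf; have hh := hilb_herm hH; split.
- split.
  + by split=> [|i im]; [exact: herm_mem0 hh|rewrite (form0l hh) //; exact: Hf].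
  + move=> a u v [Hu uf] [Hv vf]; split=> [|i im]; first exact: (herm_memL hh).
    by rewrite (herm_lin hh) ?uf ?vf ?mulr0 ?addr0 //; exact: Hf.
  + by move=> a u v w [Hu _] [Hv _] [Hw _]; exact: (herm_lin hh).
  + by move=> u v [Hu _] [Hv _]; exact: (herm_sym hh).
  + by move=> u [Hu _]; exact: (herm_ge0 hh).
- by move=> u [Hu _]; exact: (hilb_eq0 hH).
- move=> x Hx /(hilb_complete hH)[|l Hl lx]; first by move=> k; case: (Hx k).
  exists l => //; split=> // i im; have Hfi := Hf i im.
  apply: cm_eq0; apply/eqP; rewrite -sqrf_eq0 eq_le sqr_ge0 andbT.
  apply/ler_addgt0Pl => eps e0; rewrite addr0.
  have [|N /(_ N (leqnn N)) hN] := lx (eps / (nsq ip (f i) + 1)).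
    by rewrite divr_gt0 // ltr_wpDl // (nsq_ge0 hh).
  have [HxN xN0] := Hx N.
  have := cauchy_schwarz hh (memB hh HxN Hl) Hfi.
  rewrite (formBl hh) // xN0 // sub0r cmN => /le_trans; apply.
  have f0 := nsq_ge0 hh Hfi.
  apply: (@le_trans _ _ (eps / (nsq ip (f i) + 1) * (nsq ip (f i) + 1))).
    apply: ler_pM => //; last by lra.
    by apply: (nsq_ge0 hh); exact: (memB hh).
  by rewrite divfK // gt_eqF //; lra.
Qed.

End HilbertSpaces.

(** * Linear operators and iterates of positive contractions *)

Lemma uniform_index (m : nat) (P : nat -> nat -> Prop) :
  (forall i, (i < m)%N -> exists N, forall n, (N <= n)%N -> P i n) ->
  exists N, forall i n, (i < m)%N -> (N <= n)%N -> P i n.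
Proof.
elim: m => [|m IH] h; first by exists 0%N.
have [i im|N1 h1] := IH; first by apply: h; apply: ltnW.
have [N2 h2] := h m (ltnSn m).
exists (maxn N1 N2) => i n; rewrite ltnS leq_eqVlt geq_max => /orP[/eqP->|im] /andP[? ?].
  exact: h2.
exact: h1.
Qed.

Section Operators.
Variables (R : realType) (V : lmodType (Cplx R)).
Local Notation C := (Cplx R).
Variable ip : V -> V -> C.
Implicit Types (H : set V) (u v w : V) (f : nat -> V) (B : V -> V).

Section Linear.
Variables (H : set V) (B : V -> V).
Hypotheses (hH : hermitian_on H ip) (hB : operator_on H B).

Lemma opD u v : H u -> H v -> B (u + v) = B u + B v.
Proof. by move=> Hu Hv; rewrite -{1}[u]scale1r hB.2 // scale1r. Qed.
Lemma op0 : B 0 = 0.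
Proof.
have := opD (herm_mem0 hH) (herm_mem0 hH).
by rewrite addr0 => /esym/eqP; rewrite -subr_eq0 addrK => /eqP.
Qed.
Lemma opZ a u : H u -> B (a *: u) = a *: B u.
Proof.
move=> Hu; rewrite -[a *: u]addr0 hB.2 ?op0 ?addr0 //; exact: (herm_mem0 hH).
Qed.
Lemma opN u : H u -> B (- u) = - B u.
Proof. by move=> Hu; rewrite -scaleN1r opZ // scaleN1r. Qed.
Lemma opB u v : H u -> H v -> B (u - v) = B u - B v.
Proof.
by move=> Hu Hv; rewrite opD ?opN //; exact: (memN hH).
Qed.
Lemma op_sum m f : (forall i, (i < m)%N -> H (f i)) ->
  B (\sum_(i < m) f i) = \sum_(i < m) B (f i).
Proof.
elim: m => [|m IH] hf; first by rewrite !big_ord0 op0.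
have hf' i : (i < m)%N -> H (f i) by move=> im; apply: hf; apply: ltnW.
have hs : H (\sum_(i < m) f i) by apply: (mem_sum hH) => i _; apply: hf'.
by rewrite !big_ord_recr /= opD ?IH //; exact: hf.
Qed.
Lemma op_comb m (c : nat -> C) f : (forall i, (i < m)%N -> H (f i)) ->
  B (\sum_(i < m) c i *: f i) = \sum_(i < m) c i *: B (f i).
Proof.
move=> hf; rewrite (op_sum (f := fun i => c i *: f i)).
  by apply: eq_bigr => i _; rewrite opZ //; exact: hf.
by move=> i im; apply: (memZ hH); exact: hf.
Qed.
Lemma op_iter n : operator_on H (iter n B).
Proof.
elim: n => [|n [h1 h2]]; first by split.
by split=> [u Hu|a u v Hu Hv] /=; [apply: hB.1; exact: h1|rewrite h2 // hB.2 //; exact: h1].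
Qed.

End Linear.

Lemma pos_hermitian H B : hermitian_on H ip -> positive_operator H ip B ->
  hermitian_on H (fun u v => ip (B u) v).
Proof.
move=> hH [[opBH _ symB] posB]; split.
- exact: herm_mem0 hH.
- exact: herm_memL hH.
- by move=> a u v w Hu Hv Hw; rewrite opBH.2 // (herm_lin hH) //; exact: opBH.1.
- by move=> u v Hu Hv; rewrite symB // (herm_sym hH) //; exact: opBH.1.
- exact: posB.
Qed.

Lemma pos_scale H B a : hermitian_on H ip -> positive_operator H ip B -> 0 <= a ->
  positive_operator H ip (fun u => ofR a *: B u).
Proof.
move=> hH [[opBH _ symB] posB] a0.
have op : operator_on H (fun u => ofR a *: B u).
  split=> [u Hu|b u v Hu Hv]; first by apply: (memZ hH); exact: opBH.1.
  by rewrite opBH.2 // scalerDr !scalerA mulrC.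
split; first split => //.
  move=> u v Hu Hv; rewrite (formZl hH) ?(formZr hH) ?conj_ofR ?symB //; exact: opBH.1.
by move=> u Hu; rewrite (formZl hH) ?mulr_ge0 ?ofR_ge0 ?posB //; exact: opBH.1.
Qed.

Section Contraction.
Variables (H : set V) (T : V -> V).
Hypotheses (hH : hilbert_on ip H) (posT : positive_operator H ip T).
Local Notation qT := (fun u v => ip (T u) v).
Hypothesis T1 : forall u, H u -> nsq qT u <= nsq ip u.
Let hh := hilb_herm hH.
Let opT := let: And3 a _ _ := posT.1 in a.
Let symT := let: And3 _ _ a := posT.1 in a.
Let hT := pos_hermitian hh posT.

(** By Cauchy-Schwarz for the form <T u, v> at u and T u,
    |T u|^4 <= <T u, u> <T T u, T u> <= <T u, u> |T u|^2. *)
Lemma contr_nsq u : H u -> nsq ip (T u) <= nsq qT u.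
Proof.
move=> Hu; have HTu := opT.1 _ Hu.
have := cauchy_schwarz hT Hu HTu; have := T1 HTu.
rewrite (nsqE hh HTu) cm_ofR ger0_norm ?(nsq_ge0 hh) //.
have := nsq_ge0 hh HTu; have := nsq_ge0 hT Hu; have := nsq_ge0 hT HTu.
move: (nsq ip (T u)) (nsq qT u) (nsq qT (T u)) => t a b b0 a0 t0 bt h.
have [->//|tN0] := eqVneq t 0.
have tgt0 : 0 < t by rewrite lt_neqAle eq_sym tN0.
by rewrite -(ler_pM2r tgt0) -expr2 (le_trans h) // ler_wpM2l.
Qed.

Lemma mem_iter n u : H u -> H (iter n T u).
Proof. exact: (op_iter opT n).1. Qed.

Lemma iter_sym n u v : H u -> H v -> ip (iter n T u) v = ip u (iter n T v).
Proof.
elim: n u v => [//|n IH] u v Hu Hv.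
by rewrite iterSr IH //; [rewrite symT // ?iterS //; exact: mem_iter|exact: opT.1].
Qed.

Let a u k := Rpart (ip (iter k T u) u).

Lemma form_iter m n u : H u -> Rpart (ip (iter m T u) (iter n T u)) = a u (m + n).
Proof.
move=> Hu; have Hm := mem_iter m Hu.
by rewrite -(iter_sym n Hm Hu) -iterD addnC.
Qed.

Lemma iter_form_even k u : H u -> a u (k + k) = nsq ip (iter k T u).
Proof. by move=> Hu; rewrite -form_iter. Qed.
Lemma iter_form_odd k u : H u -> a u (k + k).+1 = nsq qT (iter k T u).
Proof. by move=> Hu; rewrite -addSn -form_iter. Qed.

Lemma iter_form_ge0 k u : H u -> 0 <= a u k.
Proof.
move=> Hu; rewrite -[k]odd_double_half -addnn; case: (odd k); rewrite ?add0n ?add1n.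
  by rewrite iter_form_odd ?(nsq_ge0 hT) //; exact: mem_iter.
by rewrite iter_form_even ?(nsq_ge0 hh) //; exact: mem_iter.
Qed.

(** According to the parity of k, <T^k u, u> is |x|^2 or <T x, x> with
    x = T^(k/2) u, and |T x|^2 <= <T x, x> <= |x|^2. *)
Lemma iter_form_decr k u : H u -> a u k.+1 <= a u k.
Proof.
move=> Hu; rewrite -[k]odd_double_half -addnn; case: (odd k); rewrite ?add0n ?add1n.
  rewrite iter_form_odd // -addSn -addnS iter_form_even //= contr_nsq //.
  exact: mem_iter.
by rewrite iter_form_odd // iter_form_even // T1 //; exact: mem_iter.
Qed.

Lemma iter_form_mono k l u : H u -> (k <= l)%N -> a u l <= a u k.
Proof.
move=> Hu /subnK <-; elim: (l - k)%N => [//|i IH].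
by rewrite addSn; apply: le_trans IH; exact: iter_form_decr.
Qed.

Lemma contr_le u : H u -> nsq ip (T u) <= nsq ip u.
Proof. by move=> Hu; apply: (le_trans (contr_nsq Hu)); exact: T1. Qed.

Lemma iter_le_form n u : H u -> (0 < n)%N -> nsq ip (iter n T u) <= nsq qT u.
Proof.
move=> Hu n0; rewrite -iter_form_even // -[nsq qT u]/(a u 1) iter_form_mono //.
by rewrite ltn_addl.
Qed.

(** With a(k) = <T^k u, u>, a convergent sequence because it decreases,
    |T^p u - T^q u|^2 = a(2p) - 2 a(p+q) + a(2q). So the iterates are a Cauchy
    sequence. *)
Lemma iter_limit u : H u -> exists v, [/\ H v, T v = v &
  forall eps : R, 0 < eps -> exists N, forall n, (N <= n)%N -> nsq ip (iter n T u - v) <= eps].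
Proof.
move=> Hu; have Hi n := mem_iter n Hu.
case: (hilb_complete hH Hi).
  move=> eps e0.
  have e2 : 0 < eps / 2 by rewrite divr_gt0.
  have [N hN] := decr_cauchy (fun k => iter_form_ge0 k Hu)
    (fun k => iter_form_decr k Hu) e2.
  exists N => p q Np Nq.
  rewrite (nsqB hh) // -!iter_form_even // form_iter //.
  have app := leq_trans Np (leq_addr p p); have apq := leq_trans Np (leq_addr q p).
  have aqq := leq_trans Nq (leq_addr q q).
  have := hN _ _ app apq; have := hN _ _ aqq apq; lra.
move=> v Hv hv; exists v; split=> //.
apply/eqP; rewrite -subr_eq0; apply/eqP.
have HTv := opT.1 _ Hv.
apply: (nsq_eq0 hH); first exact: (memB hh).
apply/ler_addgt0Pl => eps e0; rewrite addr0.
have e4 : 0 < eps / 4 by rewrite divr_gt0.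
have [N hN] := hv _ e4.
apply: (le_trans (nsqB_le hh HTv Hv (Hi N.+1))).
have h1 := hN _ (leqnSn N); rewrite (nsqBC hh) // in h1.
have : nsq ip (T v - iter N.+1 T u) <= eps / 4.
  rewrite iterS -(opB hh opT) //; apply: (le_trans (contr_le _)); first exact: (memB hh).
  by rewrite (nsqBC hh) // hN.
by lra.
Qed.

(** For x_n = T^n u - u one has x_(n+1) = T x_n + x_1, whence
    |x_(n+1)|^2 <= 2 |x_n|^2 + 2 |x_1|^2. *)
Lemma iter_dist n u : H u ->
  nsq ip (iter n T u - u) <= 4 ^+ n * nsq ip (T u - u).
Proof.
move=> Hu; elim: n => [|n IH].
  rewrite /= subrr (nsq0 hh) mul1r (nsq_ge0 hh) //; apply: (memB hh) => //; exact: opT.1.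
have HTu := opT.1 _ Hu; have Hn := mem_iter n Hu.
have -> : iter n.+1 T u - u = T (iter n T u - u) + (T u - u).
  by rewrite (opB hh opT) // addrA subrK.
apply: (le_trans (nsqD_le hh _ _)); [apply: opT.1; exact: (memB hh)|exact: (memB hh)|].
have h1 := contr_le (memB hh Hn Hu).
have h2 := nsq_ge0 hh (memB hh HTu Hu).
have h3 : nsq ip (T u - u) <= 4 ^+ n * nsq ip (T u - u).
  by rewrite ler_peMl // exprn_ege1 // ler1n.
rewrite exprS -mulrA; move: IH h1 h3.
move: (nsq _ (T u - u)) (_ ^+ _ * _) (nsq _ (T _)) (nsq _ _) => x y z t.
lra.
Qed.

End Contraction.

End Operators.

(** * The top eigenvector of a positive operator of finite trace *)

Section TopEigen.
Variables (R : realType) (V : lmodType (Cplx R)).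
Local Notation C := (Cplx R).
Variable ip : V -> V -> C.
Implicit Types (H : set V) (u v w : V) (f : nat -> V) (B : V -> V).

Definition trace_bounded H B (K : R) := forall f m, orthonormal ip H f m ->
  \sum_(i < m) nsq (fun u v => ip (B u) v) (f i) <= K.

(** Without a fixed vector, T^n u would tend to 0 for every u. Let f be a maximal
    orthonormal family with <T f_i, f_i> > 1/64, finite because the trace is.
    On the orthogonal complement of f the iterates are small at once, and on the
    span of f they are small for n large; so |T^n u|^2 <= 1/16 for one n and all
    unit vectors u. But a unit vector with <T u, u> close to 1 is almost fixed by
    T, hence by T^n. *)
Lemma contraction_fixed H T K : hilbert_on ip H -> positive_operator H ip T ->
  (forall u, H u -> nsq (fun u v => ip (T u) v) u <= nsq ip u) ->
  trace_bounded H T K ->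
  (forall eta : R, 0 < eta -> exists u, [/\ H u, nsq ip u = 1 &
     1 - eta <= nsq (fun u v => ip (T u) v) u]) ->
  exists2 v, H v & v <> 0 /\ T v = v.
Proof.
move=> hH posT T1 trT near1.
have hh := hilb_herm hH; have opT : operator_on H T by case: posT => -[].
have hT := pos_hermitian hh posT.
apply: contrapT => noFix.
have tends0 u : H u -> forall eps : R, 0 < eps ->
    exists N, forall n, (N <= n)%N -> nsq ip (iter n T u) <= eps.
  move=> Hu; have [v [Hv Tv hv]] := iter_limit hH posT T1 Hu.
  have v0 : v = 0 by apply: contrapT => v0; apply: noFix; exists v.
  move=> eps e0; have [N hN] := hv eps e0; exists N => n /hN.
  by rewrite v0 subr0.
(* small enough for |T^n u|^2 <= 2 e + 2 e <= 1 / 16 below *)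
pose e : R := 64%:R^-1; have e0 : 0 < e by rewrite invr_gt0.
pose P w := e < nsq (fun u v => ip (T u) v) w.
have K0 : 0 <= K.
  have := trT (fun=> 0) 0%N; rewrite big_ord0; apply; split=> //.
have bnd f m : orthonormal ip H f m -> (forall i, (i < m)%N -> P (f i)) ->
    (m <= Num.truncn (64%:R * K))%N.
  move=> hf Pf; rewrite truncn_ge_nat; last by rewrite mulr_ge0.
  rewrite -ler_pdivrMl // -/e; apply: le_trans (trT _ _ hf).
  have -> : e * m%:R = \sum_(i < m) e by rewrite sumr_const card_ord mulr_natr.
  by apply: ler_sum => i _; rewrite ltW //; exact: Pf.
have [f [m [hf _ maxf]]] := max_orthonormal (P := P) hh bnd.
have m2 : 0 < 64%:R * (m%:R * m%:R + 1) :> R.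
  by rewrite mulr_gt0 // ltr_wpDl // mulr_ge0.
have dpos : 0 < (64%:R * (m%:R * m%:R + 1))^-1 :> R by rewrite invr_gt0.
set d := (_^-1) in dpos.
have [N hN] := uniform_index (fun i im => tends0 (f i) (hf.1 i im) d dpos).
pose n := N.+1.
have small u : H u -> nsq ip u = 1 -> nsq ip (iter n T u) <= 16%:R^-1.
  move=> Hu u1; have Hp := mem_proj hh hf u; have Hup := memB hh Hu Hp.
  have opn := op_iter opT n.
  rewrite -{1}[u](subrK (proj ip f m u)) (opD opn) //.
  apply: (le_trans (nsqD_le hh (opn.1 _ Hup) (opn.1 _ Hp))).
  have h1 : nsq ip (iter n T (u - proj ip f m u)) <= e.
    apply: (le_trans (iter_le_form hH posT T1 Hup _)) => //.
    have [->|/eqP up0] := eqVneq (u - proj ip f m u) 0.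
      by rewrite (nsq0 hT) ltW.
    have [a [a0 a1]] := normalize hH Hup up0.
    have := maxf _ (memZ hh (ofR a) Hup) a1; rewrite /P => /(_ _)/negP.
    rewrite -leNgt (nsqZ hT) // cm_ofR => h.
    have {}h : `|a| ^+ 2 * nsq (fun u v => ip (T u) v) (u - proj ip f m u) <= e.
      by apply: h => i im; rewrite (formZl hh) ?(proj_orth hh hf) ?mulr0 //; exact: hf.1.
    have := proj_le hh hf Hu; move: a1; rewrite (nsqZ hh) // cm_ofR u1.
    move: h (nsq_ge0 hT Hup) (nsq_ge0 hh Hup); have := sqr_ge0 `|a|.
    move: (_ ^+ 2) (nsq _ _) (nsq _ _) => s x y s0 h x0 y0 sy y1.
    have s1 : 1 <= s by rewrite -sy ler_piMr.
    by apply: le_trans h; rewrite ler_peMl.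
  have h2 : nsq ip (iter n T (proj ip f m u)) <= e.
    rewrite /proj (op_comb hh opn (fun i => ip u (f i))); last exact: hf.1.
    apply: (le_trans (nsq_sum_le (f := fun i => ip u (f i) *: iter n T (f i)) hh _)).
      by move=> i im; apply: (memZ hh); apply: opn.1; exact: hf.1.
    apply: (@le_trans _ _ (m%:R * \sum_(i < m) d)).
      rewrite ler_wpM2l //; apply: ler_sum => i _.
      have Hfi := hf.1 i (ltn_ord i).
      rewrite (nsqZ hh); last exact: opn.1.
      apply: (@le_trans _ _ (1 * nsq ip (iter n T (f i)))).
        apply: ler_wpM2r; first by rewrite (nsq_ge0 hh) //; exact: opn.1.
        apply: (le_trans (cauchy_schwarz hh Hu Hfi)).
        by rewrite u1 mul1r /nsq hf.2 // eqxx.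
      by rewrite mul1r; apply: hN.
    rewrite sumr_const card_ord -[d *+ m]mulr_natl /d /e invfM.
    rewrite mulrA [_^-1 * _]mulrC mulrA -[leRHS]mul1r ler_wpM2r ?invr_ge0 //.
    by rewrite ler_pdivrMr ?mul1r ?lerDl // ltr_wpDl // mulr_ge0.
  by move: h1 h2; rewrite /e; lra.
(* so that |T u - u|^2 <= 2 - 2 <T u, u> <= e / 4 ^ n in iter_dist *)
have eta0 : 0 < (128%:R * 4 ^+ n)^-1 :> R by rewrite invr_gt0 mulr_gt0 // exprn_gt0.
have [u [Hu u1 hu]] := near1 _ eta0.
have HTu := opT.1 _ Hu; have Hn := mem_iter posT n Hu.
have h1 := iter_dist hH posT T1 n Hu.
have h2 : 4 ^+ n * nsq ip (T u - u) <= e.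
  have fn0 : 0 < 4 ^+ n :> R by rewrite exprn_gt0.
  rewrite -ler_pdivlMl // (nsqB hh) // u1.
  have : nsq ip (T u) <= 1 by rewrite -u1 (contr_le hH posT T1).
  have -> : Rpart (ip (T u) u) = nsq (fun u v => ip (T u) v) u by [].
  move: hu; rewrite invfM /e; set t := (4 ^+ n)^-1; lra.
have h3 := small u Hu u1.
have := nsqB_le hh Hu (herm_mem0 hh) Hn.
rewrite subr0 sub0r (nsqN hh) // (nsqBC hh) // u1.
by move: h1 h2 h3; rewrite /e; lra.
Qed.

(** If lam is the supremum of <B u, u> over the unit vectors, then B / lam
    satisfies the hypotheses of contraction_fixed. *)
Lemma top_eigen H B K u0 : hilbert_on ip H -> positive_operator H ip B ->
  trace_bounded H B K -> H u0 -> 0 < nsq (fun u v => ip (B u) v) u0 ->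
  exists e lam, [/\ H e, nsq ip e = 1, 0 < lam, B e = ofR lam *: e &
    forall u, H u -> nsq (fun u v => ip (B u) v) u <= lam * nsq ip u].
Proof.
move=> hH posB trB Hu0 u0pos.
have hh := hilb_herm hH; have opB_ : operator_on H B by case: posB => -[].
have hB := pos_hermitian hh posB; set qB := (fun u v => ip (B u) v) in hB u0pos *.
pose S := [set nsq qB u | u in [set u | H u /\ nsq ip u = 1]].
have Sbnd : ubound S K.
  move=> _ [u [Hu u1] <-]; have := trB (fun=> u) 1%N; rewrite big_ord1; apply.
  split=> // -[|//] [|//] _ _.
  by rewrite (nsqE hh) // u1 rmorph1.
have u00 : u0 <> 0 by move=> u00; move: u0pos; rewrite u00 (nsq0 hB) ltxx.
have [a [a0 a1]] := normalize hH Hu0 u00.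
have Su : S (nsq qB (ofR a *: u0)).
  by exists (ofR a *: u0) => //; split => //; exact: (memZ hh).
have hS : has_sup S by split; [exists (nsq qB (ofR a *: u0))|exists K].
pose lam := sup S.
have lam0 : 0 < lam.
  apply: lt_le_trans (ub_le_sup hS.2 Su).
  by rewrite (nsqZ hB) // mulr_gt0 // exprn_gt0 // cm_ofR normr_gt0 gt_eqF.
have lamub u : H u -> nsq qB u <= lam * nsq ip u.
  move=> Hu; have [->|/eqP un0] := eqVneq u 0.
    by rewrite (nsq0 hB) (nsq0 hh) mulr0.
  have [b [b0 b1]] := normalize hH Hu un0.
  have : nsq qB (ofR b *: u) <= lam.
    by apply: (ub_le_sup hS.2); exists (ofR b *: u) => //; split => //; exact: (memZ hh).
  move: b1; rewrite (nsqZ hh) // (nsqZ hB) // => b1 h.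
  have c0 : 0 < cm (ofR b) ^+ 2 by rewrite exprn_gt0 // cm_ofR normr_gt0 gt_eqF.
  by rewrite -(ler_pM2l c0) mulrCA b1 mulr1.
pose T u := ofR lam^-1 *: B u.
have lV0 : 0 <= lam^-1 by rewrite invr_ge0 ltW.
have posT : positive_operator H ip T by exact: pos_scale.
have qTE u : H u -> nsq (fun u v => ip (T u) v) u = lam^-1 * nsq qB u.
  by move=> Hu; rewrite /nsq (formZl hh) ?RpartZ //; exact: opB_.1.
have [|||v Hv [v0 Tv]] := @contraction_fixed H T (lam^-1 * K) hH posT.
- by move=> u Hu; rewrite qTE // ler_pdivrMl // lamub.
- move=> f m hf.
  have -> : \sum_(i < m) nsq (fun u v => ip (T u) v) (f i) =
            lam^-1 * \sum_(i < m) nsq qB (f i).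
    by rewrite mulr_sumr; apply: eq_bigr => i _; rewrite qTE //; exact: hf.1.
  by rewrite ler_wpM2l // trB.
- move=> eta eta0.
  have [_ [u [Hu u1] <-] hu] := sup_adherent (mulr_gt0 lam0 eta0) hS.
  exists u; split=> //; rewrite qTE // ler_pdivlMl //.
  by rewrite mulrBr mulr1 ltW.
have [b [b0 b1]] := normalize hH Hv v0.
exists (ofR b *: v), lam; split=> //; first exact: (memZ hh).
rewrite (opZ hh opB_) // -{2}Tv /T !scalerA -mulrA mulrCA -rmorphM /=.
by rewrite mulfV ?gt_eqF // rmorph1 mulr1.
Qed.

End TopEigen.

(** * Riesz representation *)

Lemma le_of_sqr (R : realDomainType) (a b : R) : 0 <= b -> a ^+ 2 <= b ^+ 2 -> a <= b.
Proof.
move=> b0; rewrite -[a ^+ 2]real_normK ?num_real // ler_sqr ?nnegrE //.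
exact: le_trans (ler_norm a).
Qed.

Section Adjoint.
Variables (R : realType) (V : lmodType (Cplx R)).
Local Notation C := (Cplx R).
Variable ip : V -> V -> C.
Implicit Types (H : set V) (u v w : V) (f : nat -> V) (B : V -> V).

Definition strong_limit (x : nat -> V) l := forall eps : R, 0 < eps ->
  exists N, forall n, (N <= n)%N -> nsq ip (x n - l) <= eps.

Lemma strong_limit_form H x l v : hermitian_on H ip -> (forall n, H (x n)) -> H l ->
  H v -> strong_limit x l -> forall eps : R, 0 < eps ->
  exists N, forall n, (N <= n)%N -> cm (ip (x n) v - ip l v) <= eps.
Proof.
move=> hh Hx Hl Hv hx eps e0; have v0 := nsq_ge0 hh Hv.
have vp : 0 < nsq ip v + 1 by rewrite ltr_wpDl.
have [|N hN] := hx (eps ^+ 2 / (nsq ip v + 1)); first by rewrite divr_gt0 // exprn_gt0.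
exists N => n /hN h; rewrite -(formBl hh) //.
have Hxl := memB hh (Hx n) Hl.
apply: (le_of_sqr (ltW e0)); apply: (le_trans (cauchy_schwarz hh Hxl Hv)).
apply: (@le_trans _ _ (eps ^+ 2 / (nsq ip v + 1) * (nsq ip v + 1))).
  by apply: ler_pM => //; [exact: (nsq_ge0 hh)|rewrite lerDl].
by rewrite divfK // gt_eqF.
Qed.

Lemma quadratic_ge0 (b c : R) : (forall t, 0 <= t * b + t ^+ 2 * c) -> 0 <= c -> b = 0.
Proof.
move=> h c0; have := h (- b / (c + 1)).
have cp : 0 < c + 1 by rewrite ltr_wpDl.
have -> : - b / (c + 1) * b + (- b / (c + 1)) ^+ 2 * c = - (b / (c + 1)) ^+ 2.
  by field; rewrite gt_eqF.
rewrite oppr_ge0 => h1; have /eqP : (b / (c + 1)) ^+ 2 == 0 by rewrite eq_le h1 sqr_ge0.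
move/eqP; rewrite sqrf_eq0 mulf_eq0 invr_eq0 [c + 1 == 0]gt_eqF // orbF => /eqP //.
Qed.

(** The functional J(u) = |u|^2 - 2 Re L(u) is bounded below, and its minimizing
    sequences are Cauchy by the parallelogram identity. At their limit s the
    inequality J(s) <= J(s + t w) for all real t gives Re L(w) = Re <w, s>. *)
Lemma riesz H (L : V -> C) K : hilbert_on ip H -> 0 <= K ->
  (forall (a : C) u v, H u -> H v -> L (a *: u + v) = a * L u + L v) ->
  (forall u, H u -> cm (L u) ^+ 2 <= K * nsq ip u) ->
  exists2 s, H s & forall u, H u -> L u = ip u s.
Proof.
move=> hH K0 linL bndL; have hh := hilb_herm hH.
have LD u v : H u -> H v -> L (u + v) = L u + L v.
  by move=> *; rewrite -{1}[u]scale1r linL // mul1r.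
have H0 := herm_mem0 hh.
have L0 : L 0 = 0.
  by have := LD 0 0 H0 H0; rewrite addr0 => /esym/eqP; rewrite -subr_eq0 addrK => /eqP.
have LZ a u : H u -> L (a *: u) = a * L u.
  by move=> Hu; rewrite -[_ *: _]addr0 linL // L0 addr0.
pose J u := nsq ip u - 2 * Rpart (L u).
have Jlb u : H u -> - K <= J u.
  move=> Hu; have := bndL u Hu; have := nsq_ge0 hh Hu; have := Rpart_le (L u).
  rewrite /J; move: (cm _) (nsq _ _) => t n.
  move=> rt n0 tK; have {rt}rt : Rpart (L u) <= t := le_trans (ler_norm _) rt.
  suff : 2 * t <= K + n by lra.
  apply: le_of_sqr; first by rewrite addr_ge0.
  have : 0 <= (K - n) ^+ 2 by exact: sqr_ge0.
  by rewrite sqrrB sqrrD exprMn; lra.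
pose S := [set J u | u in H].
have hS : has_inf S.
  split; first by exists (J 0), 0.
  by exists (- K) => _ [u Hu <-]; exact: Jlb.
pose m := inf S.
have mJ u : H u -> m <= J u by move=> Hu; apply: (ge_inf hS.2); exists u.
have /choice[x hx] : forall n, exists u, H u /\ J u < m + n.+1%:R^-1.
  move=> n; have n0 : 0 < n.+1%:R^-1 :> R by rewrite invr_gt0.
  by have [_ [u Hu <-] hu] := inf_adherent n0 hS; exists u.
have Hx n := (hx n).1.
have dist p q : nsq ip (x p - x q) <= 2 * p.+1%:R^-1 + 2 * q.+1%:R^-1.
  have Hs := memD hh (Hx p) (Hx q).
  have := mJ _ (memZ hh (ofR 2^-1) Hs).
  rewrite /J (nsqZ hh) // LZ // RpartZ LD // raddfD /=.
  have := parallelogram hh (Hx p) (Hx q).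
  have := (hx p).2; have := (hx q).2; rewrite /J cm_ofR ger0_norm ?invr_ge0 //.
  have -> : (2^-1) ^+ 2 = 4^-1 :> R by field.
  move: (nsq _ (_ + _)) (nsq _ (_ - _)) (nsq _ _) (nsq _ _) (Rpart _) (Rpart _) (_^-1) (_^-1).
  move=> s1 s2 a b c e g h; lra.
have inv_small (eps : R) : 0 < eps -> exists N, forall n, (N <= n)%N -> n.+1%:R^-1 <= eps.
  move=> e0; exists (Num.truncn eps^-1) => n Nn.
  rewrite -[leRHS]invrK lef_pV2 ?posrE ?invr_gt0 ?ltr0n //.
  by rewrite ltW // -truncn_lt_nat ?invr_ge0 ?ltW // ltnS.
have [|s Hs hs] := hilb_complete hH Hx.
  move=> eps e0; have [|N hN] := inv_small (eps / 4); first by rewrite divr_gt0.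
  exists N => p q /hN + /hN; move: (dist p q).
  by move: (p.+1%:R^-1) (q.+1%:R^-1) => a b; lra.
exists s => // v Hv.
have Req w : H w -> Rpart (L w) = Rpart (ip w s).
  move=> Hw; pose b := 2 * (Rpart (ip w s) - Rpart (L w)).
  suff : b = 0 by rewrite /b; lra.
  apply: (quadratic_ge0 (c := nsq ip w)); last exact: (nsq_ge0 hh).
  move=> t; apply/ler_addgt0Pl => eps e0.
  have t0 : 0 < 2 * `|t| + 1 by rewrite ltr_wpDl // mulr_ge0.
  have e20 : 0 < eps / 2 by rewrite divr_gt0.
  have [N1 h1] := strong_limit_form hh Hx Hs Hw hs (divr_gt0 e20 t0).
  have [|N2 h2] := inv_small (eps / 4); first by rewrite divr_gt0.
  pose n := maxn N1 N2.
  have {}h1 := h1 n (leq_maxl _ _); have {}h2 := h2 n (leq_maxr _ _).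
  have Htw := memZ hh (ofR t) Hw; have Hn := Hx n.
  have := mJ _ (memD hh Hn Htw); have := (hx n).2.
  rewrite /J (nsqD hh) // (nsqZ hh) // (formZr hh) // conj_ofR LD // LZ //.
  rewrite raddfD /= !RpartZ cm_ofR real_normK ?num_real //.
  rewrite /b (herm_sym hh Hs Hw) Rpart_conj.
  have : t * (Rpart (ip (x n) w) - Rpart (ip s w)) <= eps / 4.
    rewrite -raddfB; apply: (le_trans (ler_norm _)); rewrite normrM.
    have /le_trans/(_ h1) h3 := Rpart_le (ip (x n) w - ip s w).
    apply: (le_trans (ler_wpM2l (normr_ge0 t) h3)).
    rewrite mulrA ler_pdivrMr //; have := normr_ge0 t; set a := `|t|.
    by move=> a0; have := mulr_ge0 (ltW e0) a0; lra.
  move: h2; move: (n.+1%:R^-1) (nsq ip w) (t ^+ 2) => a y t2; lra.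
by apply: Cext; rewrite ?Req //; have := Req _ (memZ hh (Ci R) Hv);
  rewrite LZ // (formZl hh) // !CiM /= => /oppr_inj.
Qed.
End Adjoint.

(** * Adjoints and the eigenvalue sequence of a positive operator *)

Section EigenSequence.
Variables (R : realType) (V : lmodType (Cplx R)).
Local Notation C := (Cplx R).
Variable ip : V -> V -> C.
Implicit Types (H : set V) (u v w : V) (f : nat -> V) (B : V -> V).

Lemma form_inj H u v : hilbert_on ip H -> H u -> H v ->
  (forall w, H w -> ip u w = ip v w) -> u = v.
Proof.
move=> hH Hu Hv h; have hh := hilb_herm hH.
have Huv := memB hh Hu Hv.
apply/eqP; rewrite -subr_eq0; apply/eqP/(hilb_eq0 hH) => //.
by rewrite (formBl hh) // h // subrr.
Qed.

Lemma adjoint_exists H T K : hilbert_on ip H -> 0 <= K -> operator_on H T ->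
  (forall u, H u -> nsq ip (T u) <= K * nsq ip u) -> exists S, is_adjoint H ip T S.
Proof.
move=> hH K0 opT bndT; have hh := hilb_herm hH.
have ex v : H v -> exists s, H s /\ forall u, H u -> ip (T u) v = ip u s.
  move=> Hv; have v0 := nsq_ge0 hh Hv.
  have [|||s Hs hs] := @riesz _ _ ip H (fun u => ip (T u) v) (K * nsq ip v) hH.
  - exact: mulr_ge0.
  - by move=> a u w Hu Hw; rewrite opT.2 // (herm_lin hh) //; exact: opT.1.
  - move=> u Hu; apply: (le_trans (cauchy_schwarz hh (opT.1 _ Hu) Hv)).
    by rewrite mulrAC ler_wpM2r // bndT.
  by exists s.
pose S v := xget 0 [set s | H s /\ forall u, H u -> ip (T u) v = ip u s].
have hS v : H v -> H (S v) /\ forall u, H u -> ip (T u) v = ip u (S v).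
  by move=> /ex[s hs]; rewrite /S; case: xgetP => [y _ //|/(_ s)].
exists S; split=> //.
- split=> [v /hS[]//|a u v Hu Hv].
  have [HSu hu] := hS u Hu; have [HSv hv] := hS v Hv.
  have Huv := herm_memL hh a Hu Hv; have [HSuv huv] := hS _ Huv.
  apply: (form_inj hH) => //; first exact: (herm_memL hh).
  move=> w Hw; have HTw := opT.1 _ Hw; have HaSu := memZ hh a HSu.
  rewrite (herm_sym hh Hw HSuv) -huv // (herm_sym hh Hw (memD hh HaSu HSv)).
  rewrite (formDr hh (memZ hh a Hu) Hv HTw) (formZr hh a Hu HTw).
  by rewrite (formDr hh HaSu HSv Hw) (formZr hh a HSu Hw) hu // hv.
- by move=> u v Hu /hS[_ ->].
Qed.

(** The form of S T is <T u, T v>. *)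
Lemma adjoint_square H T S : hermitian_on H ip -> is_adjoint H ip T S ->
  positive_operator H ip (fun u => S (T u)) /\
  forall u, H u -> nsq (fun u v => ip (S (T u)) v) u = nsq ip (T u).
Proof.
move=> hh [opT opS adj].
have adj' u v : H u -> H v -> ip (S u) v = ip u (T v).
  move=> Hu Hv; have HSu := opS.1 _ Hu; have HTv := opT.1 _ Hv.
  by rewrite (herm_sym hh Hv HSu) -adj // -(herm_sym hh HTv Hu).
have op : operator_on H (fun u => S (T u)).
  split=> [u Hu|a u v Hu Hv]; first by apply: opS.1; exact: opT.1.
  by rewrite opT.2 // opS.2 //; exact: opT.1.
split; last by move=> u Hu; rewrite /nsq adj' //; exact: opT.1.
split; first split=> //.
  by move=> u v Hu Hv; rewrite adj' ?adj //; exact: opT.1.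
by move=> u Hu; rewrite adj' ?(herm_ge0 hh) //; exact: opT.1.
Qed.

Lemma orthc_positive H B f (l : nat -> R) n : hermitian_on H ip ->
  positive_operator H ip B -> (forall i, (i < n)%N -> H (f i)) ->
  (forall i, (i < n)%N -> B (f i) = ofR (l i) *: f i) ->
  positive_operator [set u | H u /\ forall i, (i < n)%N -> ip u (f i) = 0] ip B.
Proof.
move=> hh [[opBH _ symB] posB] Hf Bf.
have op : operator_on [set u | H u /\ forall i, (i < n)%N -> ip u (f i) = 0] B.
  split=> [u [Hu uf]|a u v [Hu _] [Hv _]]; last exact: opBH.2.
  split=> [|i im]; first exact: opBH.1.
  by rewrite symB ?Bf ?(formZr hh) ?uf ?mulr0 //; exact: Hf.
split; first by split=> // u v [Hu _] [Hv _]; exact: symB.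
by move=> u [Hu _]; exact: posB.
Qed.

Lemma orthonormal_sub (H H' : set V) f m : H' `<=` H ->
  orthonormal ip H' f m -> orthonormal ip H f m.
Proof. by move=> sub [hf hf']; split=> // i im; apply: sub; exact: hf. Qed.

Section Sequence.
Variables (H : set V) (B : V -> V) (K : R).
Hypotheses (hH : hilbert_on ip H) (posB : positive_operator H ip B).
Hypothesis trB : trace_bounded ip H B K.
Let hh := hilb_herm hH.
Let qB := (fun u v => ip (B u) v).
Let hB : hermitian_on H qB := pos_hermitian hh posB.
Let opB_ : operator_on H B := let: And3 a _ _ := posB.1 in a.

(** Here l is the list of the eigenvectors found so far. *)
Definition top_on (l : seq V) e := exists lam : R,
  [/\ H e /\ (forall i, (i < size l)%N -> ip e (nth 0 l i) = 0),
      nsq ip e = 1, 0 < lam, B e = ofR lam *: e &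
      forall u, H u -> (forall i, (i < size l)%N -> ip u (nth 0 l i) = 0) ->
        nsq qB u <= lam * nsq ip u].

(** The value is 0 once the quadratic form of B vanishes on the complement of l. *)
Definition next_eigen (l : seq V) := xget 0 [set e | top_on l e].

Fixpoint eigen_prefix n := if n is n'.+1
  then rcons (eigen_prefix n') (next_eigen (eigen_prefix n')) else [::].

Definition eigen_seq n := next_eigen (eigen_prefix n).
Definition eigen_val n := nsq qB (eigen_seq n).

Lemma size_eigen_prefix n : size (eigen_prefix n) = n.
Proof. by elim: n => //= n IH; rewrite size_rcons IH. Qed.

Lemma nth_eigen_prefix n i : (i < n)%N -> nth 0 (eigen_prefix n) i = eigen_seq i.
Proof.
elim: n => //= n IH; rewrite ltnS leq_eqVlt nth_rcons size_eigen_prefix.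
by case: ltngtP => //= [im _|-> _ //]; exact: IH.
Qed.

Lemma eigen_seqP n : (eigen_seq n = 0 /\ ~ exists e, top_on (eigen_prefix n) e) \/
  top_on (eigen_prefix n) (eigen_seq n).
Proof.
rewrite /eigen_seq /next_eigen; case: xgetP => [y _ h|h]; first by right.
by left; split=> // -[e he]; exact: (h e).
Qed.

Lemma mem_eigen n : H (eigen_seq n).
Proof.
by case: (eigen_seqP n) => [[-> _]|[l [[]]]] //; exact: (herm_mem0 hh).
Qed.

Lemma eigen_val_ge0 n : 0 <= eigen_val n.
Proof. exact: (nsq_ge0 hB (mem_eigen n)). Qed.

Lemma top_on_val l e : top_on l e -> exists lam, [/\ nsq qB e = lam, 0 < lam,
   B e = ofR lam *: e & forall u, H u ->
   (forall i, (i < size l)%N -> ip u (nth 0 l i) = 0) -> nsq qB u <= lam * nsq ip u].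
Proof.
move=> [lam [[He _] e1 l0 Be hl]]; exists lam; split=> //.
by rewrite /nsq /qB Be (formZl hh) // RpartZ -/(nsq ip e) e1 mulr1.
Qed.

Lemma eigen_seqE n : B (eigen_seq n) = ofR (eigen_val n) *: eigen_seq n.
Proof.
case: (eigen_seqP n) => [[-> _]|/top_on_val[l [e1 _ e2 _]]].
  by rewrite scaler0 (op0 hh opB_).
by rewrite /eigen_val e1.
Qed.

Lemma eigen_orth_lt i n : (i < n)%N -> ip (eigen_seq n) (eigen_seq i) = 0.
Proof.
move=> im; case: (eigen_seqP n) => [[-> _]|[l [[_ h] _ _ _ _]]].
  by rewrite (form0l hh) //; exact: mem_eigen.
by rewrite -(nth_eigen_prefix im) h // size_eigen_prefix.
Qed.

Lemma eigen_orth i j : i != j -> ip (eigen_seq i) (eigen_seq j) = 0.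
Proof.
rewrite neq_ltn => /orP[ij|]; last exact: eigen_orth_lt.
rewrite (herm_sym hh (mem_eigen j) (mem_eigen i)) eigen_orth_lt // rmorph0 //.
Qed.

Lemma eigen_norm n : 0 < eigen_val n -> nsq ip (eigen_seq n) = 1.
Proof.
rewrite /eigen_val; case: (eigen_seqP n) => [[-> _]|[l []//]].
by rewrite (nsq0 hB) ltxx.
Qed.

Lemma eigen_norm_le n : nsq ip (eigen_seq n) <= 1.
Proof.
case: (eigen_seqP n) => [[-> _]|[l [_ -> _ _ _]]] //.
by rewrite (nsq0 hh) ler01.
Qed.

(** If the sequence is 0 at n, the quadratic form of B vanishes on the complement
    of the vectors before n, since top_eigen would supply one more otherwise. *)
Lemma eigen_top n u : H u -> (forall i, (i < n)%N -> ip u (eigen_seq i) = 0) ->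
  nsq qB u <= eigen_val n * nsq ip u.
Proof.
move=> Hu ue; rewrite /eigen_val.
have ue' i : (i < size (eigen_prefix n))%N -> ip u (nth 0 (eigen_prefix n) i) = 0.
  by rewrite size_eigen_prefix => im; rewrite nth_eigen_prefix // ue.
case: (eigen_seqP n) => [[-> no]|/top_on_val[l [-> _ _]]]; last exact.
rewrite (nsq0 hB) mul0r leNgt; apply/negP => upos; apply: no.
have He i : (i < n)%N -> H (eigen_seq i) by move=> _; exact: mem_eigen.
have hH' := orthc_hilbert hH He.
have posB' := orthc_positive hh posB He (fun i _ => eigen_seqE i).
have trB' : trace_bounded ip
    [set u | H u /\ forall i, (i < n)%N -> ip u (eigen_seq i) = 0] B K.
  by move=> f m /(orthonormal_sub (@subIsetl _ _ _)); exact: trB.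
have Hu' : [set u | H u /\ forall i, (i < n)%N -> ip u (eigen_seq i) = 0] u by [].
have [e [lam [[He0 hle] e1 l0 Be top]]] := top_eigen hH' posB' trB' Hu' upos.
have conv w : (forall i, (i < size (eigen_prefix n))%N ->
    ip w (nth 0 (eigen_prefix n) i) = 0) <->
    (forall i, (i < n)%N -> ip w (eigen_seq i) = 0).
  rewrite size_eigen_prefix; split=> h i im; have := h i im;
    by rewrite nth_eigen_prefix.
exists e, lam; split=> //; first by split=> //; apply/conv.
by move=> w Hw /conv hw; exact: top.
Qed.

Lemma eigen_val_decr n : eigen_val n.+1 <= eigen_val n.
Proof.
apply: le_trans (eigen_top (n := n) (mem_eigen n.+1) _) _.
  by move=> i im; rewrite eigen_orth_lt // ltnS ltnW.
by rewrite ler_piMr ?eigen_val_ge0 ?eigen_norm_le.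
Qed.

Lemma eigen_val_mono i j : (i <= j)%N -> eigen_val j <= eigen_val i.
Proof.
move=> /subnK <-; elim: (j - i)%N => [//|k IH].
by rewrite addSn; apply: le_trans IH; exact: eigen_val_decr.
Qed.

Lemma eigen_orthonormal n : (forall i, (i < n)%N -> 0 < eigen_val i) ->
  orthonormal ip H eigen_seq n.
Proof.
move=> pos; split=> [i _|i j im jm]; first exact: mem_eigen.
case: eqVneq => [<-|ij]; last by rewrite eigen_orth.
by rewrite (nsqE hh (mem_eigen i)) eigen_norm ?pos // rmorph1.
Qed.

(** The n eigenvalues before eigen_val n are at least as large, and their sum is
    a partial trace. *)
Lemma eigen_val_bound n : n%:R * eigen_val n <= K.
Proof.
have K0 : 0 <= K.
  by have := trB (f := fun=> 0) (m := 0%N); rewrite big_ord0; apply; split.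
have := eigen_val_ge0 n; rewrite le_eqVlt => /orP[/eqP <-|pos].
  by rewrite mulr0.
have pos' i : (i < n)%N -> 0 < eigen_val i.
  by move=> im; apply: (lt_le_trans pos); apply: eigen_val_mono; exact: ltnW.
apply: le_trans (trB (eigen_orthonormal pos')).
have -> : n%:R * eigen_val n = \sum_(i < n) eigen_val n.
  by rewrite sumr_const card_ord mulr_natl.
by apply: ler_sum => i _; apply: eigen_val_mono; exact: ltnW.
Qed.

End Sequence.
End EigenSequence.

(** * The square root of a positive operator of finite trace *)

Section Limits.
Variables (R : realType) (V : lmodType (Cplx R)).
Local Notation C := (Cplx R).
Variable ip : V -> V -> C.
Implicit Types (H : set V) (u v w : V) (x y : nat -> V) (z : nat -> C).

Definition complex_limit z c := forall eps : R, 0 < eps ->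
  exists N, forall n, (N <= n)%N -> cm (z n - c) <= eps.

Lemma complex_limit_unique z c c' : complex_limit z c -> complex_limit z c' -> c = c'.
Proof.
move=> h h'; apply/eqP; rewrite -subr_eq0; apply/eqP/cm_eq0/eqP.
rewrite eq_le cm_ge0 andbT; apply/ler_addgt0Pl => eps e0; rewrite addr0.
have e2 : 0 < eps / 2 by rewrite divr_gt0.
have [N hN] := h _ e2; have [N' hN'] := h' _ e2.
have := hN _ (leq_maxl N N'); have := hN' _ (leq_maxr N N'); move: (maxn _ _) => n h1 h2.
have -> : c - c' = (z n - c') - (z n - c) by ring.
by apply: (le_trans (cmB _ _)); lra.
Qed.

Lemma complex_limit_ge0 z c : (forall n, 0 <= z n) -> complex_limit z c -> 0 <= c.
Proof.
move=> z0 h; suff [re im] : 0 <= Rpart c /\ Ipart c = 0.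
  by rewrite (CE c) im raddf0 mulr0 addr0 ofR_ge0.
split.
  apply/ler_addgt0Pl => eps e0; have [N /(_ N (leqnn N)) hN] := h _ e0.
  have := le_trans (Rpart_le _) hN; rewrite raddfB /= => /(le_trans (ler_norm _)).
  by have [_] := ge0P (z0 N); lra.
apply/eqP; rewrite -normr_eq0 eq_le normr_ge0 andbT.
apply/ler_addgt0Pl => eps e0; rewrite addr0; have [N /(_ N (leqnn N)) hN] := h _ e0.
have [zE _] := ge0P (z0 N).
by have := le_trans (Ipart_le _) hN; rewrite zE raddfB /= sub0r normrN.
Qed.

Lemma strong_limit_unique H x l l' : hilbert_on ip H -> (forall n, H (x n)) ->
  H l -> H l' -> strong_limit ip x l -> strong_limit ip x l' -> l = l'.
Proof.
move=> hH Hx Hl Hl' h h'; have hh := hilb_herm hH.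
apply: (form_inj hH) => // w Hw; apply: (@complex_limit_unique (fun n => ip (x n) w)).
  exact: (strong_limit_form hh).
exact: (strong_limit_form hh).
Qed.

Lemma strong_limitL H (a : C) x y l k : hermitian_on H ip -> (forall n, H (x n)) ->
  (forall n, H (y n)) -> H l -> H k -> strong_limit ip x l -> strong_limit ip y k ->
  strong_limit ip (fun n => a *: x n + y n) (a *: l + k).
Proof.
move=> hh Hx Hy Hl Hk hx hy eps e0.
have c0 : 0 < 4 * (cm a ^+ 2 + 1) by rewrite mulr_gt0 // ltr_wpDl // sqr_ge0.
have [N1 h1] := hx _ (divr_gt0 e0 c0); have e4 : 0 < eps / 4 by rewrite divr_gt0.
have [N2 h2] := hy _ e4; exists (maxn N1 N2) => n; rewrite geq_max => /andP[/h1 {}h1 /h2 {}h2].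
have -> : a *: x n + y n - (a *: l + k) = a *: (x n - l) + (y n - k).
  by rewrite scalerBr opprD addrACA.
have Hxl := memB hh (Hx n) Hl; have Hyk := memB hh (Hy n) Hk.
apply: (le_trans (nsqD_le hh (memZ hh a Hxl) Hyk)); rewrite (nsqZ hh) //.
have a0 : 0 <= cm a ^+ 2 by exact: sqr_ge0.
have h3 : cm a ^+ 2 * nsq ip (x n - l) <= eps / 4.
  apply: (@le_trans _ _ (cm a ^+ 2 * (eps / (4 * (cm a ^+ 2 + 1))))).
    by rewrite ler_wpM2l.
  rewrite mulrA ler_pdivrMr //; move: a0; move: (cm a ^+ 2) => b b0.
  by have := mulr_ge0 b0 (ltW e0); lra.
by lra.
Qed.

Lemma strong_limit_eventually H x l N : hermitian_on H ip ->
  (forall n, (N <= n)%N -> x n = l) -> strong_limit ip x l.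
Proof.
move=> hh h eps e0; exists N => n Nn.
by rewrite h // subrr (nsq0 hh) ltW.
Qed.

End Limits.

Section SquareRoot.
Variables (R : realType) (V : lmodType (Cplx R)).
Local Notation C := (Cplx R).
Variable ip : V -> V -> C.
Implicit Types (u v w : V).
Variables (H : set V) (B : V -> V) (K : R).
Hypotheses (hH : hilbert_on ip H) (posB : positive_operator H ip B).
Hypothesis trB : trace_bounded ip H B K.
Let hh := hilb_herm hH.
Let qB := (fun u v => ip (B u) v).
Let hB : hermitian_on H qB := pos_hermitian hh posB.
Let opB_ : operator_on H B := let: And3 a _ _ := posB.1 in a.
Local Notation e := (eigen_seq ip H B).
Local Notation lam := (eigen_val ip H B).
Let He n : H (e n) := mem_eigen B hH n.
Let lam0 n : 0 <= lam n := eigen_val_ge0 hH posB n.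
Let lam_mono i j : (i <= j)%N -> lam j <= lam i := @eigen_val_mono _ _ _ _ _ _ hH posB trB i j.

Definition root_val n := Num.sqrt (lam n).
Local Notation mu := root_val.

Lemma root_val_ge0 n : 0 <= mu n. Proof. exact: sqrtr_ge0. Qed.
Lemma root_val_sqr n : mu n ^+ 2 = lam n. Proof. exact: sqr_sqrtr. Qed.
Lemma root_val_mono i j : (i <= j)%N -> mu j <= mu i.
Proof. by move=> ij; rewrite /mu ler_wsqrtr // lam_mono. Qed.
Lemma root_val_gt0 n : (0 < mu n) = (0 < lam n).
Proof. exact: sqrtr_gt0. Qed.

Lemma lam_small (eps : R) : 0 < eps -> exists N, forall n, (N <= n)%N -> lam n <= eps.
Proof.
move=> e0; exists (Num.truncn (K / eps)).+1 => n Nn.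
have n0 : 0 < n%:R :> R by rewrite ltr0n; apply: leq_trans Nn.
have := eigen_val_bound hH posB trB n; rewrite -ler_pdivlMl // => /le_trans; apply.
rewrite ler_pdivrMl // mulrC -ler_pdivrMl // mulrC ltW //.
apply: lt_le_trans (truncnS_gt _) _; by rewrite ler_nat.
Qed.

(** The sequence of eigenvectors may end in zeros and is orthonormal only up to
    there; sums of n terms are compared with sums over the prefix of length m'. *)
Lemma positive_prefix m : exists m', [/\ (m' <= m)%N, orthonormal ip H e m',
  (forall i, (m' <= i)%N -> (i < m)%N -> lam i = 0) &
  lam m' <= lam m].
Proof.
elim: m => [|m [m' [le or z top]]].
  by exists 0%N; split=> //; split.
have [lz|lp] := eqVneq (lam m) 0.
  exists m'; split=> //; first exact: leq_trans le _.
  - move=> i mi; rewrite ltnS leq_eqVlt => /orP[/eqP ->//|]; exact: z.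
  - by rewrite (le_trans top) // lz.
exists m.+1; split=> //; last by move=> i mi; rewrite ltnNge mi.
apply: (eigen_orthonormal hH posB) => i; rewrite ltnS => im.
by apply: lt_le_trans (lam_mono im); rewrite lt_neqAle eq_sym lp lam0.
Qed.

Definition eigen_sum (d : nat -> C) n := \sum_(i < n) d i *: e i.

Lemma mem_eigen_sum d n : H (eigen_sum d n).
Proof. by apply: (mem_sum hh) => i _; apply: (memZ hh). Qed.

Lemma eigen_sum_bound d u M n : H u -> 0 <= M ->
  (forall i, lam i = 0 -> d i = 0) ->
  (forall i, cm (d i) ^+ 2 <= M * cm (ip u (e i)) ^+ 2) ->
  nsq ip (eigen_sum d n) <= M * nsq ip u.
Proof.
move=> Hu M0 dz db; have [m [le or z _]] := positive_prefix n.
have -> : eigen_sum d n = \sum_(i < m) d i *: e i.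
  rewrite /eigen_sum (big_ord_widen n (fun i => d i *: e i) le) [RHS]big_mkcond /=.
  apply: eq_bigr => i _; case: ltnP => // mi.
  by rewrite dz ?scale0r // z.
rewrite (nsq_comb hh or).
apply: (@le_trans _ _ (\sum_(i < m) M * cm (ip u (e i)) ^+ 2)).
  by apply: ler_sum => i _.
by rewrite -mulr_sumr ler_wpM2l // (bessel hh or).
Qed.

Lemma eigen_sum_form d n v : H v ->
  ip (eigen_sum d n) v = \sum_(i < n) d i * ip (e i) v.
Proof.
move=> Hv; rewrite (form_suml hh) //; last by move=> i _; apply: (memZ hh).
by apply: eq_bigr => i _; rewrite (formZl hh).
Qed.

Definition root_sum u := eigen_sum (fun i => ofR (mu i) * ip u (e i)).
Definition square_sum u := eigen_sum (fun i => ofR (lam i) * ip u (e i)).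

Lemma lam0_mu i : lam i = 0 -> mu i = 0.
Proof. by move=> h; rewrite /mu h sqrtr0. Qed.

Lemma root_sum_cauchy u n m : H u -> (n <= m)%N ->
  nsq ip (root_sum u m - root_sum u n) <= lam n * nsq ip u.
Proof.
move=> Hu nm.
pose d i := if (i < n)%N then 0 else ofR (mu i) * ip u (e i).
have -> : root_sum u m - root_sum u n = eigen_sum d m.
  rewrite /root_sum /eigen_sum.
  rewrite (big_ord_widen m (fun i => (ofR (mu i) * ip u (e i)) *: e i) nm).
  rewrite [X in _ - X]big_mkcond /= -sumrB; apply: eq_bigr => i _.
  by rewrite /d; case: ifP; rewrite ?subrr ?scale0r ?subr0.
apply: eigen_sum_bound => // i; rewrite /d.
  by move=> /lam0_mu ->; rewrite raddf0 mul0r if_same.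
case: ltnP => [_|ni]; first by rewrite cm0 expr0n mulr_ge0 // sqr_ge0.
rewrite cmM cm_ofR exprMn real_normK ?num_real // root_val_sqr.
by rewrite ler_wpM2r ?sqr_ge0 // lam_mono.
Qed.

(** The difference B u - square_sum u n is B applied to the component of u
    orthogonal to the first eigenvectors, on which the quadratic form of B is at
    most lam n times the square norm. Cauchy-Schwarz for the form of B then
    bounds its products with v. *)
Lemma square_sum_limit u v : H u -> H v ->
  complex_limit (fun n => ip (square_sum u n) v) (ip (B u) v).
Proof.
move=> Hu Hv eps e0; have qv0 := nsq_ge0 hB Hv; have u0 := nsq_ge0 hh Hu.
pose M := nsq ip u * nsq qB v + 1.
have M0 : 0 < M by rewrite ltr_wpDl // mulr_ge0.
have [|N hN] := @lam_small (eps ^+ 2 / M); first by rewrite divr_gt0 // exprn_gt0.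
exists N => n Nn; have [m [le or z top]] := positive_prefix n.
have Hs := mem_eigen_sum (fun i => ofR (lam i) * ip u (e i)) n.
have Hp := mem_proj hh or u; have Hup := memB hh Hu Hp.
have BuE : B u - square_sum u n = B (u - proj ip e m u).
  rewrite (opB hh opB_) // (op_comb hh opB_ (fun i => ip u (e i))) //.
  congr (_ - _); rewrite /square_sum /eigen_sum.
  rewrite (big_ord_widen n (fun i => ip u (e i) *: B (e i)) le) [RHS]big_mkcond /=.
  apply: eq_bigr => i _; case: ltnP => mi.
    by rewrite (eigen_seqE hH posB) scalerA mulrC.
  by rewrite z // raddf0 mul0r scale0r.
rewrite -cmN opprB -(formBl hh) ?BuE //; last exact: opB_.1.
apply: (le_of_sqr (ltW e0)); apply: (le_trans (cauchy_schwarz hB Hup Hv)).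
have h1 : nsq qB (u - proj ip e m u) <= eps ^+ 2 / M * nsq ip u.
  apply: (le_trans (eigen_top (n := m) hH posB trB Hup _)).
    by move=> i im; rewrite (proj_orth hh or).
  apply: ler_pM => //; first exact: (nsq_ge0 hh).
    by rewrite (le_trans top) // hN.
  exact: (proj_le hh or).
apply: (@le_trans _ _ (eps ^+ 2 / M * M)); last by rewrite divfK // gt_eqF.
apply: (le_trans (ler_wpM2r qv0 h1)); rewrite -(mulrA (eps ^+ 2 / M)) ler_wpM2l //.
  by rewrite divr_ge0 ?sqr_ge0 // ltW.
by rewrite lerDl.
Qed.

Lemma root_exists u : exists l, H u -> H l /\ strong_limit ip (root_sum u) l.
Proof.
have [Hu|nHu] := pselect (H u); last by exists 0.
have [|eps e0|l Hl hl] := @hilb_complete _ _ _ _ hH (root_sum u).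
- by move=> n; exact: mem_eigen_sum.
- have u0 := nsq_ge0 hh Hu; have up : 0 < nsq ip u + 1 by rewrite ltr_wpDl.
  have [|N hN] := @lam_small (eps / (nsq ip u + 1)); first by rewrite divr_gt0.
  exists N => p q; wlog pq : p q / (p <= q)%N.
    move=> h Np Nq; case/orP: (leq_total p q) => pq; first exact: h.
    by rewrite (nsqBC hh) ?h //; exact: mem_eigen_sum.
  move=> Np Nq; rewrite (nsqBC hh); try exact: mem_eigen_sum.
  apply: (le_trans (root_sum_cauchy Hu pq)).
  apply: (@le_trans _ _ (eps / (nsq ip u + 1) * (nsq ip u + 1))).
    by apply: ler_pM => //; [exact: hN|rewrite lerDl].
  by rewrite divfK // gt_eqF.
by exists l.
Qed.

(** The strong limit of the sums of sqrt(lam i) <u, e i> e i. *)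
Definition root_op u := projT1 (cid (root_exists u)).
Local Notation A := root_op.

Lemma root_opP u : H u -> H (A u) /\ strong_limit ip (root_sum u) (A u).
Proof. exact: (projT2 (cid (root_exists u))). Qed.

Lemma root_sumL a u v n : H u -> H v ->
  root_sum (a *: u + v) n = a *: root_sum u n + root_sum v n.
Proof.
move=> Hu Hv; rewrite /root_sum /eigen_sum scaler_sumr -big_split /=.
apply: eq_bigr => i _; rewrite (herm_lin hh) // scalerA -scalerDl.
by rewrite mulrDr mulrCA.
Qed.

Lemma root_op_linear : operator_on H A.
Proof.
split=> [u /root_opP[]//|a u v Hu Hv].
have Huv := herm_memL hh a Hu Hv.
have [HAu hAu] := root_opP Hu; have [HAv hAv] := root_opP Hv.
have [HAuv hAuv] := root_opP Huv.
have Hrs w n : H (root_sum w n) by exact: mem_eigen_sum.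
apply: (strong_limit_unique hH _ HAuv _ hAuv) => //; first exact: (herm_memL hh).
move=> eps e0; have := strong_limitL a hh (Hrs u) (Hrs v) HAu HAv hAu hAv e0.
by move=> [N hN]; exists N => n /hN; rewrite root_sumL.
Qed.

Lemma root_sum_sym u v n : H u -> H v -> ip (root_sum u n) v = (ip (root_sum v n) u)^*.
Proof.
move=> Hu Hv; rewrite !eigen_sum_form // rmorph_sum /=.
apply: eq_bigr => i _; rewrite !rmorphM /= conj_ofR -!(herm_sym hh) //.
by rewrite mulrAC.
Qed.

Lemma complex_limit_conj z c : complex_limit z c ->
  complex_limit (fun n => (z n)^*) (c : C)^*.
Proof.
move=> h eps e0; have [N hN] := h _ e0; exists N => n /hN.
by rewrite -rmorphB /= cm_conj.
Qed.

Lemma root_form_limit u v : H u -> H v ->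
  complex_limit (fun n => ip (root_sum u n) v) (ip (A u) v).
Proof.
move=> Hu Hv; have [HAu hAu] := root_opP Hu; apply: (strong_limit_form hh) => //.
by move=> n; exact: mem_eigen_sum.
Qed.

Lemma root_op_positive : positive_operator H ip A.
Proof.
have opA := root_op_linear; split; first split=> //.
  move=> u v Hu Hv; rewrite (herm_sym hh (opA.1 _ Hv) Hu).
  apply: (complex_limit_unique (root_form_limit Hu Hv)).
  have := complex_limit_conj (root_form_limit Hv Hu).
  move=> h eps e0; have [N hN] := h _ e0; exists N => n /hN.
  by rewrite (root_sum_sym _ Hu Hv).
move=> u Hu; apply: complex_limit_ge0 (root_form_limit Hu Hu) => n.
rewrite eigen_sum_form // sumr_ge0 // => i _.
rewrite (herm_sym hh Hu (He i)) -mulrA mulJ -rmorphM ofR_ge0.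
by rewrite mulr_ge0 ?sqr_ge0 ?root_val_ge0.
Qed.

Lemma root_op_eigen j : A (e j) = ofR (mu j) *: e j.
Proof.
have [HA hA] := root_opP (He j).
apply: (strong_limit_unique hH _ HA _ hA) => //; first by move=> n; exact: mem_eigen_sum.
  exact: (memZ hh).
apply: (strong_limit_eventually (N := j.+1) hh) => n jn.
rewrite /root_sum /eigen_sum (bigD1 (Ordinal jn)) //= big1 ?addr0.
  have := lam0 j; rewrite le_eqVlt => /orP[/eqP lj|lj].
    by rewrite lam0_mu // raddf0 mul0r.
  by rewrite (nsqE hh) // (eigen_norm hH posB) // rmorph1 mulr1.
move=> i ij; rewrite (eigen_orth B hH) ?mulr0 ?scale0r //.
by rewrite eq_sym.
Qed.

Lemma root_op_square u : H u -> A (A u) = B u.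
Proof.
move=> Hu; have opA := root_op_linear; have [[_ _ symA] _] := root_op_positive.
have HAu := opA.1 _ Hu.
apply: (form_inj hH); [exact: opA.1|exact: opB_.1|move=> v Hv].
have HAv := opA.1 _ Hv; rewrite symA //.
apply: complex_limit_unique (root_form_limit Hu HAv) _.
move=> eps e0; have [N hN] := square_sum_limit Hu Hv e0; exists N => n /hN.
rewrite -symA //; last exact: mem_eigen_sum.
suff -> : A (root_sum u n) = square_sum u n by [].
rewrite (op_comb hh opA (fun i => ofR (mu i) * ip u (e i))) //.
apply: eq_bigr => i _; rewrite root_op_eigen scalerA mulrAC -rmorphM -expr2.
by rewrite root_val_sqr.
Qed.

Lemma root_op_kernel u : H u -> (forall i, 0 < mu i -> ip u (e i) = 0) -> A u = 0.
Proof.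
move=> Hu h; have [HA hA] := root_opP Hu.
apply: (strong_limit_unique hH _ HA _ hA) => //; first by move=> n; exact: mem_eigen_sum.
  exact: (herm_mem0 hh).
apply: (strong_limit_eventually (N := 0) hh) => n _.
rewrite /root_sum /eigen_sum big1 // => i _.
have := root_val_ge0 i; rewrite le_eqVlt => /orP[/eqP <-|/h ->].
  by rewrite raddf0 mul0r scale0r.
by rewrite mulr0 scale0r.
Qed.

(** The values decrease to 0, so a positive one is taken on finitely many
    consecutive indices. *)
Lemma root_val_segment s : 0 < s -> exists a b, (a <= b)%N /\
  forall i, (mu i = s) <-> (a <= i < b)%N.
Proof.
move=> s0; have exb : exists n, mu n < s.
  have [|N hN] := @lam_small (s ^+ 2 / 2); first by rewrite divr_gt0 // exprn_gt0.
  exists N; rewrite ltNge; apply/negP => sN.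
  have : s ^+ 2 <= mu N ^+ 2 by rewrite ler_sqr ?nnegrE ?root_val_ge0 // ltW.
  rewrite root_val_sqr; have := hN _ (leqnn N); have := exprn_gt0 2 s0; lra.
have exa : exists n, mu n <= s by have [n hn] := exb; exists n; exact: ltW.
case: (ex_minnP exa) => a ha amin; case: (ex_minnP exb) => b hb bmin.
exists a, b; split; first by apply: amin; exact: ltW.
move=> i; split=> [mi|/andP[ai ib]].
  apply/andP; split; first by apply: amin; rewrite mi.
  by rewrite ltnNge; apply/negP => /root_val_mono; rewrite mi leNgt hb.
apply/eqP; rewrite eq_le (le_trans (root_val_mono ai) ha) /= leNgt.
by apply/negP => /bmin; rewrite leqNgt ib.
Qed.

End SquareRoot.

(** * Singular values of Hilbert-Schmidt operators *)

Lemma card_shift (a n : nat) (S : set nat) :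
  (forall j, S j <-> (a <= j < a + n)%N) -> (S #= `I_n)%card.
Proof.
move=> hS; have -> : S = addn a @` `I_n.
  apply/seteqP; split=> [j /hS/andP[aj jn]|_ [i /= im <-]].
    by exists (j - a)%N; rewrite /= ?subnKC // ltn_subLR.
  by apply/hS; rewrite leq_addr ltn_add2l.
by apply: inj_card_eq => x y _ _; exact: addnI.
Qed.

Section SingularValues.
Variables (R : realType) (V : lmodType (Cplx R)).
Local Notation C := (Cplx R).
Variable ip : V -> V -> C.
Implicit Types (u v w : V) (mu : nat -> R).

Definition extend_ord n (T : Type) (x0 : T) (c : 'I_n -> T) (k : nat) : T :=
  oapp c x0 (insub k).
Lemma extend_ordE n (T : Type) (x0 : T) (c : 'I_n -> T) (i : 'I_n) :
  extend_ord x0 c i = c i.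
Proof. by rewrite /extend_ord valK. Qed.

(** K bounds the square of the Hilbert-Schmidt norm of T. *)
Definition HS_bounded (H : set V) (T : V -> V) (K : R) :=
  forall f m, orthonormal ip H f m -> \sum_(i < m) nsq ip (T (f i)) <= K.

Lemma HS_bounded_ge0 H T K : HS_bounded H T K -> 0 <= K.
Proof.
by move=> /(_ (fun=> 0) 0%N); rewrite big_ord0; apply; split.
Qed.

Lemma HS_bounded_op H T K u : hilbert_on ip H -> operator_on H T ->
  HS_bounded H T K -> H u -> nsq ip (T u) <= K * nsq ip u.
Proof.
move=> hH opT hsT Hu; have hh := hilb_herm hH.
have [->|/eqP u0] := eqVneq u 0.
  by rewrite (op0 hh opT) (nsq0 hh) mulr0.
have [a [a0 a1]] := normalize hH Hu u0.
have := hsT (fun=> ofR a *: u) 1%N; rewrite big_ord1 (opZ hh opT) // (nsqZ hh); last exact: opT.1.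
have Hau := memZ hh (ofR a) Hu.
have or1 : orthonormal ip H (fun=> ofR a *: u) 1.
  by split=> // -[|//] [|//] _ _; rewrite (nsqE hh) // a1 rmorph1.
move=> /(_ or1); move: a1; rewrite (nsqZ hh) // => a1 h.
have c0 : 0 < cm (ofR a) ^+ 2 by rewrite exprn_gt0 // cm_ofR normr_gt0 gt_eqF.
by rewrite -(ler_pM2l c0) mulrCA a1 mulr1.
Qed.

Lemma HS_trace H T S K : hermitian_on H ip -> is_adjoint H ip T S ->
  HS_bounded H T K -> trace_bounded ip H (fun u => S (T u)) K.
Proof.
move=> hh adj hsT f m or; apply: le_trans (hsT f m or).
apply: ler_sum => i _; rewrite (adjoint_square hh adj).2 //.
exact: or.1.
Qed.

(** The square roots of the eigenvalues of S T, with S the adjoint of T, list the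
    singular values. Their multiplicities are right because a vector w with
    |T| w = s w that is orthogonal to the e j with value s is orthogonal to every
    e j, so that |T| w = 0. *)
Lemma singular_values_exist H T K : hilbert_on ip H -> operator_on H T ->
  HS_bounded H T K -> exists mu, is_singular_values H ip T mu.
Proof.
move=> hH opT hsT; have hh := hilb_herm hH.
have [S adj] := adjoint_exists hH (HS_bounded_ge0 hsT) opT
  (fun u Hu => HS_bounded_op hH opT hsT Hu).
have [posB qBE] := adjoint_square hh adj; have trB := HS_trace hh adj hsT.
set B := (fun u => S (T u)) in posB qBE trB.
pose e := eigen_seq ip H B; pose mu := root_val ip H B.
have He n : H (e n) by exact: mem_eigen.
have mu0 n : 0 <= mu n by exact: root_val_ge0.
exists mu; split=> //; first by move=> i j; exact: (root_val_mono hH posB trB).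
pose A := root_op hH posB trB; exists A.
have posA := root_op_positive hH posB trB; rewrite -/A in posA.
have [[opA _ symA] _] := posA.
split; first by split=> //; exists S; split=> // u Hu; exact: root_op_square.
move=> s s0; have [a [b [ab hab]]] := root_val_segment hH posB trB s0.
rewrite -/mu in hab; exists (b - a)%N; split; last first.
  by apply: (card_shift (a := a)) => j; rewrite subnKC //; exact: hab.
have mus i : (i < b - a)%N -> mu (a + i)%N = s.
  by move=> ib; apply/hab; rewrite leq_addr -ltn_subRL.
have or : orthonormal ip H (fun i => e (a + i)%N) (b - a).
  split=> [i _ //|i j im jm]; case: eqVneq => [<-|ij].
    rewrite (nsqE hh) // (eigen_norm hH posB) ?rmorph1 //.
    by rewrite -(root_val_gt0 ip H B) -/mu mus.
  by rewrite (eigen_orth B hH) // eqn_add2l.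
have Aeig j : A (e j) = ofR (mu j) *: e j by exact: root_op_eigen.
exists (fun i : 'I_(b - a) => e (a + i)%N); split.
- by move=> i; split; rewrite ?Aeig ?mus.
- move=> c c0 i; have := form_comb hh or (extend_ord 0 c) (ltn_ord i).
  rewrite extend_ordE => <-.
  have -> : \sum_(k < b - a) extend_ord 0 c k *: e (a + k)%N = 0.
    rewrite -[RHS]c0; apply: eq_bigr => k _; congr (_ *: _).
    exact: extend_ordE.
  by rewrite (form0l hh).
- move=> u [Hu Au]; exists (fun i => ip u (e (a + i)%N)).
  have Hp := mem_proj hh or u; have Hup := memB hh Hu Hp.
  apply/eqP; rewrite -subr_eq0; apply/eqP; rewrite -/(proj ip (fun i => e (a + i)%N) (b - a) u).
  set w := u - _ in Hup *.
  have us i : mu i <> s -> ip u (e i) = 0.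
    move=> mi; have : ip (A u) (e i) = ip u (A (e i)) by exact: symA.
    rewrite Au Aeig (formZl hh) // (formZr hh) // conj_ofR => /eqP.
    rewrite -subr_eq0 -mulrBl mulf_eq0 => /orP[|/eqP //].
    by rewrite -(raddfB (@ofR R)) fmorph_eq0 subr_eq0 => /eqP ms; case: mi.
  have wA : A w = ofR s *: w.
    rewrite (opB hh opA) // Au /w scalerBr; congr (_ - _).
    rewrite /proj (op_comb (f := fun i => e (a + i)%N) hh opA (fun i => ip u (e (a + i)%N))) // scaler_sumr.
    by apply: eq_bigr => i _; rewrite Aeig mus // !scalerA mulrC.
  have : A w = 0.
    apply: root_op_kernel => // i _.
    have [ms|/eqP ms] := eqVneq (mu i) s.
      have /hab/andP[ai ib] := ms.
      have im : (i - a < b - a)%N by rewrite ltn_sub2r // (leq_ltn_trans ai).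
      by have := proj_orth hh or Hu im; rewrite subnKC.
    rewrite /w (formBl hh) // us // sub0r /proj (form_suml hh) //.
      rewrite big1 ?oppr0 // => k _; rewrite (formZl hh) // (eigen_orth B hH) ?mulr0 //.
      by apply/eqP => k_i; apply: ms; rewrite -k_i mus.
    by move=> k _; apply: (memZ hh).
  rewrite wA => /eqP; rewrite scaler_eq0 fmorph_eq0 gt_eqF //= => /eqP //.
Qed.

Lemma dim_le (m n : nat) (x : 'I_m -> V) (y : 'I_n -> V) (M : 'M[C]_(m, n)) :
  (forall c : 'I_m -> C, \sum_i c i *: x i = 0 -> forall i, c i = 0) ->
  (forall i, x i = \sum_k M i k *: y k) -> (m <= n)%N.
Proof.
move=> free xE; suff /eqP <- : row_free M by exact: rank_leq_col.
rewrite -kermx_eq0; apply/rowV0P => v /sub_kermxP vM.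
apply/rowP => i; rewrite mxE; apply: (free (fun i => v 0 i)) => //.
under eq_bigr do rewrite xE scaler_sumr.
rewrite exchange_big big1 // => k _.
under eq_bigr do rewrite scalerA.
rewrite -scaler_suml; have := congr1 (fun N : 'rV_n => N 0 k) vM.
by rewrite !mxE => ->; rewrite scale0r.
Qed.

Lemma wide_kernel (m n : nat) (M : 'M[C]_(m, n)) : (n < m)%N ->
  exists2 c : 'rV[C]_m, c != 0 & c *m M = 0.
Proof.
move=> nm; have : kermx M != 0.
  rewrite kermx_eq0 /row_free neq_ltn (leq_ltn_trans (rank_leq_col M)) //.
by move=> /rowV0Pn[c /sub_kermxP cM c0]; exists c.
Qed.

(** A maximal orthonormal family in E has at most n elements because it is free,
    and at least n because it spans E. *)
Lemma orthonormal_basis H (E : set V) n : hilbert_on ip H -> E `<=` H ->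
  (forall (a : C) u v, E u -> E v -> E (a *: u + v)) -> has_dim E n ->
  exists f, [/\ orthonormal ip H f n, forall i, (i < n)%N -> E (f i) &
    forall u, E u -> (forall i, (i < n)%N -> ip u (f i) = 0) -> u = 0].
Proof.
move=> hH EH EL [x [Ex free span]]; have hh := hilb_herm hH.
have n0E : (0 < n)%N -> E 0.
  move=> n0; have := EL (-1) _ _ (Ex (Ordinal n0)) (Ex (Ordinal n0)).
  by rewrite scaleN1r addNr.
have ortho_free f m : orthonormal ip H f m ->
    forall c : 'I_m -> C, \sum_i c i *: f i = 0 -> forall i, c i = 0.
  move=> or c c0 i; have := form_comb hh or (extend_ord 0 c) (ltn_ord i).
  rewrite extend_ordE => <-.
  have -> : \sum_(k < m) extend_ord 0 c k *: f k = 0.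
    rewrite -[RHS]c0; apply: eq_bigr => k _; congr (_ *: _); exact: extend_ordE.
  by rewrite (form0l hh) //; exact: or.1.
have bnd f m : orthonormal ip H f m -> (forall i, (i < m)%N -> E (f i)) -> (m <= n)%N.
  move=> or Ef; have /choice[M hM] : forall i : 'I_m, exists c : 'I_n -> C,
      f i = \sum_k c k *: x k by move=> i; apply: span; exact: Ef.
  apply: (@dim_le m n (fun i => f i) x (\matrix_(i, k) M i k)); first exact: ortho_free.
  by move=> i; rewrite hM; apply: eq_bigr => k _; rewrite mxE.
have [f [m [or Ef maxf]]] := max_orthonormal (P := E) hh bnd.
have sep u : E u -> (forall i, (i < m)%N -> ip u (f i) = 0) -> u = 0.
  move=> Eu uf; apply: contrapT => u0; have Hu := EH _ Eu.
  have [a [a0 a1]] := normalize hH Hu u0.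
  have E0 : E 0 by have := EL (-1) _ _ Eu Eu; rewrite scaleN1r addNr.
  apply: (maxf (ofR a *: u)) => //; first exact: (memZ hh).
    by move=> i im; rewrite (formZl hh) ?uf ?mulr0 //; exact: or.1.
  by rewrite -[_ *: _]addr0; exact: EL.
have mn : m = n.
  apply/eqP; rewrite eqn_leq (bnd _ _ or Ef) /=.
  apply: (@dim_le n m x (fun i => f i) (\matrix_(i, k) ip (x i) (f k))) => // i.
  have Hx := EH _ (Ex i); apply/eqP; rewrite -subr_eq0; apply/eqP.
  have -> : \sum_(k < m) (\matrix_(i, k) ip (x i) (f k)) i k *: f k = proj ip f m (x i).
    by apply: eq_bigr => k _; rewrite mxE.
  apply: sep; last by move=> k km; rewrite (proj_orth hh or).
  have Esum (r : seq 'I_m) : E (x i - \sum_(k <- r) ip (x i) (f k) *: f k).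
    elim: r => [|k r IH]; first by rewrite big_nil subr0.
    by rewrite big_cons opprD addrCA -scaleNr; apply: EL => //; exact: Ef.
  exact: Esum.
by rewrite -mn; exists f.
Qed.

Section Counting.
Variables (H : set V) (T : V -> V) (K : R) (mu : nat -> R).
Hypotheses (hH : hilbert_on ip H) (hsT : HS_bounded H T K).
Hypothesis muT : is_singular_values H ip T mu.
Let hh := hilb_herm hH.

(** Any sequence that lists the singular values comes with eigenvectors g j of
    |T|: the indices j with mu j = s are in bijection with an orthonormal basis of
    the eigenspace of s, and different eigenspaces are orthogonal. *)
Lemma singular_family : exists A S g, [/\ positive_operator H ip A, is_adjoint H ip T S,
  forall u, H u -> A (A u) = S (T u),
  forall j, H (g j) /\ A (g j) = ofR (mu j) *: g j &
  (forall i j, 0 < mu i -> 0 < mu j -> ip (g i) (g j) = (i == j)%:R) /\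
  forall s u, 0 < s -> H u -> A u = ofR s *: u ->
    (forall j, mu j = s -> ip u (g j) = 0) -> u = 0].
Proof.
have [mu0 mudecr [A [[posA [S [adj AA]]] dimE]]] := muT.
have [[opA _ symA] _] := posA.
have ex s : exists g : nat -> V, 0 < s ->
    [/\ forall j, mu j = s -> H (g j) /\ A (g j) = ofR s *: g j,
     forall i j, mu i = s -> mu j = s -> ip (g i) (g j) = (i == j)%:R &
     forall u, H u -> A u = ofR s *: u -> (forall j, mu j = s -> ip u (g j) = 0) -> u = 0].
  have [s0|_] := ltP 0 s; last by exists (fun=> 0).
  have [n [dimn /card_set_bijP[h [hfun hinj hsurj]]]] := dimE s s0.
  have EH : eigenspace_on H A s `<=` H by move=> u [].
  have EL (a : C) u v : eigenspace_on H A s u -> eigenspace_on H A s v ->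
      eigenspace_on H A s (a *: u + v).
    move=> [Hu Au] [Hv Av]; split; first exact: (herm_memL hh).
    by rewrite opA.2 // Au Av scalerDr !scalerA mulrC.
  have [f [or Ef sep]] := orthonormal_basis hH EH EL dimn.
  exists (fun j => f (h j)) => _; split.
  - by move=> j /hfun /Ef [].
  - move=> i j mi mj; rewrite or.2 ?hfun //; congr (nat_of_bool _)%:R.
    apply/eqP/eqP => [|-> //]; apply: hinj; exact/mem_set.
  - move=> u Hu Au uf; apply: sep; first by split.
    by move=> i im; have [j mj <-] := hsurj i im; exact: uf.
have [g hg] := choice ex; exists A, S.
exists (fun j => if 0 < mu j then g (mu j) j else 0); split=> //.
- move=> j; case: ifPn => [mj|_]; last by rewrite (op0 hh opA) scaler0; split=> //; exact: (herm_mem0 hh).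
  by have [h1 _ _] := hg _ mj; exact: h1.
- split=> [i j mi mj|s u s0 Hu Au uf]; last first.
    have [_ _ h3] := hg _ s0; apply: h3 => // j mj.
    by have := uf j mj; rewrite mj s0.
  rewrite mi mj; have [mij|/eqP mij] := eqVneq (mu i) (mu j).
    by have [_ h2 _] := hg _ mj; rewrite mij h2.
  have [Hi Ai] : H (g (mu i) i) /\ A (g (mu i) i) = ofR (mu i) *: g (mu i) i.
    by have [h1 _ _] := hg _ mi; exact: h1.
  have [Hj Aj] : H (g (mu j) j) /\ A (g (mu j) j) = ofR (mu j) *: g (mu j) j.
    by have [h1 _ _] := hg _ mj; exact: h1.
  have ij : (i == j) = false by apply/eqP => ij; apply: mij; rewrite ij.
  have : ip (A (g (mu i) i)) (g (mu j) j) = ip (g (mu i) i) (A (g (mu j) j)) by exact: symA.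
  rewrite Ai Aj (formZl hh) // (formZr hh) // conj_ofR ij => /eqP.
  rewrite -subr_eq0 -mulrBl mulf_eq0 => /orP[|/eqP //].
  by rewrite -(raddfB (@ofR R)) fmorph_eq0 subr_eq0 => /eqP.
Qed.

(** The vectors g 0, ..., g p are orthonormal and |T (g i)| = mu i >= rho. *)
Lemma singular_count_upper (rho : R) p : 0 < rho -> rho <= mu p -> p.+1%:R * rho ^+ 2 <= K.
Proof.
move=> r0 rp; have [A [S [g [posA adj AA Ag [gor _]]]]] := singular_family.
have [_ mudecr _] := muT; have [[opA _ symA] _] := posA.
have rj j : (j < p.+1)%N -> rho <= mu j by move=> jp; apply: (le_trans rp); exact: mudecr.
have or : orthonormal ip H g p.+1.
  split=> [i _|i j ip_ jp]; first by case: (Ag i).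
  by rewrite gor // (lt_le_trans r0) // rj.
apply: le_trans (hsT or).
have -> : p.+1%:R * rho ^+ 2 = \sum_(i < p.+1) rho ^+ 2.
  by rewrite sumr_const card_ord mulr_natl.
apply: ler_sum => i _; have [Hg Agi] := Ag i.
rewrite -(adjoint_square hh adj).2 // /nsq -AA // symA //; last exact: opA.1.
rewrite Agi -/(nsq ip _) (nsqZ hh) // cm_ofR real_normK ?num_real //.
rewrite /nsq gor ?eqxx ?mulr1; try by rewrite (lt_le_trans r0) // rj.
by rewrite ler_sqr ?nnegrE ?rj // (le_trans (ltW r0)) // rj.
Qed.

(** Suppose mu j < rho with j < m. Some nonzero combination of the w i is
    orthogonal to g 0, ..., g (j-1), so the quadratic form of S T on the
    complement H' of these vectors reaches rho^2 on unit vectors. Its top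
    eigenvalue there is s^2 with s >= rho > mu j, and (|T| + s) e is then an
    eigenvector of |T| for s that is orthogonal to every g k with mu k = s,
    because such k are smaller than j. So it is 0, but its product with e is
    positive. *)
Lemma singular_count_lower (m : nat) (w : 'I_m -> V) (rho : R) : 0 < rho ->
  (forall i, H (w i)) ->
  (forall c : 'I_m -> C, (exists i, c i != 0) -> \sum_i c i *: w i <> 0) ->
  (forall c : 'I_m -> C, rho ^+ 2 * nsq ip (\sum_i c i *: w i) <=
     nsq ip (T (\sum_i c i *: w i))) ->
  forall j, (j < m)%N -> rho <= mu j.
Proof.
move=> r0 Hw free low j jm; rewrite leNgt; apply/negP => muj.
have [A [S [g [posA adj AA Ag [_ gsep]]]]] := singular_family.
have [mu0 mudecr _] := muT; have [[opA _ symA] _] := posA.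
have [posB qBE] := adjoint_square hh adj; have trB := HS_trace hh adj hsT.
have [c c0 cM] := wide_kernel (\matrix_(i < m, k < j) ip (w i) (g k)) jm.
pose u := \sum_i c 0 i *: w i.
have Hu : H u by apply: (mem_sum hh) => i _; exact: (memZ hh).
have Hg i : H (g i) by case: (Ag i).
have u0 : u <> 0.
  apply: free; have /rV0Pn[i ci] := c0; by exists i.
have ug k : (k < j)%N -> ip u (g k) = 0.
  move=> kj; rewrite (form_suml hh) //; last by move=> i _; exact: (memZ hh).
  have h := congr1 (fun N : 'rV_j => N 0 (Ordinal kj)) cM; rewrite mxE [RHS]mxE in h.
  rewrite -[RHS]h.
  by apply: eq_bigr => i _; rewrite mxE (formZl hh).
pose H' := [set v | H v /\ forall i, (i < j)%N -> ip v (g i) = 0].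
have hH' : hilbert_on ip H' by exact: (orthc_hilbert hH (fun i _ => Hg i)).
have BG i : (i < j)%N -> S (T (g i)) = ofR (mu i ^+ 2) *: g i.
  move=> _; have [Hgi Agi] := Ag i.
  by rewrite -AA // Agi (opZ hh opA) // Agi scalerA -rmorphM.
have posB' := orthc_positive hh posB (fun i _ => Hg i) BG.
have trB' : trace_bounded ip H' (fun u => S (T u)) K.
  by move=> f n /(orthonormal_sub (@subIsetl _ _ _)); exact: trB.
have nu : 0 < nsq ip u by rewrite ltNge; apply/negP => /(nsq_eq0 hH Hu).
have Tu := low (fun i => c 0 i); rewrite -/u in Tu.
have upos : 0 < nsq (fun u v => ip (S (T u)) v) u.
  by rewrite qBE // (lt_le_trans _ Tu) // mulr_gt0 // exprn_gt0.
have Hu' : H' u by [].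
have [e [lam [[He eg] e1 l0 Be top]]] := top_eigen hH' posB' trB' Hu' upos.
pose s := Num.sqrt lam; have s0 : 0 < s by rewrite sqrtr_gt0.
have rs : rho <= s.
  apply: (le_of_sqr (ltW s0)); rewrite (sqr_sqrtr (ltW l0)).
  rewrite -(ler_pM2r nu); apply: (le_trans Tu); rewrite -qBE //; exact: top.
(* A need not fix the line of e: since (A - s) (A + s) e = 0, it is (A + s) e
   that is known to be an eigenvector of A. *)
have HAe := opA.1 _ He; pose x := A e + ofR s *: e.
have Hse := memZ hh (ofR s) He; have Hx : H x by exact: (memD hh).
have Ax : A x = ofR s *: x.
  rewrite /x (opD opA) // (opZ hh opA) // AA // Be scalerDr scalerA -rmorphM.
  by rewrite -expr2 sqr_sqrtr ?ltW // addrC.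
have x0 : x = 0.
  apply: (gsep s) => // k muk.
  have kj : (k < j)%N.
    by rewrite ltnNge; apply/negP => /mudecr; rewrite muk leNgt (lt_le_trans muj).
  have [Hgk Agk] := Ag k.
  rewrite (formDl hh) // (formZl hh) // symA // Agk (formZr hh) // eg // !mulr0.
  by rewrite addr0.
have : ip x e = 0 by rewrite x0 (form0l hh).
rewrite (formDl hh) // (formZl hh) // (nsqE hh He) e1 rmorph1 mulr1.
have /ge0P[-> Ae0] := posA.2 _ He.
by rewrite -rmorphD => /eqP; rewrite fmorph_eq0 gt_eqF // ltr_wpDl.
Qed.

End Counting.

Theorem sv_count_bounds H T K (m : nat) (w : 'I_m -> V) (rho : R) :
  hilbert_on ip H -> operator_on H T -> HS_bounded H T K -> 0 < rho ->
  (forall i, H (w i)) ->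
  (forall c : 'I_m -> C, (exists i, c i != 0) -> \sum_i c i *: w i <> 0) ->
  (forall c : 'I_m -> C, rho ^+ 2 * nsq ip (\sum_i c i *: w i) <=
     nsq ip (T (\sum_i c i *: w i))) ->
  ((m%:R)%:E <= sv_count H ip T rho^-1)%E /\
  (sv_count H ip T rho^-1 <= (K / rho ^+ 2)%:E)%E.
Proof.
move=> hH opT hsT r0 Hw free low; rewrite /sv_count invrK.
have svT : is_singular_values H ip T (singular_value H ip T).
  rewrite /singular_value; case: xgetP => [mu _ //|no].
  by have [mu hmu] := singular_values_exist hH opT hsT; case: (no mu).
set S := [set j | _].
have K0 := HS_bounded_ge0 hsT; have q0 : 0 <= K / rho ^+ 2 by rewrite divr_ge0 // sqr_ge0.
have sub : S `<=` `I_(Num.truncn (K / rho ^+ 2)).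
  move=> p /= /(singular_count_upper hH hsT svT r0) h.
  by rewrite /= truncn_ge_nat // ler_pdivlMr // exprn_gt0.
have sup : `I_m `<=` S by move=> j /=; exact: (singular_count_lower hH hsT svT r0 Hw free low).
have finS : finite_set S by apply: sub_finite_set sub _; exact: finite_II.
rewrite /counting asboolT // !lee_fin; split.
  by rewrite ler_nat leq_card_fset_set //; exact: subset_card_le.
apply: (@le_trans _ _ (Num.truncn (K / rho ^+ 2))%:R).
  by rewrite ler_nat geq_card_fset_set //; exact: subset_card_le.
by rewrite truncn_le.
Qed.

End SingularValues.

(** * Continuity and differentiability on the complex plane *)

Section Topology.
Variable R : realType.
Local Notation C := (Cplx R).
Implicit Types (z w h : C) (f : C -> C).

Lemma gt0P z : 0 < z -> z = ofR (Rpart z) /\ 0 < Rpart z.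
Proof.
move=> z0; have [zE _] := ge0P (ltW z0); split=> //.
by rewrite zE (_ : 0 = ofR 0) ?ltr_ofR ?rmorph0 // in z0.
Qed.

(** Radii of balls in Cplx R belong to Cplx R; being positive, they are real. *)
Lemma nbhs_complexP z (A : set C) :
  nbhs z A <-> exists2 e : R, 0 < e & forall w, cm (w - z) < e -> A w.
Proof.
split=> [/nbhs_ballP[e /= e0 h]|[e e0 h]].
  have [eE e0'] := gt0P e0; exists (Rpart e) => // w wz; apply: h.
  by rewrite -ball_normE /= eE distrC cmE ltr_ofR.
apply/nbhs_ballP; exists (ofR e) => /=; first by rewrite (_ : 0 = ofR 0) ?ltr_ofR ?rmorph0.
by move=> w; rewrite -ball_normE /= distrC cmE ltr_ofR; exact: h.
Qed.

Lemma open_complexP (Om : set C) z : open Om -> Om z ->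
  exists2 e : R, 0 < e & forall w, cm (w - z) < e -> Om w.
Proof. by move=> oOm Omz; apply/nbhs_complexP; exact: open_nbhs_nbhs. Qed.

Definition cont_at f z := forall e : R, 0 < e ->
  exists2 d : R, 0 < d & forall w, cm (w - z) < d -> cm (f w - f z) <= e.

Lemma cont_atP f z : {for z, continuous f} <-> cont_at f z.
Proof.
split=> [fz e e0|fz].
  have : nbhs (f z) [set y | cm (y - f z) < e] by apply/nbhs_complexP; exists e.
  by move=> /fz /nbhs_complexP[d d0 h]; exists d => // w /h /= /ltW.
move=> A /nbhs_complexP[e e0 h]; apply/nbhs_complexP.
have e2 : 0 < e / 2 by rewrite divr_gt0.
have [d d0 hd] := fz _ e2; exists d => // w /hd wz; apply: h.
by apply: (le_lt_trans wz); lra.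
Qed.

Definition has_deriv f z L := forall e : R, 0 < e -> exists2 d : R, 0 < d &
  forall w, cm (w - z) < d -> cm (f w - f z - L * (w - z)) <= e * cm (w - z).

Lemma derivableP_complex f z : derivable f z 1 <-> exists L, has_deriv f z L.
Proof.
have quot h L : h != 0 -> h^-1 *: (f (h *: 1 + z) - f z) - L =
    h^-1 * (f (h + z) - f z - L * h).
  by move=> h0; rewrite /GRing.scale /= mulr1; field.
split=> [/cvg_ex[/= L hL]|[L hL]].
  exists L => e e0; have : nbhs (L : C) [set y : C | cm (y - (L : C)) < e] by apply/nbhs_complexP; exists e.
  move=> /hL /nbhs_complexP[d d0 hd]; exists d => // w wz.
  have [->|wNz] := eqVneq w z; first by rewrite !subrr mulr0 subr0 cm0 mulr0.
  have h0 : w - z != 0 by rewrite subr_eq0.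
  have := hd (w - z); rewrite subr0 => /(_ wz h0) /=.
  rewrite quot // subrK cmM cmV mulrC ltr_pdivrMr ?cm_gt0 // => /ltW //.
apply/cvg_ex; exists L => A /nbhs_complexP[e e0 hA]; apply/nbhs_complexP.
have e2 : 0 < e / 2 by rewrite divr_gt0.
have [d d0 hd] := hL _ e2; exists d => // h; rewrite subr0 => hlt h0 /=.
apply: hA; rewrite quot // cmM cmV mulrC ltr_pdivrMr ?cm_gt0 //.
have := hd (h + z); rewrite addrK => /(_ hlt)/le_lt_trans; apply.
by rewrite ltr_pM2r ?cm_gt0 //; lra.
Qed.

Lemma derivable_cont f z : derivable f z 1 -> cont_at f z.
Proof. by move=> /derivable1_diffP/differentiable_continuous/cont_atP. Qed.

Lemma cont_at_cst k z : cont_at (fun=> k) z.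
Proof. by move=> e e0; exists 1 => // w _; rewrite subrr cm0 ltW. Qed.

Lemma cont_atD f g z : cont_at f z -> cont_at g z -> cont_at (fun w => f w + g w) z.
Proof.
move=> h1 h2 e e0; have e2 : 0 < e / 2 by rewrite divr_gt0.
have [d1 d10 hd1] := h1 _ e2; have [d2 d20 hd2] := h2 _ e2.
exists (Num.min d1 d2); first by rewrite lt_min d10.
move=> w; rewrite lt_min => /andP[/hd1 y1 /hd2 y2].
by rewrite opprD addrACA (le_trans (cmD _ _)) //; lra.
Qed.

Lemma cont_atM f g z : cont_at f z -> cont_at g z -> cont_at (fun w => f w * g w) z.
Proof.
move=> hf hg e e0; pose M := cm (f z) + cm (g z) + 1.
have M0 : 0 < M by rewrite ltr_wpDl // addr_ge0 // cm_ge0.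
have e1 : 0 < e / 2 / M by rewrite !divr_gt0.
have [d1 d10 hd1] := hf _ e1; have [d2 d20 hd2] := hg _ e1.
have [d3 d30 hd3] := hg _ ltr01.
exists (Num.min d1 (Num.min d2 d3)); first by rewrite !lt_min d10 d20.
move=> w; rewrite !lt_min => /andP[/hd1 y1 /andP[/hd2 y2 /hd3 y3]].
have -> : f w * g w - f z * g z = (f w - f z) * g w + f z * (g w - g z) by ring.
apply: (le_trans (cmD _ _)); rewrite !cmM.
have gM : cm (g w) <= M.
  have := cmD (g w - g z) (g z); rewrite subrK; have := cm_ge0 (f z); rewrite /M; lra.
have fM : cm (f z) <= M by have := cm_ge0 (g z); rewrite /M; lra.
have -> : e = e / 2 / M * M + M * (e / 2 / M) by field; rewrite gt_eqF.
by apply: lerD; apply: ler_pM => //; exact: cm_ge0.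
Qed.

Lemma derivable_inv w z : z != w -> derivable (fun y : C => (y - w)^-1) z 1.
Proof.
move=> zw; have h0 : derivable (fun y : C => y - w) z 1.
  by apply: derivableB; [exact: derivable_id|exact: derivable_cst].
have h := derivableV (f := fun y : C => y - w) (x := z) (v := 1).
by apply: h => //; rewrite subr_eq0.
Qed.

Lemma derivable_quot f w z : z != w -> derivable f z 1 ->
  derivable (fun y => f y / (y - w)) z 1.
Proof. by move=> zw df; exact: (derivableM df (derivable_inv zw)). Qed.

Lemma derivable_addc f k z : derivable f z 1 -> derivable (fun y => f y + k) z 1.
Proof. by move=> df; exact: (derivableD df (derivable_cst k z 1)). Qed.

End Topology.

(** * Integrals over real segments *)

Section SegmentIntegrals.
Variable R : realType.
Local Notation C := (Cplx R).
Local Notation mu := (@lebesgue_measure R).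
Implicit Types (a b c : R) (g : R -> R) (p : R -> C).

Definition segint g a b : R := \int[mu]_(x in `[a, b]) g x.

Definition cont_on g a b := forall x, a <= x <= b -> {for x, continuous g}.

Lemma cont_on_sub g a b a' b' : a <= a' -> b' <= b -> cont_on g a b -> cont_on g a' b'.
Proof.
by move=> aa bb h x /andP[ax xb]; apply: h; rewrite (le_trans aa) // (le_trans xb).
Qed.

Lemma segint_integrable g a b : cont_on g a b -> mu.-integrable `[a, b] (EFin \o g).
Proof.
move=> h; apply: continuous_compact_integrable; first exact: segment_compact.
by apply: continuous_in_subspaceT => x /[1!inE] /=; rewrite in_itv /=; exact: h.
Qed.
Hint Resolve segint_integrable : core.

Lemma segint_cat g a b c : a <= b -> b <= c -> cont_on g a c ->
  segint g a c = segint g a b + segint g b c.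
Proof.
move=> ab bc h; have := Rintegral_itvB (a := BLeft a) (b := BRight c) (x := b)
  (segint_integrable h).
rewrite /= !bnd_simp => /(_ ab bc); rewrite Rintegral_itv_obnd_cbnd /segint.
  by move=> <-; rewrite addrC subrK.
apply: integrableS (segint_integrable h) => //.
by apply: subset_itv; rewrite !bnd_simp.
Qed.

Lemma segintD g1 g2 a b : cont_on g1 a b -> cont_on g2 a b ->
  segint (fun x => g1 x + g2 x) a b = segint g1 a b + segint g2 a b.
Proof. by move=> h1 h2; rewrite /segint RintegralD //; exact: segint_integrable. Qed.

Lemma segintZ r g a b : cont_on g a b ->
  segint (fun x => r * g x) a b = r * segint g a b.
Proof. by move=> h; rewrite /segint RintegralZl //; exact: segint_integrable. Qed.

Lemma segint_cst r a b : a <= b -> segint (fun=> r) a b = r * (b - a).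
Proof.
move=> ab; rewrite /segint Rintegral_cst //=.
by rewrite lebesgue_measure_itv /= lte_fin lt_neqAle ab andbT; case: eqVneq => [->|] //=;
  rewrite ?subrr.
Qed.

Lemma segint_le g1 g2 a b : cont_on g1 a b -> cont_on g2 a b ->
  (forall x, a <= x <= b -> g1 x <= g2 x) -> segint g1 a b <= segint g2 a b.
Proof.
by move=> h1 h2 h; apply: le_Rintegral => //; exact: segint_integrable.
Qed.

Lemma segint_eq g1 g2 a b : (forall x, a <= x <= b -> g1 x = g2 x) ->
  segint g1 a b = segint g2 a b.
Proof.
by move=> h; apply: eq_Rintegral => x /[1!inE] /=; rewrite in_itv /=; exact: h.
Qed.

Lemma cont_on_norm g a b : cont_on g a b -> cont_on (fun x => `|g x|) a b.
Proof. by move=> h x /h gx; exact: (continuous_comp gx (@norm_continuous _ _ _)). Qed.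

Lemma segint_norm g a b : cont_on g a b -> `|segint g a b| <= segint (fun x => `|g x|) a b.
Proof. by move=> h; apply: le_normr_Rintegral => //; exact: segint_integrable. Qed.

Lemma segint_FTC g F a b : a <= b -> cont_on g a b ->
  (forall x : R, is_derive x 1 F (g x)) -> segint g a b = F b - F a.
Proof.
move=> ab h dF; rewrite /segint /Rintegral.
move: ab; rewrite le_eqVlt => /orP[/eqP <-|ab].
  by rewrite set_itv1 integral_set1 subrr.
have cF x : {for x, continuous F}.
  by apply: differentiable_continuous; apply/derivable1_diffP; apply: ex_derive.
rewrite (@continuous_FTC2 _ g F) //.
- by apply: continuous_in_subspaceT => x /[1!inE] /=; rewrite in_itv /=; exact: h.
- split; [by move=> x _; apply: ex_derive|exact/cvg_at_right_filter/cF|].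
  exact/cvg_at_left_filter/cF.
- by move=> x _; rewrite derive1E; exact: derive_val.
Qed.

Definition pcont p a b := forall x, a <= x <= b -> forall e : R, 0 < e ->
  exists2 d : R, 0 < d & forall y, `|y - x| < d -> cm (p y - p x) <= e.

Lemma pcont_comp (psi : C -> R) p a b :
  (forall z w, `|psi z - psi w| <= cm (z - w)) -> pcont p a b ->
  cont_on (fun x => psi (p x)) a b.
Proof.
move=> hpsi hp x xab; apply/cvgrPdist_le => e e0.
have [d d0 hd] := hp x xab e e0; apply/nbhs_ballP; exists d => // y.
rewrite /ball_ /= distrC => /hd h; rewrite distrC.
exact: (le_trans (hpsi _ _)).
Qed.

Lemma pcont_Re p a b : pcont p a b -> cont_on (fun x => Rpart (p x)) a b.
Proof. by apply: pcont_comp => z w; rewrite -raddfB; exact: Rpart_le. Qed.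
Lemma pcont_Im p a b : pcont p a b -> cont_on (fun x => Ipart (p x)) a b.
Proof. by apply: pcont_comp => z w; rewrite -raddfB; exact: Ipart_le. Qed.

Lemma cm_dist z w : `|cm (z : C) - cm w| <= cm (z - w).
Proof.
rewrite ler_norml; apply/andP; split.
  have := cmD (w - z) z; rewrite subrK -[cm (w - z)]cmN opprB; lra.
have := cmD (z - w) w; rewrite subrK; lra.
Qed.
Lemma pcont_cm p a b : pcont p a b -> cont_on (fun x => cm (p x)) a b.
Proof. by apply: pcont_comp; exact: cm_dist. Qed.

Lemma pcontD p1 p2 a b : pcont p1 a b -> pcont p2 a b -> pcont (fun x => p1 x + p2 x) a b.
Proof.
move=> h1 h2 x xab e e0; have e2 : 0 < e / 2 by rewrite divr_gt0.
have [d1 d10 hd1] := h1 x xab _ e2; have [d2 d20 hd2] := h2 x xab _ e2.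
exists (Num.min d1 d2); first by rewrite lt_min d10.
move=> y; rewrite lt_min => /andP[/hd1 y1 /hd2 y2].
by rewrite opprD addrACA (le_trans (cmD _ _)) //; lra.
Qed.

Lemma pcontZ k p a b : pcont p a b -> pcont (fun x => k * p x) a b.
Proof.
move=> h x xab e e0; have k0 : 0 < cm k + 1 by rewrite ltr_wpDl // cm_ge0.
have [d d0 hd] := h x xab _ (divr_gt0 e0 k0); exists d => // y /hd hy.
rewrite -mulrBr cmM; apply: (@le_trans _ _ ((cm k + 1) * (e / (cm k + 1)))).
  by apply: ler_pM => //; rewrite ?cm_ge0 // lerDl.
by rewrite mulrC divfK // gt_eqF.
Qed.

Lemma pcont_cst k a b : pcont (fun=> k) a b.
Proof. by move=> x _ e e0; exists 1 => // y _; rewrite subrr cm0 ltW. Qed.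

Definition csegint p a b : C :=
  toC (segint (fun x => Rpart (p x)) a b, segint (fun x => Ipart (p x)) a b).

Lemma csegint_cat p a b c : a <= b -> b <= c -> pcont p a c ->
  csegint p a c = csegint p a b + csegint p b c.
Proof.
move=> ab bc h; apply: Cext; rewrite raddfD /=.
  by rewrite -segint_cat //; exact: pcont_Re.
by rewrite -segint_cat //; exact: pcont_Im.
Qed.

Lemma csegintD p1 p2 a b : pcont p1 a b -> pcont p2 a b ->
  csegint (fun x => p1 x + p2 x) a b = csegint p1 a b + csegint p2 a b.
Proof.
move=> h1 h2; apply: Cext; rewrite raddfD /=.
  rewrite -segintD; [|exact: pcont_Re..].
  by apply: segint_eq => x _; rewrite raddfD.
rewrite -segintD; [|exact: pcont_Im..].
by apply: segint_eq => x _; rewrite raddfD.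
Qed.

Lemma cont_onZ r g a b : cont_on g a b -> cont_on (fun x => r * g x) a b.
Proof. by move=> h x /h gx; apply: cvgM => //; exact: cvg_cst. Qed.

Lemma csegintZ k p a b : pcont p a b ->
  csegint (fun x => k * p x) a b = k * csegint p a b.
Proof.
move=> h; have hR := pcont_Re h; have hI := pcont_Im h.
apply: Cext; rewrite ?RpartM ?IpartM /=.
  rewrite -mulNr -!segintZ // -segintD; [|exact: cont_onZ..].
  by apply: segint_eq => x _; rewrite RpartM mulNr.
rewrite -!segintZ // -segintD; [|exact: cont_onZ..].
by apply: segint_eq => x _; rewrite IpartM.
Qed.

Lemma csegint_eq p1 p2 a b : (forall x, a <= x <= b -> p1 x = p2 x) ->
  csegint p1 a b = csegint p2 a b.
Proof. by move=> h; congr (toC (_, _)); apply: segint_eq => x /h ->. Qed.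

Lemma csegint_norm p a b : pcont p a b ->
  cm (csegint p a b) <= 2 * segint (fun x => cm (p x)) a b.
Proof.
move=> h; have hR := pcont_Re h; have hI := pcont_Im h; have hc := pcont_cm h.
apply: (le_trans (cm_le _)) => /=; rewrite mulr_natl mulr2n; apply: lerD.
  apply: (le_trans (segint_norm hR)); apply: segint_le => //.
    exact: cont_on_norm.
  by move=> x _; exact: Rpart_le.
apply: (le_trans (segint_norm hI)); apply: segint_le => //.
  exact: cont_on_norm.
by move=> x _; exact: Ipart_le.
Qed.

Lemma cont_on_cst r a b : cont_on (fun=> r) a b.
Proof. by move=> x _; exact: cvg_cst. Qed.

Lemma csegint_bound p M a b : a <= b -> pcont p a b ->
  (forall x, a <= x <= b -> cm (p x) <= M) ->
  cm (csegint p a b) <= 2 * M * (b - a).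
Proof.
move=> ab h hM; apply: (le_trans (csegint_norm h)).
rewrite -mulrA ler_wpM2l // -segint_cst //; apply: segint_le => //.
  exact: pcont_cm.
exact: cont_on_cst.
Qed.

Lemma csegint_affine (k l : C) a b : a <= b ->
  csegint (fun x => k + l * ofR x) a b =
  ofR (b - a) * k + ofR ((b ^+ 2 - a ^+ 2) / 2) * l.
Proof.
move=> ab.
have pid : pcont (fun x => ofR x) a b.
  by move=> x _ e e0; exists e => // y /ltW; rewrite -raddfB cm_ofR.
rewrite csegintD; [|exact: pcont_cst|exact: pcontZ].
rewrite csegintZ //; congr (_ + _).
  by apply: Cext; rewrite ?RpartZ ?IpartZ /= segint_cst // mulrC.
rewrite mulrC; congr (_ * _); apply: Cext => /=.
  rewrite mulrBl; apply: (@segint_FTC id (fun x => x ^+ 2 / 2)) => //.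
    by move=> x _ A.
  move=> x; have h : is_derive x 1 (fun y : R => y ^+ 2 / 2) ((2 * x) / 2).
    by apply: is_derive_eq; rewrite /GRing.scale /=; ring.
  by apply: is_derive_eq; field.
by rewrite segint_cst // mul0r.
Qed.

End SegmentIntegrals.

(** * Goursat's theorem on rectangles *)

Section Bisection.
Variable R : realType.
Implicit Types (a b c d x y : R).

Lemma halving_small (w e : R) : 0 <= w -> 0 < e -> exists N, forall n, (N <= n)%N -> w / 2 ^+ n < e.
Proof.
move=> w0 e0; exists (Num.truncn (w / e)) => n Nn.
have two : 0 < 2 ^+ n :> R by rewrite exprn_gt0.
rewrite ltr_pdivrMr // mulrC -ltr_pdivrMr //.
have h : w / e < n.+1%:R by rewrite -truncn_lt_nat // divr_ge0 // ltW.
by apply: (lt_le_trans h); rewrite -natrX ler_nat ltn_expl.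
Qed.

Lemma nested_point (a b : nat -> R) : (forall n, a n <= a n.+1) ->
  (forall n, b n.+1 <= b n) -> (forall n, a n <= b n) ->
  exists x, forall n, a n <= x <= b n.
Proof.
move=> ha hb hab.
have am m n : (m <= n)%N -> a m <= a n.
  by move=> /subnK <-; elim: (n - m)%N => // k IH; rewrite addSn (le_trans IH).
have bm m n : (m <= n)%N -> b n <= b m.
  by move=> /subnK <-; elim: (n - m)%N => // k IH; rewrite addSn (le_trans _ IH).
have ab m n : a m <= b n.
  by rewrite (le_trans (am _ _ (leq_maxl m n))) // (le_trans (hab _)) // bm // leq_maxr.
have hs : has_sup (range a).
  by split; [exists (a 0%N), 0%N|exists (b 0%N) => _ [n _ <-]].
exists (sup (range a)) => n; apply/andP; split.
  by apply: ub_le_sup; [case: hs|exists n].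
by apply: ge_sup; [case: hs|move=> _ [m _ <-]].
Qed.

(** If P failed, repeated quartering would produce nested rectangles on which P
    fails and which shrink to a point. *)
Lemma bisection (P : R -> R -> R -> R -> Prop) a b c d : a <= b -> c <= d ->
  (forall a' b' c' d', a <= a' -> a' <= b' -> b' <= b -> c <= c' -> c' <= d' -> d' <= d ->
    P a' ((a' + b') / 2) c' ((c' + d') / 2) ->
    P ((a' + b') / 2) b' c' ((c' + d') / 2) ->
    P a' ((a' + b') / 2) ((c' + d') / 2) d' ->
    P ((a' + b') / 2) b' ((c' + d') / 2) d' -> P a' b' c' d') ->
  (forall x y, a <= x <= b -> c <= y <= d -> exists2 e : R, 0 < e &
    forall a' b' c' d', a <= a' <= x -> x <= b' <= b -> c <= c' <= y -> y <= d' <= d ->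
    b' - a' < e -> d' - c' < e -> P a' b' c' d') ->
  P a b c d.
Proof.
move=> ab cd split4 loc; apply: contrapT => nP.
pose good (q : R * R * R * R) := let: (a', b', c', d') := q in
  [/\ a <= a' /\ a' <= b', b' <= b, c <= c' /\ c' <= d', d' <= d & ~ P a' b' c' d'].
pose next (q q' : R * R * R * R) := let: (a1, b1, c1, d1) := q in
  let: (a2, b2, c2, d2) := q' in
  [/\ a1 <= a2, b2 <= b1, c1 <= c2, d2 <= d1 & b2 - a2 = (b1 - a1) / 2 /\
      d2 - c2 = (d1 - c1) / 2].
have /choice[F hF] : forall q, exists q', good q -> good q' /\ next q q'.
  move=> q; have [gq|ngq] := pselect (good q); last by exists q.
  case: q gq => [[[a1 b1] c1] d1] [[aa1 ab1] bb1 [cc1 cd1] dd1 nP1].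
  pose m := (a1 + b1) / 2; pose n := (c1 + d1) / 2.
  have [am mb] : a1 <= m /\ m <= b1 by rewrite /m; split; lra.
  have [cn nd] : c1 <= n /\ n <= d1 by rewrite /n; split; lra.
  have [P1|nP'] := pselect (P a1 m c1 n); last first.
    exists (a1, m, c1, n) => _; split; split => //; rewrite /m /n; try (split; lra); lra.
  have [P2|nP'] := pselect (P m b1 c1 n); last first.
    exists (m, b1, c1, n) => _; split; split => //; rewrite /m /n; try (split; lra); lra.
  have [P3|nP'] := pselect (P a1 m n d1); last first.
    exists (a1, m, n, d1) => _; split; split => //; rewrite /m /n; try (split; lra); lra.
  have [P4|nP'] := pselect (P m b1 n d1); last first.
    exists (m, b1, n, d1) => _; split; split => //; rewrite /m /n; try (split; lra); lra.
  by exfalso; apply: nP1; exact: split4.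
pose s n := iter n F (a, b, c, d).
have gs n : good (s n).
  by elim: n => [|n /hF[]//]; split.
have ns n : next (s n) (s n.+1) by have [] := hF _ (gs n).
pose an n := (s n).1.1.1; pose bn n := (s n).1.1.2; pose cn n := (s n).1.2; pose dn n := (s n).2.
have sE n : s n = (an n, bn n, cn n, dn n) by rewrite /an /bn /cn /dn; case: (s n) => [[[]]].
have gE n : [/\ a <= an n /\ an n <= bn n, bn n <= b, c <= cn n /\ cn n <= dn n, dn n <= d &
    ~ P (an n) (bn n) (cn n) (dn n)] by have := gs n; rewrite sE.
have nE n : [/\ an n <= an n.+1, bn n.+1 <= bn n, cn n <= cn n.+1, dn n.+1 <= dn n &
    bn n.+1 - an n.+1 = (bn n - an n) / 2 /\ dn n.+1 - cn n.+1 = (dn n - cn n) / 2].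
  by have := ns n; rewrite !sE.
have wb n : bn n - an n = (b - a) / 2 ^+ n.
  elim: n => [|n IH]; first by rewrite expr0 divr1.
  by have [_ _ _ _ [-> _]] := nE n; rewrite IH exprS invfM mulrA mulrAC -mulrA.
have wd n : dn n - cn n = (d - c) / 2 ^+ n.
  elim: n => [|n IH]; first by rewrite expr0 divr1.
  by have [_ _ _ _ [_ ->]] := nE n; rewrite IH exprS invfM mulrA mulrAC -mulrA.
have [||n|x hx] := @nested_point an bn; [by move=> n; case: (nE n)..|by case: (gE n) => -[]|].
have [||n|y hy] := @nested_point cn dn; [by move=> n; case: (nE n)..|by case: (gE n) => _ _ []|].
have [||e e0 he] := loc x y; [exact: (hx 0%N)|exact: (hy 0%N)|].
have [|N1 h1] := @halving_small (b - a) e _ e0; first by rewrite subr_ge0.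
have [|N2 h2] := @halving_small (d - c) e _ e0; first by rewrite subr_ge0.
have [[aan anb] bnb [ccn cnd] dnd] := gE (maxn N1 N2); apply.
have /andP[x1 x2] := hx (maxn N1 N2); have /andP[y1 y2] := hy (maxn N1 N2).
apply: he; rewrite ?aan ?bnb ?ccn ?dnd ?x1 ?x2 ?y1 ?y2 //.
  by rewrite wb h1 // leq_maxl.
by rewrite wd h2 // leq_maxr.
Qed.

End Bisection.

Section Rectangles.
Variable R : realType.
Local Notation C := (Cplx R).
Implicit Types (a b c d x y : R) (f : C -> C) (z w : C).

(** The integral of f along the boundary of [a, b] x [c, d], counterclockwise. *)
Definition rint f a b c d : C :=
  csegint (fun x => f (toC (x, c))) a b - csegint (fun x => f (toC (x, d))) a b +
  Ci R * (csegint (fun y => f (toC (b, y))) c d - csegint (fun y => f (toC (a, y))) c d).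

Definition cont_edges f a b c d :=
  [/\ pcont (fun x => f (toC (x, c))) a b, pcont (fun x => f (toC (x, d))) a b,
      pcont (fun y => f (toC (b, y))) c d & pcont (fun y => f (toC (a, y))) c d].

Lemma pcont_hor f a b c : (forall x, a <= x <= b -> cont_at f (toC (x, c))) ->
  pcont (fun x => f (toC (x, c))) a b.
Proof.
move=> h x xab e e0; have [r r0 hr] := h x xab e e0; exists r => // y yx; apply: hr.
have -> : toC (y, c) - toC (x, c) = ofR (y - x) :> C.
  by apply: Cext; rewrite raddfB //= subrr.
by rewrite cm_ofR.
Qed.

Lemma pcont_ver f a c d : (forall y, c <= y <= d -> cont_at f (toC (a, y))) ->
  pcont (fun y => f (toC (a, y))) c d.
Proof.
move=> h x xab e e0; have [r r0 hr] := h x xab e e0; exists r => // y yx; apply: hr.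
have -> : toC (a, y) - toC (a, x) = Ci R * ofR (y - x) :> C.
  by rewrite CiM; apply: Cext; rewrite raddfB //= subrr oppr0.
by rewrite cmM cm_Ci mul1r cm_ofR.
Qed.

Definition inside a b c d z := a <= Rpart z <= b /\ c <= Ipart z <= d.
Definition on_edge a b c d z := inside a b c d z /\
  [\/ Rpart z = a, Rpart z = b, Ipart z = c | Ipart z = d].

Lemma cont_edgesP f a b c d : a <= b -> c <= d ->
  (forall z, on_edge a b c d z -> cont_at f z) -> cont_edges f a b c d.
Proof.
move=> ab cd h; split.
- by apply: pcont_hor => x xab; apply: h; split; [rewrite /inside /= lexx|apply: Or43].
- by apply: pcont_hor => x xab; apply: h; split; [rewrite /inside /= lexx andbT|apply: Or44].
- by apply: pcont_ver => x xab; apply: h; split; [rewrite /inside /= lexx andbT|apply: Or42].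
- by apply: pcont_ver => x xab; apply: h; split; [rewrite /inside /= lexx|apply: Or41].
Qed.

Lemma rintD f g a b c d : cont_edges f a b c d -> cont_edges g a b c d ->
  rint (fun z => f z + g z) a b c d = rint f a b c d + rint g a b c d.
Proof.
by move=> [f1 f2 f3 f4] [g1 g2 g3 g4]; rewrite /rint !csegintD //; ring.
Qed.

Lemma rintZ k f a b c d : cont_edges f a b c d ->
  rint (fun z => k * f z) a b c d = k * rint f a b c d.
Proof. by move=> [f1 f2 f3 f4]; rewrite /rint !csegintZ //; ring. Qed.

Lemma rint_eq f g a b c d : a <= b -> c <= d ->
  (forall z, on_edge a b c d z -> f z = g z) -> rint f a b c d = rint g a b c d.
Proof.
move=> ab cd h; rewrite /rint; congr (_ - _ + _ * (_ - _)); apply: csegint_eq => x xab; apply: h.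
- by split; [rewrite /inside /= lexx|apply: Or43].
- by split; [rewrite /inside /= lexx andbT|apply: Or44].
- by split; [rewrite /inside /= lexx andbT|apply: Or42].
- by split; [rewrite /inside /= lexx|apply: Or41].
Qed.

Lemma rint_bound f M a b c d : a <= b -> c <= d -> cont_edges f a b c d ->
  (forall z, on_edge a b c d z -> cm (f z) <= M) ->
  cm (rint f a b c d) <= 4 * M * ((b - a) + (d - c)).
Proof.
move=> ab cd [f1 f2 f3 f4] hM; rewrite /rint.
apply: (le_trans (cmD _ _)); rewrite cmM cm_Ci mul1r.
have h1 : cm (csegint (fun x => f (toC (x, c))) a b) <= 2 * M * (b - a).
  apply: csegint_bound => // x xab; apply: hM.
  by split; [rewrite /inside /= lexx|apply: Or43].
have h2 : cm (csegint (fun x => f (toC (x, d))) a b) <= 2 * M * (b - a).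
  apply: csegint_bound => // x xab; apply: hM.
  by split; [rewrite /inside /= lexx andbT|apply: Or44].
have h3 : cm (csegint (fun y => f (toC (b, y))) c d) <= 2 * M * (d - c).
  apply: csegint_bound => // x xab; apply: hM.
  by split; [rewrite /inside /= lexx andbT|apply: Or42].
have h4 : cm (csegint (fun y => f (toC (a, y))) c d) <= 2 * M * (d - c).
  apply: csegint_bound => // x xab; apply: hM.
  by split; [rewrite /inside /= lexx|apply: Or41].
apply: (le_trans (lerD (cmB _ _) (cmB _ _))).
apply: (le_trans (lerD (lerD h1 h2) (lerD h3 h4))).
by rewrite le_eqVlt; apply/orP; left; apply/eqP; ring.
Qed.

Lemma rint_affine (k l : C) a b c d : a <= b -> c <= d ->
  rint (fun z => k + l * z) a b c d = 0.
Proof.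
move=> ab cd.
have toCE x y : toC (x, y) = ofR x + Ci R * ofR y :> C by rewrite [LHS]CE.
have hor y : csegint (fun x => k + l * toC (x, y)) a b =
    ofR (b - a) * (k + l * (Ci R * ofR y)) + ofR ((b ^+ 2 - a ^+ 2) / 2) * l.
  rewrite -csegint_affine //; apply: csegint_eq => x _.
  by rewrite toCE; ring.
have ver x : csegint (fun y => k + l * toC (x, y)) c d =
    ofR (d - c) * (k + l * ofR x) + ofR ((d ^+ 2 - c ^+ 2) / 2) * (l * Ci R).
  rewrite -csegint_affine //; apply: csegint_eq => y _.
  by rewrite toCE; ring.
rewrite /rint !hor !ver.
have ii : Ci R * Ci R = -1 by rewrite CiM; apply: Cext => /=; rewrite ?oppr0.
rewrite !raddfB /=; ring: ii.
Qed.

Lemma rint_vsplit f a m b c d : a <= m -> m <= b ->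
  pcont (fun x => f (toC (x, c))) a b -> pcont (fun x => f (toC (x, d))) a b ->
  rint f a b c d = rint f a m c d + rint f m b c d.
Proof.
by move=> am mb hc hd; rewrite /rint (csegint_cat am mb hc) (csegint_cat am mb hd); ring.
Qed.

Lemma rint_hsplit f a b c n d : c <= n -> n <= d ->
  pcont (fun y => f (toC (a, y))) c d -> pcont (fun y => f (toC (b, y))) c d ->
  rint f a b c d = rint f a b c n + rint f a b n d.
Proof.
by move=> cn nd ha hb; rewrite /rint (csegint_cat cn nd ha) (csegint_cat cn nd hb); ring.
Qed.

Lemma cm_le_box a b c d z w : inside a b c d z -> inside a b c d w ->
  cm (z - w) <= (b - a) + (d - c).
Proof.
move=> [/andP[z1 z2] /andP[z3 z4]] [/andP[w1 w2] /andP[w3 w4]].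
apply: (le_trans (cm_le _)); rewrite !raddfB /=; apply: lerD.
  by rewrite ler_norml; lra.
by rewrite ler_norml; lra.
Qed.

(** The bound |rint f| <= e h^2, where h is half the perimeter, passes from the
    four quarters of a rectangle to the rectangle. On a small rectangle around z0,
    the affine part of f at z0 has integral 0, and the rest is at most e / 4 times
    the distance to z0. *)
Theorem goursat f a b c d : a <= b -> c <= d ->
  (forall z, inside a b c d z -> derivable f z 1) -> rint f a b c d = 0.
Proof.
move=> ab cd df.
have cf z : inside a b c d z -> cont_at f z by move=> /df; exact: derivable_cont.
apply: cm_eq0; apply/eqP; rewrite eq_le cm_ge0 andbT.
suff key e : 0 < e -> cm (rint f a b c d) <= e * ((b - a) + (d - c)) ^+ 2.
  apply/ler_addgt0Pl => e e0; rewrite addr0.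
  have s0 : 0 < ((b - a) + (d - c)) ^+ 2 + 1 by rewrite ltr_wpDl // sqr_ge0.
  apply: (le_trans (key _ (divr_gt0 e0 s0))).
  rewrite mulrAC ler_pdivrMr // ler_pM2l //; lra.
move=> e0; pose P a b c d := cm (rint f a b c d) <= e * ((b - a) + (d - c)) ^+ 2.
apply: (bisection (P := P)) => //.
  move=> a' b' c' d' aa ab' bb cc cd' dd; rewrite /P.
  set m := (a' + b') / 2; set n := (c' + d') / 2.
  have [am mb] : a' <= m /\ m <= b' by rewrite /m; split; lra.
  have [cn nd] : c' <= n /\ n <= d' by rewrite /n; split; lra.
  have hor y : c' <= y -> y <= d' -> pcont (fun x => f (toC (x, y))) a' b'.
    move=> cy yd; apply: pcont_hor => x /andP[ax xb]; apply: cf; split => /=.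
      by rewrite (le_trans aa) // (le_trans xb).
    by rewrite (le_trans cc) // (le_trans yd).
  have ver x : a' <= x -> x <= b' -> pcont (fun y => f (toC (x, y))) c' d'.
    move=> ax xb; apply: pcont_ver => y /andP[cy yd]; apply: cf; split => /=.
      by rewrite (le_trans aa) // (le_trans xb).
    by rewrite (le_trans cc) // (le_trans yd).
  move=> h1 h2 h3 h4.
  rewrite (rint_vsplit (m := m)) //; try exact: hor.
  rewrite (rint_hsplit (n := n) (b := m)) //; try exact: ver.
  rewrite (rint_hsplit (n := n) (a := m)) //; try exact: ver.
  apply: (le_trans (cmD _ _)).
  apply: (le_trans (lerD (cmD _ _) (cmD _ _))).
  apply: (le_trans (lerD (lerD h1 h3) (lerD h2 h4))).
  by rewrite le_eqVlt; apply/orP; left; apply/eqP; rewrite /m /n; field.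
move=> x y xab ycd; pose z0 : C := toC (x, y).
have [L hL] := (derivableP_complex f z0).1 (df z0 (conj xab ycd)).
have e4 : 0 < e / 4 by rewrite divr_gt0.
have [r r0 hr] := hL _ e4; exists (r / 2); first by rewrite divr_gt0.
move=> a' b' c' d' /andP[aa ax] /andP[xb bb] /andP[cc cy] /andP[yd dd] hb hd.
have [ab' cd'] : a' <= b' /\ c' <= d' by rewrite (le_trans ax xb) (le_trans cy yd).
have sub z : inside a' b' c' d' z -> inside a b c d z.
  move=> [/andP[h1 h2] /andP[h3 h4]]; split.
    by rewrite (le_trans aa) // (le_trans h2).
  by rewrite (le_trans cc) // (le_trans h4).
have z0in : inside a' b' c' d' z0 by split => /=; rewrite ?ax ?xb ?cy ?yd.
pose aff z := (f z0 - L * z0) + L * z.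
have caff z : cont_at aff z.
  apply: derivable_cont; apply/derivableP_complex; exists L => s s0; exists 1 => // w _.
  have -> : aff w - aff z - L * (w - z) = 0 by rewrite /aff; ring.
  by rewrite cm0 mulr_ge0 ?cm_ge0 // ltW.
have cre z : inside a b c d z -> cont_at (fun z => f z + (-1) * aff z) z.
  move=> /cf h1; apply: cont_atD => //; apply: cont_atM => //; exact: cont_at_cst.
rewrite /P; have -> : rint f a' b' c' d' = rint (fun z => f z + (-1) * aff z) a' b' c' d'.
  have e1 : cont_edges f a' b' c' d'.
    by apply: cont_edgesP => // z [/sub/cf].
  have e2 : cont_edges aff a' b' c' d' by apply: cont_edgesP.
  rewrite rintD // ?rintZ // ?rint_affine ?mulr0 ?addr0 //.
  apply: cont_edgesP => // z _; apply: cont_atM => //; exact: cont_at_cst.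
have box z : inside a' b' c' d' z -> cm (f z + -1 * aff z) <= e / 4 * ((b' - a') + (d' - c')).
  move=> zin; have hz := cm_le_box zin z0in.
  have -> : f z + -1 * aff z = f z - f z0 - L * (z - z0) by rewrite /aff; ring.
  apply: (le_trans (hr _ _)); first by apply: (le_lt_trans hz); lra.
  by rewrite ler_pM2l.
apply: (le_trans (rint_bound ab' cd' _ _)).
- by apply: cont_edgesP => // z [/sub/cre].
- by move=> z [zin _]; exact: (box z zin).
by rewrite le_eqVlt; apply/orP; left; apply/eqP; field.
Qed.

End Rectangles.

Notation in_square w s := (inside (Rpart w - s) (Rpart w + s) (Ipart w - s) (Ipart w + s)).
Notation on_square w s := (on_edge (Rpart w - s) (Rpart w + s) (Ipart w - s) (Ipart w + s)).

(** * Cauchy's formula on rectangles *)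

Section Cauchy.
Variable R : realType.
Local Notation C := (Cplx R).
Implicit Types (a b c d x y r : R) (f : C -> C) (z w : C).

(** The four rectangles cut off around the small square do not contain w, and
    Goursat's theorem removes them one by one. *)
Lemma rint_puncture f w a b c d r : 0 < r ->
  a < Rpart w - r -> Rpart w + r < b -> c < Ipart w - r -> Ipart w + r < d ->
  (forall z, inside a b c d z -> z <> w -> derivable f z 1) ->
  rint f a b c d =
  rint f (Rpart w - r) (Rpart w + r) (Ipart w - r) (Ipart w + r).
Proof.
set p := Rpart w - r; set q := Rpart w + r; set s := Ipart w - r; set t := Ipart w + r.
move=> r0 ap qb cs td df.
have [pw wq] : p < Rpart w /\ Rpart w < q by rewrite /p /q; split; lra.
have [sw wt] : s < Ipart w /\ Ipart w < t by rewrite /s /t; split; lra.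
have cf z : inside a b c d z -> z <> w -> cont_at f z.
  by move=> h /(df z h); exact: derivable_cont.
have hor y a' b' : c <= y <= d -> y <> Ipart w -> a <= a' -> b' <= b ->
    pcont (fun x => f (toC (x, y))) a' b'.
  move=> cyd yw aa bb; apply: pcont_hor => x /andP[ax xb]; apply: cf.
    by split => //=; rewrite (le_trans aa) // (le_trans xb).
  by move=> /(congr1 (@Ipart R)) /=.
have ver x c' d' : a <= x <= b -> x <> Rpart w -> c <= c' -> d' <= d ->
    pcont (fun y => f (toC (x, y))) c' d'.
  move=> cyd yw aa bb; apply: pcont_ver => y /andP[ax xb]; apply: cf.
    by split => //=; rewrite (le_trans aa) // (le_trans xb).
  by move=> /(congr1 (@Rpart R)) /=.
have zero a' b' c' d' : a <= a' -> a' <= b' -> b' <= b -> c <= c' -> c' <= d' -> d' <= d ->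
    ~ inside a' b' c' d' w -> rint f a' b' c' d' = 0.
  move=> aa ab' bb cc cd' dd nw; apply: goursat => // z zin; apply: df.
    case: zin => /andP[h1 h2] /andP[h3 h4]; split.
      by rewrite (le_trans aa) // (le_trans h2).
    by rewrite (le_trans cc) // (le_trans h4).
  by move=> zw; apply: nw; rewrite -zw.
have hc a' b' : a <= a' -> b' <= b -> pcont (fun x => f (toC (x, c))) a' b'.
  by apply: hor; [lra|apply/eqP; rewrite lt_eqF //; lra].
have hd a' b' : a <= a' -> b' <= b -> pcont (fun x => f (toC (x, d))) a' b'.
  by apply: hor; [lra|apply/eqP; rewrite gt_eqF //; lra].
have vp c' d' : c <= c' -> d' <= d -> pcont (fun y => f (toC (p, y))) c' d'.
  by apply: ver; [lra|apply/eqP; rewrite lt_eqF //; lra].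
have vq c' d' : c <= c' -> d' <= d -> pcont (fun y => f (toC (q, y))) c' d'.
  by apply: ver; [lra|apply/eqP; rewrite gt_eqF //; lra].
rewrite (@rint_vsplit _ f a p b c d); [|lra|lra|apply: hc; lra|apply: hd; lra].
rewrite (zero a p c d) ?add0r; [|lra|lra|lra|lra|lra|lra|by move=> [/=]; lra].
rewrite (@rint_vsplit _ f p q b c d); [|lra|lra|apply: hc; lra|apply: hd; lra].
rewrite (zero q b c d) ?addr0; [|lra|lra|lra|lra|lra|lra|by move=> [/=]; lra].
rewrite (@rint_hsplit _ f p q c s d); [|lra|lra|apply: vp; lra|apply: vq; lra].
rewrite (zero p q c s) ?add0r; [|lra|lra|lra|lra|lra|lra|by move=> [_ /=]; lra].
rewrite (@rint_hsplit _ f p q s t d); [|lra|lra|apply: vp; lra|apply: vq; lra].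
by rewrite (zero p q t d) ?addr0; [|lra|lra|lra|lra|lra|lra|by move=> [_ /=]; lra].
Qed.

Lemma small_radius (e1 e2 e3 e4 e5 e6 : R) : 0 < e1 -> 0 < e2 -> 0 < e3 -> 0 < e4 ->
  0 < e5 -> 0 < e6 -> exists r, [/\ 0 < r, r < e1 /\ r < e2, r < e3 /\ r < e4 & r < e5 /\ r < e6].
Proof.
move=> h1 h2 h3 h4 h5 h6.
pose m := Num.min e1 (Num.min e2 (Num.min e3 (Num.min e4 (Num.min e5 e6)))).
have m0 : 0 < m by rewrite /m !lt_min h1 h2 h3 h4 h5 h6.
have : m <= m by []; rewrite {2}/m !le_min => /andP[k1 /andP[k2 /andP[k3 /andP[k4 /andP[k5 k6]]]]].
by exists (m / 2); split; try split; lra.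
Qed.

(** The quotient is bounded near w, and the boundary of the square left by
    rint_puncture can be made arbitrarily short. *)
Lemma quot_rint0 f w a b c d : a < Rpart w < b -> c < Ipart w < d ->
  (forall z, inside a b c d z -> derivable f z 1) ->
  rint (fun z => (f z - f w) / (z - w)) a b c d = 0.
Proof.
move=> /andP[aw wb] /andP[cw wd] df.
have win : inside a b c d w by split; apply/andP; split; apply: ltW.
have [L hL] := (derivableP_complex f w).1 (df w win).
have [e e0 he] := hL 1 ltr01; pose M := cm L + 1.
have M0 : 0 < M by rewrite ltr_wpDl // cm_ge0.
apply: cm_eq0; apply/eqP; rewrite eq_le cm_ge0 andbT.
apply/ler_addgt0Pl => eps eps0; rewrite addr0.
have [||||||r [r0 [r1 r2] [r3 r4] [r5 r6]]] := @small_radius (Rpart w - a) (b - Rpart w)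
  (Ipart w - c) (d - Ipart w) (e / 4) (eps / (16%:R * M)); rewrite ?subr_gt0 ?divr_gt0 ?mulr_gt0 //.
have dq z : inside a b c d z -> z <> w -> derivable (fun z => (f z - f w) / (z - w)) z 1.
  move=> zin /eqP zw; apply: derivable_quot => //.
  by apply: derivable_addc; exact: df.
rewrite (rint_puncture (r := r) (w := w)) //; try lra.
have sub z : in_square w r z ->
    inside a b c d z.
  by move=> [? ?]; split; lra.
have nw z : on_square w r z -> z <> w.
  by move=> [_ h] zw; move: h; rewrite zw => -[]; lra.
apply: (le_trans (rint_bound _ _ _ (M := M) _)); try lra.
- apply: cont_edgesP; try lra.
  by move=> z h; apply: derivable_cont; apply: dq (nw _ h); case: h => /sub.
- move=> z h; have zw := nw _ h; have [zin _] := h.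
  have zwin := cm_le_box zin (_ : inside _ _ _ _ w).
  have /he h1 : cm (z - w) < e by apply: (le_lt_trans (zwin _)); [split|]; lra.
  have z0 : 0 < cm (z - w) by rewrite cm_gt0 // subr_eq0; apply/eqP.
  rewrite cmM cmV ler_pdivrMr // /M mulrDl -cmM.
  have -> : f z - f w = L * (z - w) + (f z - f w - L * (z - w)) by ring.
  by apply: (le_trans (cmD _ _)); rewrite lerD2l.
have -> : 4 * M * (Rpart w + r - (Rpart w - r) + (Ipart w + r - (Ipart w - r))) =
  r * (16%:R * M) by ring.
by rewrite -ler_pdivlMr ?mulr_gt0 // ltW.
Qed.

Lemma Rpart_inv z : Rpart z^-1 = Rpart z / (Rpart z ^+ 2 + Ipart z ^+ 2).
Proof. by case: z. Qed.
Lemma Ipart_inv z : Ipart z^-1 = - Ipart z / (Rpart z ^+ 2 + Ipart z ^+ 2).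
Proof. by case: z => x y /=; rewrite mulNr. Qed.

(** The integrand is the imaginary part of 1 / (x - i r - x0). *)
Lemma poisson_cont x0 r : 0 < r ->
  cont_on (fun x => r / ((x - x0) ^+ 2 + r ^+ 2)) (x0 - r) (x0 + r).
Proof.
move=> r0; pose w : C := toC (x0, 0).
have h : pcont (fun x => 1 / (toC (x, - r) - w)) (x0 - r) (x0 + r).
  apply: (@pcont_hor _ (fun z => 1 / (z - w))) => x _; apply: derivable_cont.
  apply: derivable_quot; last exact: derivable_cst.
  by apply/eqP => /(congr1 (@Ipart R)) /=; lra.
have -> : (fun x => r / ((x - x0) ^+ 2 + r ^+ 2)) =
    (fun x => Ipart (1 / (toC (x, - r) - w))).
  apply/funext => x; rewrite div1r Ipart_inv !raddfB /= subr0 opprK.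
  by rewrite sqrrN opprK addr0.
exact: pcont_Im.
Qed.

Lemma poisson_segint x0 r : 0 < r ->
  segint (fun x => r / ((x - x0) ^+ 2 + r ^+ 2)) (x0 - r) (x0 + r) = 2 * atan 1.
Proof.
move=> r0; have rN0 : r != 0 by rewrite gt_eqF.
pose F x := atan ((x - x0) / r).
have pos x : 0 < (x - x0) ^+ 2 + r ^+ 2 by rewrite ltr_wpDl ?sqr_ge0 // exprn_gt0.
have dF x : is_derive x 1 F (r / ((x - x0) ^+ 2 + r ^+ 2)).
  have h1 : is_derive x 1 (fun x : R => (x - x0) / r) r^-1.
    by apply: is_derive_eq; rewrite /GRing.scale /=; ring.
  have h2 := is_derive1_atan ((x - x0) / r).
  have h3 : is_derive x 1 F _ := @is_derive1_comp _ atan (fun x => (x - x0) / r) _ _ _ h2 h1.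
  apply: is_derive_eq; rewrite /GRing.scale /=.
  by field; rewrite rN0 gt_eqF //; apply: ltr_wpDl; rewrite ?sqr_ge0 ?exprn_gt0.
rewrite (segint_FTC (F := F)) //; last 2 first.
- by lra.
- exact: poisson_cont.
rewrite /F.
have -> : (x0 + r - x0) / r = 1 by field.
have -> : (x0 - r - x0) / r = - 1 by field.
by rewrite atanN; ring.
Qed.

(** This is 2 pi i, written with atan 1 for pi / 4: over each side of a square
    centred at w, the integral of 1 / (z - w) has imaginary part pi / 2. *)
Definition winding : C := Ci R * ofR (8 * atan 1).

Lemma winding_neq0 : winding != 0.
Proof.
apply/eqP => /(congr1 (@cm R)); rewrite cmM cm_Ci mul1r cm_ofR cm0 => /eqP.
rewrite normr_eq0 atan1 => /eqP h; have := pi_gt0 R; lra.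
Qed.

(** The real parts of the integrals over opposite horizontal sides agree, as do the
    imaginary parts over opposite vertical sides; four Poisson integrals remain. *)
Lemma rint_inv_centered w r : 0 < r ->
  rint (fun z => (z - w)^-1) (Rpart w - r) (Rpart w + r) (Ipart w - r) (Ipart w + r) = winding.
Proof.
move=> r0; set x0 := Rpart w; set y0 := Ipart w.
have cinv z : z != w -> cont_at (fun z => (z - w)^-1) z.
  by move=> zw; apply: derivable_cont; exact: derivable_inv.
have hor y a b : y != y0 -> pcont (fun x => (toC (x, y) - w)^-1) a b.
  move=> yy; apply: (@pcont_hor _ (fun z => (z - w)^-1)) => x _; apply: cinv.
  by apply: contra yy => /eqP e; rewrite /y0 -e.
have ver x a b : x != x0 -> pcont (fun y => (toC (x, y) - w)^-1) a b.
  move=> xx; apply: (@pcont_ver _ (fun z => (z - w)^-1)) => y _; apply: cinv.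
  by apply: contra xx => /eqP e; rewrite /x0 -e.
have eI (f g : R -> R) a b : f =1 g -> segint f a b = segint g a b.
  by move=> fg; apply: segint_eq => t _.
rewrite /rint /csegint.
pose U := segint (fun x => (x - x0) / ((x - x0) ^+ 2 + r ^+ 2)) (x0 - r) (x0 + r).
pose W := segint (fun y => - (y - y0) / ((y - y0) ^+ 2 + r ^+ 2)) (y0 - r) (y0 + r).
have J0 := poisson_segint x0 r0; have K0 := poisson_segint y0 r0.
have nJ x1 : segint (fun x => - r / ((x - x1) ^+ 2 + r ^+ 2)) (x1 - r) (x1 + r) = - (2 * atan 1).
  rewrite -(poisson_segint x1 r0) -[RHS]mulN1r -segintZ; last exact: poisson_cont.
  by apply: eI => x; rewrite mulN1r mulNr.
have sq1 (y : R) : y - r - y = - r by ring.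
have sq2 (y : R) : y + r - y = r by ring.
have -> : segint (fun x => Rpart (toC (x, y0 - r) - w)^-1) (x0 - r) (x0 + r) = U.
  by apply: eI => x; rewrite Rpart_inv (raddfB (@Rpart R)) (raddfB (@Ipart R)) /= -/x0 -/y0 sq1 sqrrN.
have -> : segint (fun x => Rpart (toC (x, y0 + r) - w)^-1) (x0 - r) (x0 + r) = U.
  by apply: eI => x; rewrite Rpart_inv (raddfB (@Rpart R)) (raddfB (@Ipart R)) /= -/x0 -/y0 sq2.
have -> : segint (fun x => Ipart (toC (x, y0 - r) - w)^-1) (x0 - r) (x0 + r) = 2 * atan 1.
  by rewrite -J0; apply: eI => x; rewrite Ipart_inv (raddfB (@Rpart R)) (raddfB (@Ipart R)) /= -/x0 -/y0 sq1 sqrrN opprK.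
have -> : segint (fun x => Ipart (toC (x, y0 + r) - w)^-1) (x0 - r) (x0 + r) = - (2 * atan 1).
  by rewrite -(nJ x0); apply: eI => x; rewrite Ipart_inv (raddfB (@Rpart R)) (raddfB (@Ipart R)) /= -/x0 -/y0 sq2.
have -> : segint (fun y => Rpart (toC (x0 + r, y) - w)^-1) (y0 - r) (y0 + r) = 2 * atan 1.
  by rewrite -K0; apply: eI => x; rewrite Rpart_inv (raddfB (@Rpart R)) (raddfB (@Ipart R)) /= -/x0 -/y0 sq2 [r ^+ 2 + _]addrC.
have -> : segint (fun y => Rpart (toC (x0 - r, y) - w)^-1) (y0 - r) (y0 + r) = - (2 * atan 1).
  by rewrite -(nJ y0); apply: eI => x; rewrite Rpart_inv (raddfB (@Rpart R)) (raddfB (@Ipart R)) /= -/x0 -/y0 sq1 sqrrN [r ^+ 2 + _]addrC.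
have -> : segint (fun y => Ipart (toC (x0 + r, y) - w)^-1) (y0 - r) (y0 + r) = W.
  by apply: eI => x; rewrite Ipart_inv (raddfB (@Rpart R)) (raddfB (@Ipart R)) /= -/x0 -/y0 sq2 [r ^+ 2 + _]addrC.
have -> : segint (fun y => Ipart (toC (x0 - r, y) - w)^-1) (y0 - r) (y0 + r) = W.
  by apply: eI => x; rewrite Ipart_inv (raddfB (@Rpart R)) (raddfB (@Ipart R)) /= -/x0 -/y0 sq1 sqrrN [r ^+ 2 + _]addrC.
rewrite /winding !CiM; apply: Cext; rewrite ?raddfD ?raddfB /= ?raddfB /=; ring.
Qed.

Lemma rint_inv w a b c d : a < Rpart w < b -> c < Ipart w < d ->
  rint (fun z => (z - w)^-1) a b c d = winding.
Proof.
move=> /andP[aw wb] /andP[cw wd].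
have [||||||r [r0 [r1 r2] [r3 r4] _]] := @small_radius (Rpart w - a) (b - Rpart w)
  (Ipart w - c) (d - Ipart w) 1 1; rewrite ?subr_gt0 //.
rewrite (rint_puncture (w := w) r0); [exact: rint_inv_centered|lra|lra|lra|lra|].
by move=> z _ /eqP zw; exact: derivable_inv.
Qed.

Theorem cauchy_formula f w a b c d : a < Rpart w < b -> c < Ipart w < d ->
  (forall z, inside a b c d z -> derivable f z 1) ->
  rint (fun z => f z / (z - w)) a b c d = winding * f w.
Proof.
move=> wx wy df; have := quot_rint0 wx wy df.
have /andP[aw wb] := wx; have /andP[cw wd] := wy.
have ab : a <= b by lra. have cd : c <= d by lra.
have nw z : on_edge a b c d z -> z != w.
  by move=> [_ h]; apply/eqP => zw; move: h; rewrite zw => -[]; lra.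
have cE1 : cont_edges (fun z => f z / (z - w)) a b c d.
  apply: cont_edgesP => // z ze; apply: derivable_cont; apply: derivable_quot; first exact: nw.
  by apply: df; case: ze.
have cE2 : cont_edges (fun z => (z - w)^-1) a b c d.
  apply: cont_edgesP => // z ze; apply: derivable_cont.
  by apply: derivable_inv; exact: nw.
have cE3 : cont_edges (fun z => - f w * (z - w)^-1) a b c d.
  by case: cE2 => *; split; exact: pcontZ.
have -> : (fun z => (f z - f w) / (z - w)) = (fun z => f z / (z - w) + - f w * (z - w)^-1).
  by apply/funext => z; rewrite mulrBl mulNr.
rewrite rintD // rintZ // rint_inv // mulNr => /eqP.
by rewrite subr_eq0 => /eqP ->; rewrite mulrC.
Qed.

End Cauchy.

(** * Locally uniform limits of holomorphic functions *)

Section UniformLimits.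
Variable R : realType.
Local Notation C := (Cplx R).
Implicit Types (a b c d x y r : R) (f : C -> C) (z w v : C).

Lemma cont_on_bounded (g : R -> R) a b : a <= b -> cont_on g a b ->
  exists M, forall x, a <= x <= b -> g x <= M.
Proof.
move=> ab h; have cg : {within `[a, b], continuous g}.
  by apply: continuous_in_subspaceT => x /[1!inE] /=; rewrite in_itv /=; exact: h.
have [m _ hm] := EVT_max ab cg; exists (g m) => x xab; apply: hm.
by rewrite in_itv.
Qed.

Lemma cont_edges_bounded f a b c d : a <= b -> c <= d -> cont_edges f a b c d ->
  exists2 M, 0 <= M & forall z, on_edge a b c d z -> cm (f z) <= M.
Proof.
move=> ab cd [f1 f2 f3 f4].
have [M1 h1] := cont_on_bounded ab (pcont_cm f1).
have [M2 h2] := cont_on_bounded ab (pcont_cm f2).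
have [M3 h3] := cont_on_bounded cd (pcont_cm f3).
have [M4 h4] := cont_on_bounded cd (pcont_cm f4).
exists (Num.max M1 (Num.max M2 (Num.max M3 M4))).
  by rewrite le_max (le_trans (cm_ge0 _) (h1 a _)) // lexx.
move=> z [[zx zy] h]; rewrite !le_max.
have zE : z = toC (Rpart z, Ipart z) by case: (z).
case: h => h; rewrite zE h.
- by rewrite h4 ?orbT.
- by rewrite h3 ?orbT.
- by rewrite h1.
- by rewrite h2 ?orbT.
Qed.

Lemma cont_inv w z : z != w -> cont_at (fun y : C => (y - w)^-1) z.
Proof. by move=> zw; apply: derivable_cont; exact: derivable_inv. Qed.

Lemma le_cmV k z : 0 < k -> k <= cm z -> cm z^-1 <= k^-1.
Proof. by move=> k0 kz; rewrite cmV lef_pV2 ?posrE // (lt_le_trans k0). Qed.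

(** Differentiation under the integral sign, by the identity
    1/(z - v) = 1/(z - w) + (v - w)/(z - w)^2 + (v - w)^2/((z - w)^2 (z - v)). *)
Lemma holo_of_cauchy f w a b c d r : a <= b -> c <= d -> 0 < r ->
  (forall z, on_edge a b c d z -> cont_at f z) ->
  (forall z, on_edge a b c d z -> 2 * r <= cm (z - w)) ->
  (forall v, cm (v - w) <= r ->
    winding R * f v = rint (fun z => f z / (z - v)) a b c d) ->
  derivable f w 1.
Proof.
move=> ab cd r0 cf far cauchy; have wN0 := winding_neq0 R.
have cE : cont_edges f a b c d by exact: cont_edgesP.
have [M M0 hM] := cont_edges_bounded ab cd cE.
pose W := winding R.
pose D := W^-1 * rint (fun z => f z * ((z - w)^-1 * (z - w)^-1)) a b c d.
pose K := cm W^-1 * (4 * (M * (r^-1 * r^-1 * r^-1)) * ((b - a) + (d - c))).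
have K0 : 0 <= K.
  have rV : 0 <= r^-1 by rewrite invr_ge0 ltW.
  have L0 : 0 <= (b - a) + (d - c) by rewrite addr_ge0 ?subr_ge0.
  by rewrite /K; repeat (apply: mulr_ge0 => //); exact: cm_ge0.
apply/derivableP_complex; exists D => e e0.
have K1 : 0 < K + 1 by rewrite ltr_wpDl.
exists (Num.min r (e / (K + 1))); first by rewrite lt_min r0 divr_gt0.
move=> v; rewrite lt_min => /andP[vr ve].
have nw z : on_edge a b c d z -> z != w.
  by move=> /far h; apply/eqP => zw; move: h; rewrite zw subrr cm0; lra.
have farv z : on_edge a b c d z -> r <= cm (z - v).
  move=> /far h; have := cmD (z - v) (v - w); rewrite subrKA; lra.
have nv z : on_edge a b c d z -> z != v.
  by move=> /farv h; apply/eqP => zw; move: h; rewrite zw subrr cm0; lra.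
pose ker z := (z - w)^-1 * (z - w)^-1 * (z - v)^-1.
have cker z : on_edge a b c d z -> cont_at (fun z => f z * ker z) z.
  move=> ze; apply: cont_atM; first exact: cf.
  by apply: cont_atM; [apply: cont_atM|]; apply: cont_inv; [exact: nw..|exact: nv].
have c1 : cont_edges (fun z => f z / (z - w)) a b c d.
  apply: cont_edgesP => // z ze; apply: cont_atM; first exact: cf.
  by apply: cont_inv; exact: nw.
have c2 : cont_edges (fun z => f z * ((z - w)^-1 * (z - w)^-1)) a b c d.
  apply: cont_edgesP => // z ze; apply: cont_atM; first exact: cf.
  by apply: cont_atM; apply: cont_inv; exact: nw.
have c3 : cont_edges (fun z => f z * ker z) a b c d by exact: cont_edgesP.
have cZ g k : cont_edges g a b c d -> cont_edges (fun z => k * g z) a b c d.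
  by case=> *; split; exact: pcontZ.
have cD g h : cont_edges g a b c d -> cont_edges h a b c d ->
    cont_edges (fun z => g z + h z) a b c d.
  by case=> ? ? ? ? [? ? ? ?]; split; exact: pcontD.
have key : f v - f w - D * (v - w) =
    W^-1 * (v - w) ^+ 2 * rint (fun z => f z * ker z) a b c d.
  have hv := cauchy v (ltW vr).
  have hw : W * f w = rint (fun z => f z / (z - w)) a b c d.
    by apply: cauchy; rewrite subrr cm0 ltW.
  have dec : rint (fun z => f z / (z - v)) a b c d =
      rint (fun z => f z / (z - w)) a b c d +
      ((v - w) * rint (fun z => f z * ((z - w)^-1 * (z - w)^-1)) a b c d +
      (v - w) ^+ 2 * rint (fun z => f z * ker z) a b c d).
    rewrite -!rintZ // -!rintD //; try by [apply: cZ|apply: cD; apply: cZ].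
    apply: rint_eq => // z ze; rewrite /ker.
    have h1 : z - w != 0 by rewrite subr_eq0 nw.
    have h2 : z - v != 0 by rewrite subr_eq0 nv.
    by field; rewrite h1 h2.
  rewrite -[f v](mulKf wN0) hv -[f w](mulKf wN0) hw dec /D -/W; ring.
rewrite key (cmM (_ * _)) (cmM W^-1) cmX.
have hb : cm (rint (fun z => f z * ker z) a b c d) <=
    4 * (M * (r^-1 * r^-1 * r^-1)) * ((b - a) + (d - c)).
  apply: rint_bound => // z ze; rewrite cmM; apply: ler_pM; rewrite ?cm_ge0 //.
    exact: hM.
  have h1 : cm (z - w)^-1 <= r^-1 by apply: le_cmV => //; have := far z ze; lra.
  have h2 : cm (z - v)^-1 <= r^-1 by apply: le_cmV => //; exact: farv.
  by rewrite /ker !cmM; repeat (apply: ler_pM; rewrite ?mulr_ge0 ?cm_ge0 //).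
apply: (@le_trans _ _ (K * cm (v - w) ^+ 2)).
  rewrite /K [leLHS]mulrAC; apply: ler_wpM2r; first exact: sqr_ge0.
  by apply: ler_wpM2l => //; exact: cm_ge0.
rewrite expr2 mulrA ler_wpM2r ?cm_ge0 //.
apply: (@le_trans _ _ ((K + 1) * (e / (K + 1)))).
  by apply: ler_pM; rewrite ?cm_ge0 ?lerDl // ltW.
by rewrite mulrC divfK // gt_eqF.
Qed.

Lemma ball_square w s z : in_square w s z ->
  cm (z - w) <= 2 * s.
Proof.
move=> [/andP[h1 h2] /andP[h3 h4]]; apply: (le_trans (cm_le _)).
rewrite (raddfB (@Rpart R)) (raddfB (@Ipart R)) /= mulr_natl mulr2n.
by apply: lerD; rewrite ler_norml; lra.
Qed.

Lemma edge_far w s z : on_square w s z ->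
  s <= cm (z - w).
Proof.
move=> [_ h]; have := Rpart_le (z - w); have := Ipart_le (z - w).
rewrite (raddfB (@Rpart R)) (raddfB (@Ipart R)) /= !ler_norml.
by case: h => ->; lra.
Qed.

Lemma square_strict w v s t : cm (v - w) <= t -> t < s ->
  Rpart w - s < Rpart v < Rpart w + s /\ Ipart w - s < Ipart v < Ipart w + s.
Proof.
move=> vw ts; have := le_trans (Rpart_le (v - w)) vw; have := le_trans (Ipart_le (v - w)) vw.
by rewrite (raddfB (@Rpart R)) (raddfB (@Ipart R)) /= !ler_norml; lra.
Qed.

(** Cauchy's formula passes to uniform limits, and holo_of_cauchy recovers
    differentiability from the formula. *)
Theorem holo_limit (F : nat -> C -> C) f w r : 0 < r ->
  (forall n z, cm (z - w) < r -> derivable (F n) z 1) ->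
  (forall e : R, 0 < e -> exists n, forall z, cm (z - w) < r -> cm (F n z - f z) <= e) ->
  derivable f w 1.
Proof.
move=> r0 dF unif; pose s := r / 4.
have s0 : 0 < s by rewrite divr_gt0.
have cf z : cm (z - w) < r -> cont_at f z.
  move=> zr e e0; have e3 : 0 < e / 3 by rewrite divr_gt0.
  have [n hn] := unif _ e3; have [d d0 hd] := derivable_cont (dF n z zr) e3.
  exists (Num.min d (r - cm (z - w))); first by rewrite lt_min d0 subr_gt0.
  move=> y; rewrite lt_min => /andP[/hd h1 yz].
  have yr : cm (y - w) < r.
    by have := cmD (y - z) (z - w); rewrite subrKA; lra.
  have -> : f y - f z = (F n y - F n z) - (F n y - f y) + (F n z - f z) by ring.
  have h2 := hn y yr; have h3 := hn z zr.
  apply: (le_trans (cmD _ _)); have := cmB (F n y - F n z) (F n y - f y); lra.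
have ab : Rpart w - s <= Rpart w + s by lra.
have cd : Ipart w - s <= Ipart w + s by lra.
have inr z : in_square w s z -> cm (z - w) < r.
  by move=> /ball_square h; apply: (le_lt_trans h); rewrite /s; lra.
apply: (@holo_of_cauchy f w _ _ _ _ (s / 2) ab cd).
- by rewrite divr_gt0.
- by move=> z [/inr/cf].
- by move=> z /edge_far; lra.
move=> v vw.
have s2 : s / 2 < s by lra.
have [vx vy] := square_strict vw s2.
have farv z : on_square w s z ->
    s / 2 <= cm (z - v).
  by move=> /edge_far h; have := cmD (z - v) (v - w); rewrite subrKA; lra.
have nv z : on_square w s z -> z != v.
  by move=> /farv h; apply/eqP => zw; move: h; rewrite zw subrr cm0; lra.
apply/eqP; rewrite -subr_eq0; apply/eqP/cm_eq0/eqP.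
rewrite eq_le cm_ge0 andbT.
pose K := cm (winding R) + 4 * (s / 2)^-1 * (4 * s).
have K0 : 0 < K + 1.
  have sV : 0 < (s / 2)^-1 by rewrite invr_gt0 divr_gt0.
  rewrite ltr_wpDl // addr_ge0 ?cm_ge0 //.
  by repeat (apply: mulr_ge0 => //); apply: ltW.
apply/ler_addgt0Pl => e e0; rewrite addr0.
have [n hn] := unif _ (divr_gt0 e0 K0).
have hc : rint (fun z => F n z / (z - v)) (Rpart w - s) (Rpart w + s) (Ipart w - s)
    (Ipart w + s) = winding R * F n v.
  by apply: (cauchy_formula vx vy) => z /inr; exact: dF.
have vr : cm (v - w) < r by apply: (le_lt_trans vw); rewrite /s; lra.
have c1 : cont_edges (fun z => f z / (z - v)) (Rpart w - s) (Rpart w + s) (Ipart w - s) (Ipart w + s).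
  apply: cont_edgesP => // z ze; apply: cont_atM; first by apply: cf; apply: inr; case: ze.
  by apply: cont_inv; exact: nv.
have c2 : cont_edges (fun z => F n z / (z - v)) (Rpart w - s) (Rpart w + s) (Ipart w - s) (Ipart w + s).
  apply: cont_edgesP => // z ze; apply: cont_atM.
    by apply: derivable_cont; apply: dF; apply: inr; case: ze.
  by apply: cont_inv; exact: nv.
have c3 : cont_edges (fun z => -1 * (f z / (z - v))) (Rpart w - s) (Rpart w + s) (Ipart w - s) (Ipart w + s).
  by case: c1 => *; split; exact: pcontZ.
have -> : winding R * f v - rint (fun z => f z / (z - v)) (Rpart w - s) (Rpart w + s) (Ipart w - s) (Ipart w + s) =
   rint (fun z => F n z / (z - v) + -1 * (f z / (z - v))) (Rpart w - s) (Rpart w + s) (Ipart w - s) (Ipart w + s)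
   - winding R * (F n v - f v).
  by rewrite rintD // rintZ // hc; ring.
apply: (le_trans (cmB _ _)); rewrite cmM.
have h1 := hn v vr.
have h2 : cm (rint (fun z => F n z / (z - v) + -1 * (f z / (z - v))) (Rpart w - s) (Rpart w + s) (Ipart w - s) (Ipart w + s))
   <= 4 * (e / (K + 1) * (s / 2)^-1) * ((Rpart w + s - (Rpart w - s)) + (Ipart w + s - (Ipart w - s))).
  apply: rint_bound => //.
    case: c2 c3 => ? ? ? ? [? ? ? ?]; split; exact: pcontD.
  move=> z ze; have -> : F n z / (z - v) + -1 * (f z / (z - v)) = (F n z - f z) * (z - v)^-1 by ring.
  rewrite cmM; apply: ler_pM; rewrite ?cm_ge0 //; first by apply: hn; apply: inr; case: ze.
  by apply: le_cmV; [rewrite divr_gt0|exact: farv].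
apply: (le_trans (lerD h2 (ler_wpM2l (cm_ge0 _) h1))).
have -> : 4 * (e / (K + 1) * (s / 2)^-1) * ((Rpart w + s - (Rpart w - s)) + (Ipart w + s - (Ipart w - s)))
   + cm (winding R) * (e / (K + 1)) = K * (e / (K + 1)) by rewrite /K; ring.
by rewrite mulrA ler_pdivrMr // mulrC ler_pM2l //; lra.
Qed.

End UniformLimits.

(** * Measurability in the plane *)

Section PlaneMeasure.
Variable R : realType.
Local Notation C := (Cplx R).
Local Notation RR := (measurableTypeR R * measurableTypeR R)%type.

Definition plane_open (D : set RR) := forall p, D p -> exists2 e : R, 0 < e &
  forall q, `|q.1 - p.1| < e -> `|q.2 - p.2| < e -> D q.

(** D is the union of those squares with rational centre and radius 1 / (n+1) that
    it contains. *)
Lemma measurable_plane_open (D : set RR) : plane_open D -> measurable D.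
Proof.
move=> oD.
pose rad (i : rat * rat * nat) : R := i.2.+1%:R^-1.
pose box (i : rat * rat * nat) : set RR :=
  `]ratr i.1.1 - rad i, ratr i.1.1 + rad i[ `*` `]ratr i.1.2 - rad i, ratr i.1.2 + rad i[.
pose F i := if pselect (box i `<=` D) then box i else set0.
have -> : D = \bigcup_i F i.
  apply/seteqP; split=> [p Dp|p [i _]]; last by rewrite /F; case: pselect => // h /h.
  have [e e0 he] := oD p Dp.
  pose n := Num.truncn (2 / e).
  have r0 : 0 < n.+1%:R^-1 :> R by rewrite invr_gt0.
  have rn : n.+1%:R^-1 <= e / 2.
    rewrite -[leRHS]invrK lef_pV2 ?posrE ?invr_gt0 ?divr_gt0 // invf_div.
    by rewrite ltW // -truncn_lt_nat // divr_ge0 // ltW.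
  have [q1 hq1] : exists q : rat, p.1 - n.+1%:R^-1 < ratr q < p.1 + n.+1%:R^-1.
    have [|q] := @rat_in_itvoo R (p.1 - n.+1%:R^-1) (p.1 + n.+1%:R^-1); first by rewrite ltrBlDr -addrA ltrDl addr_gt0.
    by rewrite in_itv; exists q.
  have [q2 hq2] : exists q : rat, p.2 - n.+1%:R^-1 < ratr q < p.2 + n.+1%:R^-1.
    have [|q] := @rat_in_itvoo R (p.2 - n.+1%:R^-1) (p.2 + n.+1%:R^-1); first by rewrite ltrBlDr -addrA ltrDl addr_gt0.
    by rewrite in_itv; exists q.
  exists (q1, q2, n) => //; rewrite /F; case: pselect => [h|[]].
    by split; rewrite /= in_itv /= /rad /=; move: hq1 hq2; move: (n.+1%:R^-1) => r; lra.
  move=> q [/=]; rewrite !in_itv /= /rad /= => h1 h2.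
  by apply: he; rewrite ltr_norml; move: rn hq1 hq2 h1 h2; move: (n.+1%:R^-1) => r; lra.
apply: countable_bigcupT_measurable; first exact: countableP.
move=> i; rewrite /F; case: pselect => h; last exact: measurable0.
by apply: measurableX; exact: measurable_itv.
Qed.

Definition plane_cont (D : set RR) (g : RR -> R) := forall p, D p ->
  forall e : R, 0 < e -> exists2 d : R, 0 < d &
  forall q, `|q.1 - p.1| < d -> `|q.2 - p.2| < d -> `|g q - g p| <= e.

Lemma measurable_plane_cont (D : set RR) (g : RR -> R) : plane_open D -> plane_cont D g ->
  measurable_fun D g.
Proof.
move=> oD cg; apply: (measurability _ (RGenOInfty.measurableE R)).
move=> A [B [a BE] <-]; rewrite BE; apply: measurable_plane_open => p [Dp /=].
rewrite in_itv /= andbT => ga.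
have [e1 e10 h1] := oD p Dp.
have e2 : 0 < (g p - a) / 2 by rewrite divr_gt0 // subr_gt0.
have [d d0 hd] := cg p Dp _ e2.
exists (Num.min e1 d); first by rewrite lt_min e10.
move=> q; rewrite !lt_min => /andP[q1 q1'] /andP[q2 q2']; split; first exact: h1.
rewrite /= in_itv /= andbT.
have := hd q q1' q2'; rewrite ler_norml; lra.
Qed.

Lemma plane_dist (p q : RR) (d : R) : `|q.1 - p.1| < d / 2 -> `|q.2 - p.2| < d / 2 ->
  cm (toC q - toC p : C) < d.
Proof.
move=> h1 h2; apply: (le_lt_trans (cm_le _)).
by rewrite (raddfB (@Rpart R)) (raddfB (@Ipart R)) /=; lra.
Qed.

Lemma plane_open_preim (Om : set C) : open Om -> plane_open (@toC R @^-1` Om).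
Proof.
move=> oOm p Op; have [e e0 he] := open_complexP oOm Op.
exists (e / 2); first by rewrite divr_gt0.
by move=> q q1 q2; apply: he; exact: plane_dist.
Qed.

Lemma plane_cont_comp (Om : set C) (f : C -> C) (psi : C -> R) :
  (forall z w, `|psi z - psi w| <= cm (z - w)) ->
  (forall z, Om z -> cont_at f z) ->
  plane_cont (@toC R @^-1` Om) (fun p => psi (f (toC p))).
Proof.
move=> hpsi cf p Op e e0; have [d d0 hd] := cf _ Op e e0.
exists (d / 2); first by rewrite divr_gt0.
move=> q q1 q2; apply: (le_trans (hpsi _ _)); apply: hd; exact: plane_dist.
Qed.

Lemma measurable_comp_plane (Om : set C) (f : C -> C) (psi : C -> R) : open Om ->
  (forall z w, `|psi z - psi w| <= cm (z - w)) ->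
  (forall z, Om z -> cont_at f z) ->
  measurable_fun (@toC R @^-1` Om : set RR) (fun p => psi (f (toC p))).
Proof.
move=> oOm hpsi cf; apply: measurable_plane_cont; first exact: plane_open_preim.
exact: (plane_cont_comp hpsi cf).
Qed.

Lemma Rpart_dist (z w : C) : `|Rpart z - Rpart w| <= cm (z - w).
Proof. by rewrite -raddfB; exact: Rpart_le. Qed.
Lemma Ipart_dist (z w : C) : `|Ipart z - Ipart w| <= cm (z - w).
Proof. by rewrite -raddfB; exact: Ipart_le. Qed.

(** Tonelli's theorem on the rectangle [a, b] x [c, d] contained in D. *)
Lemma strip_integral_hor (D : set RR) (F : RR -> R) (a b c d g : R) :
  measurable D -> measurable_fun D F -> (forall p, D p -> 0 <= F p) ->
  (forall x y, a <= x <= b -> c <= y <= d -> D (x, y)) ->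
  c <= d -> 0 <= g ->
  (forall y, c <= y <= d -> cont_on (fun x => F (x, y)) a b) ->
  (forall y, c <= y <= d -> g <= segint (fun x => F (x, y)) a b) ->
  ((g * (d - c))%:E <= \int[@leb2 R]_(p in D) (F p)%:E)%E.
Proof.
move=> mD mF F0 sub cd g0 cF hg.
pose Q : set RR := `[a, b] `*` `[c, d].
have QD : Q `<=` D by move=> [x y] [/=]; rewrite !in_itv /=; exact: sub.
have mQ : measurable Q by apply: measurableX; exact: measurable_itv.
have mEF : measurable_fun D (fun p => (F p)%:E) by exact/measurable_EFinP.
have F0' p : D p -> (0 <= (F p)%:E)%E by move=> /F0; rewrite /= lee_fin.
apply: (@le_trans _ _ (\int[@leb2 R]_(p in Q) (F p)%:E)%E); last first.
  exact: ge0_subset_integral.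
rewrite integral_mkcond.
have m1 : measurable_fun setT ((fun p => (F p)%:E) \_ Q).
  by apply/(measurable_restrictT _ mQ); exact: measurable_funS mEF.
have p1 p : (0 <= ((fun p => (F p)%:E) \_ Q) p)%E.
  by rewrite patchE; case: ifPn => // /set_mem /QD; exact: F0'.
rewrite /leb2 fubini_tonelli2 //.
have -> : (g * (d - c))%:E = (\int[@lebesgue_measure R]_(y in `[c, d]) (cst g%:E) y)%E.
  rewrite integral_cst //= lebesgue_measure_itv /= lte_fin.
  by move: cd; rewrite le_eqVlt => /orP[/eqP ->|->] //; rewrite ltxx subrr mulr0 mule0.
rewrite integral_mkcond; apply: ge0_le_integral => //.
- by move=> y _; rewrite patchE; case: ifPn => //=; rewrite lee_fin.
- apply: (measurable_restrictT _ _).1 => //; exact: measurable_cst.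
- exact: measurable_fun_fubini_tonelli_G.
move=> y _; rewrite patchE; case: ifPn => [/set_mem|_]; last first.
  by apply: integral_ge0 => x _; exact: p1.
rewrite /= in_itv /= => ycd.
have int := segint_integrable (cF y ycd).
have -> : fubini_G (@lebesgue_measure R) ((fun p => (F p)%:E) \_ Q) y =
    (\int[@lebesgue_measure R]_(x in `[a, b]) (F (x, y))%:E)%E.
  rewrite /fubini_G [RHS]integral_mkcond; apply: eq_integral => x _.
  rewrite !patchE /Q; congr (if _ then _ else _).
  apply/idP/idP => [/set_mem[/= h _]|/set_mem h]; first exact/mem_set.
  by apply/mem_set; split => //=; rewrite in_itv.
rewrite -[leRHS]fineK; last exact: integrable_fin_num.
by rewrite lee_fin; exact: hg.
Qed.

Lemma strip_integral_ver (D : set RR) (F : RR -> R) (a b c d g : R) :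
  measurable D -> measurable_fun D F -> (forall p, D p -> 0 <= F p) ->
  (forall x y, a <= x <= b -> c <= y <= d -> D (x, y)) ->
  a <= b -> 0 <= g ->
  (forall x, a <= x <= b -> cont_on (fun y => F (x, y)) c d) ->
  (forall x, a <= x <= b -> g <= segint (fun y => F (x, y)) c d) ->
  ((g * (b - a))%:E <= \int[@leb2 R]_(p in D) (F p)%:E)%E.
Proof.
move=> mD mF F0 sub ab g0 cF hg.
pose Q : set RR := `[a, b] `*` `[c, d].
have QD : Q `<=` D by move=> [x y] [/=]; rewrite !in_itv /=; exact: sub.
have mQ : measurable Q by apply: measurableX; exact: measurable_itv.
have mEF : measurable_fun D (fun p => (F p)%:E) by exact/measurable_EFinP.
have F0' p : D p -> (0 <= (F p)%:E)%E by move=> /F0; rewrite /= lee_fin.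
apply: (@le_trans _ _ (\int[@leb2 R]_(p in Q) (F p)%:E)%E); last first.
  exact: ge0_subset_integral.
rewrite integral_mkcond.
have m1 : measurable_fun setT ((fun p => (F p)%:E) \_ Q).
  by apply/(measurable_restrictT _ mQ); exact: measurable_funS mEF.
have p1 p : (0 <= ((fun p => (F p)%:E) \_ Q) p)%E.
  by rewrite patchE; case: ifPn => // /set_mem /QD; exact: F0'.
rewrite /leb2 fubini_tonelli1 //.
have -> : (g * (b - a))%:E = (\int[@lebesgue_measure R]_(y in `[a, b]) (cst g%:E) y)%E.
  rewrite integral_cst //= lebesgue_measure_itv /= lte_fin.
  by move: ab; rewrite le_eqVlt => /orP[/eqP ->|->] //; rewrite ltxx subrr mulr0 mule0.
rewrite integral_mkcond; apply: ge0_le_integral => //.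
- by move=> y _; rewrite patchE; case: ifPn => //=; rewrite lee_fin.
- apply: (measurable_restrictT _ _).1 => //; exact: measurable_cst.
- exact: measurable_fun_fubini_tonelli_F.
move=> x _; rewrite patchE; case: ifPn => [/set_mem|_]; last first.
  by apply: integral_ge0 => y _; exact: p1.
rewrite /= in_itv /= => xab.
have int := segint_integrable (cF x xab).
have -> : fubini_F (@lebesgue_measure R) ((fun p => (F p)%:E) \_ Q) x =
    (\int[@lebesgue_measure R]_(y in `[c, d]) (F (x, y))%:E)%E.
  rewrite /fubini_F [RHS]integral_mkcond; apply: eq_integral => y _.
  rewrite !patchE /Q; congr (if _ then _ else _).
  apply/idP/idP => [/set_mem[/= _ h]|/set_mem h]; first exact/mem_set.
  by apply/mem_set; split => //=; rewrite in_itv.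
rewrite -[leRHS]fineK; last exact: integrable_fin_num.
by rewrite lee_fin; exact: hg.
Qed.

End PlaneMeasure.

(** * The pointwise estimate for square-integrable holomorphic functions *)

Section PointwiseBound.
Variable R : realType.
Local Notation C := (Cplx R).
Implicit Types (a b c d x y r : R) (f : C -> C) (z w v : C) (g : R -> R).

Lemma cont_on_sqr g a b : cont_on g a b -> cont_on (fun x => g x ^+ 2) a b.
Proof.
move=> h x /h gx; have := continuousM gx gx.
by congr {for _, continuous _}; apply/funext => t; rewrite expr2.
Qed.

Lemma cont_onD g1 g2 a b : cont_on g1 a b -> cont_on g2 a b ->
  cont_on (fun x => g1 x + g2 x) a b.
Proof. by move=> h1 h2 x xab; apply: cvgD; [exact: h1|exact: h2]. Qed.

Lemma segint_ge0_sub g a b a' b' : a' <= a -> a <= b -> b <= b' ->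
  cont_on g a' b' -> (forall x, 0 <= g x) -> segint g a b <= segint g a' b'.
Proof.
move=> aa ab bb cg g0.
have ge0 (s t : R) : 0 <= segint g s t by apply: Rintegral_ge0 => x _; exact: g0.
rewrite (@segint_cat _ g a' a b') //; last exact: le_trans bb.
rewrite (@segint_cat _ g a b b') //; last exact: cont_on_sub cg.
by rewrite addrCA lerDl addr_ge0.
Qed.

(** By |p| <= t / 2 + |p|^2 / (2 t), an L2 bound on one side of a rectangle
    controls the integral of p q over that side. *)
Lemma side_bound (p q : R -> C) a b a' b' t r : a' <= a -> a <= b -> b <= b' ->
  0 < t -> 0 < r -> pcont p a' b' -> pcont (fun x => p x * q x) a b ->
  (forall x, a <= x <= b -> cm (q x) <= r^-1) ->
  cm (csegint (fun x => p x * q x) a b) <=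
    r^-1 * (t * (b' - a') + t^-1 * segint (fun x => cm (p x) ^+ 2) a' b').
Proof.
move=> aa ab bb t0 r0 cp cpq qb; apply: (le_trans (csegint_norm cpq)).
have cp2 := cont_on_sqr (pcont_cm cp).
have cp2' := cont_on_sub aa bb cp2.
have cst_ab := @cont_on_cst R (t / 2) a b.
have rV : 0 <= r^-1 by rewrite invr_ge0 ltW.
have tV : 0 <= t^-1 by rewrite invr_ge0 ltW.
pose h x := r^-1 * (t / 2 + (t^-1 / 2) * cm (p x) ^+ 2).
have ch : cont_on h a b.
  by apply: cont_onZ; apply: cont_onD => //; exact: cont_onZ.
have le1 : segint (fun x => cm (p x * q x)) a b <= segint h a b.
  apply: segint_le => //; first exact: pcont_cm.
  move=> x xab; rewrite cmM /h mulrC; apply: ler_pM; rewrite ?cm_ge0 //; first exact: qb.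
  have : 0 <= t^-1 / 2 * (t - cm (p x)) ^+ 2 by rewrite mulr_ge0 ?sqr_ge0 ?divr_ge0.
  have -> : t^-1 / 2 * (t - cm (p x)) ^+ 2 =
     (t / 2 + t^-1 / 2 * cm (p x) ^+ 2) - cm (p x) by field; rewrite gt_eqF.
  by rewrite subr_ge0.
have le2 : segint h a b = r^-1 * (t / 2 * (b - a) + t^-1 / 2 * segint (fun x => cm (p x) ^+ 2) a b).
  rewrite /h segintZ; last first.
    by apply: cont_onD => //; exact: cont_onZ.
  by rewrite segintD ?segint_cst ?segintZ //; exact: cont_onZ.
have le3 := segint_ge0_sub aa ab bb cp2 (fun x => sqr_ge0 (cm (p x))).
apply: (le_trans (ler_wpM2l _ le1)) => //; rewrite le2 mulrCA ler_wpM2l //.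
rewrite mulrDr mulrA [2 * (t / 2)]mulrC divfK // mulrA [2 * (t^-1 / 2)]mulrC divfK //.
apply: lerD; last exact: ler_wpM2l.
by apply: ler_wpM2l; [exact: ltW|lra].
Qed.

Definition est_const r := 256%:R / (r ^+ 2 * cm (winding R) ^+ 2).

Lemma est_const_gt0 r : 0 < r -> 0 < est_const r.
Proof.
move=> r0; apply: divr_gt0; first by rewrite ltr0n.
by apply: mulr_gt0; apply: exprn_gt0 => //; rewrite cm_gt0 // winding_neq0.
Qed.

(** Suppose that the integral of |f|^2 is too small. Between the square of
    half-side 2 r about w and the one of half-side r lie a lower, an upper, a left
    and a right strip of width r; by Tonelli's theorem each contains a segment
    parallel to it on which the integral of |f|^2 is less than gg. These four
    segments bound a rectangle around w, and side_bound contradicts Cauchy's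
    formula there. *)
Theorem L2_pointwise (Om : set C) f w r : open Om -> 0 < r ->
  (forall z, in_square w (2 * r) z -> Om z) ->
  holomorphic_on Om f ->
  ((cm (f w) ^+ 2)%:E <= (est_const r)%:E *
     \int[@leb2 R]_(p in @toC R @^-1` Om) (cm (f (toC p)) ^+ 2)%:E)%E.
Proof.
move=> oOm r0 sq hf.
set a1 := Rpart w - 2 * r in sq *; set b1 := Rpart w + 2 * r in sq *.
set c1 := Ipart w - 2 * r in sq *; set d1 := Ipart w + 2 * r in sq *.
pose kap := cm (winding R) * cm (f w).
have W0 : 0 < cm (winding R) by rewrite cm_gt0 // winding_neq0.
set I := (\int[_]_(p in _) _)%E.
have I0 : (0 <= I)%E by apply: integral_ge0 => p _; rewrite lee_fin sqr_ge0.
have K0 := est_const_gt0 r0.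
have [f0|fN0] := eqVneq (cm (f w)) 0.
  by rewrite f0 expr0n /= mule_ge0 // lee_fin ltW.
have fpos : 0 < cm (f w) by rewrite lt_neqAle eq_sym fN0 cm_ge0.
have kap0 : 0 < kap by rewrite mulr_gt0.
pose gg := r * kap ^+ 2 / 256%:R.
have gg0 : 0 <= gg.
  by apply: divr_ge0; [apply: mulr_ge0; [exact: ltW|exact: sqr_ge0]|rewrite ler0n].
suff : ((gg * r)%:E <= I)%E.
  move=> h; apply: (@le_trans _ _ ((est_const r)%:E * (gg * r)%:E)%E).
    rewrite -EFinM lee_fin le_eqVlt; apply/orP; left; apply/eqP.
    by rewrite /est_const /gg /kap; field; rewrite !gt_eqF.
  by apply: lee_wpmul2l => //; rewrite lee_fin ltW.
have cf z : Om z -> cont_at f z by move=> /hf; exact: derivable_cont.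
pose F (p : measurableTypeR R * measurableTypeR R) := cm (f (toC p)) ^+ 2.
have mOm : measurable (@toC R @^-1` Om : set (measurableTypeR R * measurableTypeR R)).
  by apply: measurable_plane_open; exact: plane_open_preim.
have mF : measurable_fun (@toC R @^-1` Om : set (measurableTypeR R * measurableTypeR R)) F.
  apply: measurable_funX; apply: measurable_comp_plane => //.
  exact: cm_dist.
have F0 p : 0 <= F p by exact: sqr_ge0.
have sub x y : a1 <= x <= b1 -> c1 <= y <= d1 -> Om (toC (x, y)).
  by move=> h1 h2; apply: sq; split.
have chor y : c1 <= y <= d1 -> pcont (fun x => f (toC (x, y))) a1 b1.
  by move=> yy; apply: pcont_hor => x xx; apply: cf; exact: sub.
have cver x : a1 <= x <= b1 -> pcont (fun y => f (toC (x, y))) c1 d1.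
  by move=> yy; apply: pcont_ver => y xx; apply: cf; exact: sub.
pose G1 y := segint (fun x => F (x, y)) a1 b1.
pose G2 x := segint (fun y => F (x, y)) c1 d1.
have hor c d : c1 <= c -> d <= d1 -> d - c = r -> (forall y, c <= y <= d -> gg <= G1 y) ->
    ((gg * r)%:E <= I)%E.
  move=> cc dd dc h; rewrite -dc.
  apply: (@strip_integral_hor _ _ F a1 b1 c d gg) => //.
  - by move=> x y hx /andP[cy yd]; apply: sub => //; rewrite (le_trans cc) // (le_trans yd).
  - by rewrite -subr_ge0 dc ltW.
  - move=> y /andP[cy yd]; apply: cont_on_sqr; apply: pcont_cm; apply: chor.
    by rewrite (le_trans cc) // (le_trans yd).
have ver a b : a1 <= a -> b <= b1 -> b - a = r -> (forall x, a <= x <= b -> gg <= G2 x) ->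
    ((gg * r)%:E <= I)%E.
  move=> cc dd dc h; rewrite -dc.
  apply: (@strip_integral_ver _ _ F a b c1 d1 gg) => //.
  - by move=> x y /andP[cy yd] hx; apply: sub => //; rewrite (le_trans cc) // (le_trans yd).
  - by rewrite -subr_ge0 dc ltW.
  - move=> y /andP[cy yd]; apply: cont_on_sqr; apply: pcont_cm; apply: cver.
    by rewrite (le_trans cc) // (le_trans yd).
apply: contrapT => notI.
have pickh c d : c1 <= c -> d <= d1 -> d - c = r -> exists2 y, c <= y <= d & G1 y < gg.
  move=> cc dd dc; apply: contrapT => no; apply: notI; apply: (hor c d) => // y ycd.
  by rewrite leNgt; apply/negP => h; apply: no; exists y.
have pickv a b : a1 <= a -> b <= b1 -> b - a = r -> exists2 x, a <= x <= b & G2 x < gg.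
  move=> cc dd dc; apply: contrapT => no; apply: notI; apply: (ver a b) => // y ycd.
  by rewrite leNgt; apply/negP => h; apply: no; exists y.
have [|||c /andP[cl cu] Gc] := pickh c1 (Ipart w - r); rewrite /c1 /d1; try lra; try ring.
have [|||d /andP[dl du] Gd] := pickh (Ipart w + r) d1; rewrite /c1 /d1; try lra; try ring.
have [|||a /andP[al au] Ga] := pickv a1 (Rpart w - r); rewrite /a1 /b1; try lra; try ring.
have [|||b /andP[bl bu] Gb] := pickv (Rpart w + r) b1; rewrite /a1 /b1; try lra; try ring.
rewrite -/a1 -/b1 -/c1 -/d1 in cl cu dl du al au bl bu *.
have wx : a < Rpart w < b by rewrite /a1 /b1 in al bu *; lra.
have wy : c < Ipart w < d by lra.
have ab : a <= b by lra. have cd : c <= d by lra.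
have sub' z : inside a b c d z -> Om z.
  move=> [h1 h2]; apply: sq; split; lra.
have cauchy : rint (fun z => f z / (z - w)) a b c d = winding R * f w.
  by apply: cauchy_formula => // z /sub'/hf.
have far z : on_edge a b c d z -> r <= cm (z - w).
  move=> [_ h]; have := Rpart_le (z - w); have := Ipart_le (z - w).
  rewrite (raddfB (@Rpart R)) (raddfB (@Ipart R)) /= !ler_norml.
  by case: h => ->; lra.
have nw z : on_edge a b c d z -> z != w.
  by move=> /far h; apply/eqP => zw; move: h; rewrite zw subrr cm0; lra.
have invb z : on_edge a b c d z -> cm (z - w)^-1 <= r^-1 by move=> /far; exact: le_cmV.
have [e1 e2 e3 e4] : cont_edges (fun z => f z / (z - w)) a b c d.
  apply: cont_edgesP => // z ze; apply: cont_atM; last by apply: cont_inv; exact: nw.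
  by apply: cf; apply: sub'; case: ze.
(* With 4 r the length of the side of the outer square, this weight makes the
   constant terms of the four side bounds add up to kap / 2. *)
pose t := kap / 32%:R; have t0 : 0 < t by rewrite divr_gt0.
have s1 : cm (csegint (fun x => f (toC (x, c)) * (toC (x, c) - w)^-1) a b) <=
    r^-1 * (t * (b1 - a1) + t^-1 * G1 c).
  apply: (side_bound al ab bu t0 r0) => //; first by apply: chor; lra.
  by move=> x xab; apply: invb; split; [rewrite /inside /= lexx|apply: Or43].
have s2 : cm (csegint (fun x => f (toC (x, d)) * (toC (x, d) - w)^-1) a b) <=
    r^-1 * (t * (b1 - a1) + t^-1 * G1 d).
  apply: (side_bound al ab bu t0 r0) => //; first by apply: chor; lra.
  by move=> x xab; apply: invb; split; [rewrite /inside /= lexx andbT|apply: Or44].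
have s3 : cm (csegint (fun y => f (toC (b, y)) * (toC (b, y) - w)^-1) c d) <=
    r^-1 * (t * (d1 - c1) + t^-1 * G2 b).
  apply: (side_bound cl cd du t0 r0) => //; first by apply: cver; lra.
  by move=> x xab; apply: invb; split; [rewrite /inside /= lexx andbT|apply: Or42].
have s4 : cm (csegint (fun y => f (toC (a, y)) * (toC (a, y) - w)^-1) c d) <=
    r^-1 * (t * (d1 - c1) + t^-1 * G2 a).
  apply: (side_bound cl cd du t0 r0) => //; first by apply: cver; lra.
  by move=> x xab; apply: invb; split; [rewrite /inside /= lexx|apply: Or41].
have : kap <= r^-1 * (t * (b1 - a1) + t^-1 * G1 c) + r^-1 * (t * (b1 - a1) + t^-1 * G1 d) +
   (r^-1 * (t * (d1 - c1) + t^-1 * G2 b) + r^-1 * (t * (d1 - c1) + t^-1 * G2 a)).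
  rewrite /kap -cmM -cauchy /rint; apply: (le_trans (cmD _ _)).
  rewrite cmM cm_Ci mul1r; apply: lerD; apply: (le_trans (cmB _ _)); exact: lerD.
have -> : b1 - a1 = 4 * r by rewrite /a1 /b1; ring.
have -> : d1 - c1 = 4 * r by rewrite /c1 /d1; ring.
have -> : r^-1 * (t * (4 * r) + t^-1 * G1 c) + r^-1 * (t * (4 * r) + t^-1 * G1 d) +
   (r^-1 * (t * (4 * r) + t^-1 * G2 b) + r^-1 * (t * (4 * r) + t^-1 * G2 a)) =
   16%:R * t + (r^-1 * t^-1) * (G1 c + G1 d + G2 b + G2 a).
  by field; rewrite !gt_eqF.
have rt : 0 < r^-1 * t^-1 by rewrite mulr_gt0 // invr_gt0.
have : (r^-1 * t^-1) * (G1 c + G1 d + G2 b + G2 a) < (r^-1 * t^-1) * (4 * gg).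
  by rewrite ltr_pM2l //; move: Gc Gd Ga Gb; clear; lra.
have -> : r^-1 * t^-1 * (4 * gg) = kap / 2.
  by rewrite /gg /t; field; rewrite !gt_eqF.
by move: kap0; rewrite /t; clear; lra.
Qed.

End PointwiseBound.

(** * The Bergman space *)

Section Bergman.
Variable R : realType.
Local Notation C := (Cplx R).
Local Notation RR := (measurableTypeR R * measurableTypeR R)%type.
Variable Om : set C.
Hypothesis oOm : open Om.
Let D : set RR := @toC R @^-1` Om.
Variable N : nat.
Implicit Types (F : C -> 'cV[C]_N) (f : C -> C).

Lemma measurable_domain : measurable D.
Proof. by apply: measurable_plane_open; exact: plane_open_preim. Qed.
Let mD := measurable_domain.

Definition density F (p : RR) : R := \sum_i cm (F (toC p) i 0) ^+ 2.

Lemma density_ge0 F p : 0 <= density F p.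
Proof. by apply: sumr_ge0 => i _; exact: sqr_ge0. Qed.

Lemma cont_at_sum (I : Type) (s : seq I) (f : I -> C -> C) z :
  (forall i, cont_at (f i) z) -> cont_at (fun w => \sum_(i <- s) f i w) z.
Proof.
move=> h; elim: s => [|i s IH].
  rewrite (_ : (fun w => _) = fun=> 0); first exact: cont_at_cst.
  by apply/funext => w; rewrite big_nil.
rewrite (_ : (fun w => _) = fun w => f i w + \sum_(i <- s) f i w); first exact: cont_atD.
by apply/funext => w; rewrite big_cons.
Qed.

Lemma cont_at_conj f z : cont_at f z -> cont_at (fun w => (f w)^*) z.
Proof.
move=> h e e0; have [d d0 hd] := h e e0; exists d => // w /hd.
by rewrite -rmorphB /= cm_conj.
Qed.

Lemma bergman_out F z : bergman Om F -> ~ Om z -> F z = 0.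
Proof.
move=> [hF _ _] /hF Fz; apply/matrixP => i j; rewrite mxE.
by have := congr1 (fun g : 'I_N -> 'I_1 -> C => g i j) Fz.
Qed.

Lemma bergman_cont F i z : bergman Om F -> Om z -> cont_at (fun w => F w i 0) z.
Proof. by move=> [_ hF _] Oz; apply: derivable_cont; exact: hF. Qed.

Lemma measurable_density F : (forall i z, Om z -> cont_at (fun w => F w i 0) z) ->
  measurable_fun D (density F).
Proof.
move=> cF; apply: measurable_sum => i; apply: measurable_funX.
apply: (measurable_comp_plane oOm (@cm_dist R) (f := fun w => F w i 0)); exact: cF.
Qed.

Lemma integrable_density F : bergman Om F -> (@leb2 R).-integrable D (EFin \o density F).
Proof.
move=> hF; apply/integrableP; split.
  apply/measurable_EFinP; apply: measurable_density => i z; exact: bergman_cont.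
have [_ _ fin] := hF; apply: le_lt_trans fin.
rewrite le_eqVlt; apply/orP; left; apply/eqP; apply: eq_integral => p _ /=.
by rewrite ger0_norm // density_ge0.
Qed.

Definition cintegrable f := (@leb2 R).-integrable D (EFin \o (fun p => Rpart (f (toC p)))) /\
  (@leb2 R).-integrable D (EFin \o (fun p => Ipart (f (toC p)))).

Lemma cintegralD f g : cintegrable f -> cintegrable g ->
  cintegral Om (fun z => f z + g z) = cintegral Om f + cintegral Om g.
Proof.
move=> [f1 f2] [g1 g2]; apply: Cext; rewrite raddfD /=.
  rewrite -RintegralD //; by apply: eq_Rintegral => p _; rewrite raddfD.
by rewrite -RintegralD //; apply: eq_Rintegral => p _; rewrite raddfD.
Qed.

Lemma integrable_comb (a b : R) (g h : RR -> R) :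
  (@leb2 R).-integrable D (EFin \o g) -> (@leb2 R).-integrable D (EFin \o h) ->
  (@leb2 R).-integrable D (EFin \o (fun p => a * g p + b * h p)).
Proof.
move=> ig ih.
have := integrableD mD (integrableZl mD a ig) (integrableZl mD b ih).
by congr ((@leb2 R).-integrable D _).
Qed.

Lemma Rintegral_comb (a b : R) (g h : RR -> R) :
  (@leb2 R).-integrable D (EFin \o g) -> (@leb2 R).-integrable D (EFin \o h) ->
  \int[@leb2 R]_(p in D) (a * g p + b * h p) =
  a * \int[@leb2 R]_(p in D) g p + b * \int[@leb2 R]_(p in D) h p.
Proof.
move=> ig ih; rewrite RintegralD ?RintegralZl //.
  exact: (integrableZl mD a ig).
exact: (integrableZl mD b ih).
Qed.

Lemma cintegralZ a f : cintegrable f ->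
  cintegral Om (fun z => a * f z) = a * cintegral Om f.
Proof.
move=> [f1 f2]; apply: Cext; rewrite ?RpartM ?IpartM /=.
  rewrite -mulNr -Rintegral_comb //; apply: eq_Rintegral => p _.
  by rewrite RpartM mulNr.
rewrite -Rintegral_comb //; apply: eq_Rintegral => p _.
by rewrite IpartM.
Qed.

Definition pairing F1 F2 z : C := \sum_i F1 z i 0 * (F2 z i 0)^*.

Lemma pairing_bound F1 F2 p :
  cm (pairing F1 F2 (toC p)) <= 2^-1 * density F1 p + 2^-1 * density F2 p.
Proof.
apply: (le_trans (cm_sum _ _ _)); rewrite /density !mulr_sumr -big_split /=.
apply: ler_sum => i _; rewrite cmM cm_conj.
have := sqr_ge0 (cm (F1 (toC p) i 0) - cm (F2 (toC p) i 0)); rewrite sqrrB; lra.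
Qed.

Lemma cintegrable_pairing F1 F2 : bergman Om F1 -> bergman Om F2 ->
  cintegrable (pairing F1 F2).
Proof.
move=> h1 h2.
have cp z : Om z -> cont_at (pairing F1 F2) z.
  move=> Oz; apply: cont_at_sum => i; apply: cont_atM; first exact: bergman_cont.
  by apply: cont_at_conj; exact: bergman_cont.
have dom := integrable_comb 2^-1 2^-1 (integrable_density h1) (integrable_density h2).
have main (psi : C -> R) : (forall z w, `|psi z - psi w| <= cm (z - w)) ->
    (forall z, `|psi z| <= cm z) ->
    (@leb2 R).-integrable D (EFin \o (fun p => psi (pairing F1 F2 (toC p)))).
  move=> lip bd; apply: (le_integrable mD _ _ dom).
    by apply/measurable_EFinP; exact: (measurable_comp_plane oOm lip cp).
  move=> p _; rewrite /= lee_fin; apply: (le_trans (bd _)).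
  apply: (le_trans (pairing_bound _ _ _)); exact: ler_norm.
split; [apply: (main (@Rpart R))|apply: (main (@Ipart R))].
- exact: Rpart_dist.
- exact: Rpart_le.
- exact: Ipart_dist.
- exact: Ipart_le.
Qed.

Lemma nsq_bergman F : nsq (@bergman_ip R Om N) F = \int[@leb2 R]_(p in D) density F p.
Proof.
rewrite /nsq /=; apply: eq_Rintegral => p _; rewrite raddf_sum; apply: eq_bigr => i _.
by rewrite mulJ.
Qed.

Lemma nsq_bergmanE F : bergman Om F ->
  (nsq (@bergman_ip R Om N) F)%:E = (\int[@leb2 R]_(p in D) (density F p)%:E)%E.
Proof.
move=> hF; rewrite nsq_bergman fineK //.
exact: integrable_fin_num (integrable_density hF).
Qed.

(** Domination by an integrable function replaces the finiteness of the integral. *)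
Lemma bergman_of F : (forall z, ~ Om z -> F z = 0) ->
  (forall i, holomorphic_on Om (fun z => F z i 0)) ->
  (exists2 g : RR -> R, (@leb2 R).-integrable D (EFin \o g) & forall p, D p -> density F p <= g p) ->
  bergman Om F.
Proof.
move=> F0 hF [g ig le]; split; [|exact: hF|].
  by move=> z /F0 ->; apply/funext => i; apply/funext => j; rewrite mxE.
have /integrableP[_ fin] := ig; apply: le_lt_trans fin.
apply: ge0_le_integral => //.
- by move=> p _; rewrite lee_fin density_ge0.
- apply/measurable_EFinP; apply: measurable_density => i z Oz.
  by apply: derivable_cont; exact: hF.
- by apply: measurableT_comp => //; exact: measurable_int ig.
- by move=> p Dp; rewrite lee_fin; apply: (le_trans (le p Dp)); exact: ler_norm.
Qed.

Lemma derivable_lin (a : C) f g z :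
  derivable f z 1 -> derivable g z 1 ->
  derivable (fun w => a * f w + g w) z 1.
Proof.
by move=> df dg; exact: (derivableD (derivableM (derivable_cst a z 1) df) dg).
Qed.

Lemma bergman_lin (a : C) F1 F2 : bergman Om F1 -> bergman Om F2 ->
  bergman Om (a *: F1 + F2).
Proof.
move=> h1 h2; apply: bergman_of.
- move=> z Oz; have -> : (a *: F1 + F2) z = a *: F1 z + F2 z by [].
  by rewrite (bergman_out h1) // (bergman_out h2) // scaler0 addr0.
- have [_ d1 _] := h1; have [_ d2 _] := h2; move=> i z Oz.
  have -> : (fun w => (a *: F1 + F2) w i 0) = (fun w => a * F1 w i 0 + F2 w i 0).
    by apply/funext => w; rewrite !mxE.
  exact: derivable_lin (d1 i z Oz) (d2 i z Oz).
- exists (fun p => (2 * cm a ^+ 2) * density F1 p + 2 * density F2 p).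
    by apply: integrable_comb; exact: integrable_density.
  move=> p _; rewrite /density !mulr_sumr -big_split /=; apply: ler_sum => i _.
  rewrite !mxE; apply: (@le_trans _ _ ((cm a * cm (F1 (toC p) i 0) + cm (F2 (toC p) i 0)) ^+ 2)).
    by rewrite ler_sqr ?nnegrE ?cm_ge0 ?addr_ge0 ?mulr_ge0 ?cm_ge0 // -cmM cmD.
  have := sqr_ge0 (cm a * cm (F1 (toC p) i 0) - cm (F2 (toC p) i 0)).
  rewrite sqrrB sqrrD exprMn; lra.
Qed.

Lemma bergman_hermitian : hermitian_on (@bergman R Om N) (@bergman_ip R Om N).
Proof.
split.
- split=> //.
  + by move=> z _; apply/funext => i; apply/funext => j; rewrite mxE.
  + by move=> i z _; rewrite (_ : (fun z => _) = cst 0) //; apply/funext => w; rewrite mxE.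
  + rewrite (eq_integral (cst 0%E)) ?integral0 //.
    by move=> p _; rewrite big1 // => i _; rewrite mxE normr0 expr0n.
- exact: bergman_lin.
- move=> a u v w hu hv hw.
  have := cintegrable_pairing hu hw; have := cintegrable_pairing hv hw => iv iu.
  rewrite /bergman_ip -/(pairing u w) -/(pairing v w).
  have -> : (fun z => \sum_i (a *: u + v) z i 0 * (w z i 0)^*) =
     (fun z => a * pairing u w z + pairing v w z).
    apply/funext => z; rewrite /pairing mulr_sumr -big_split /=.
    by apply: eq_bigr => i _; rewrite !mxE mulrDl mulrA.
  rewrite cintegralD ?cintegralZ //; have [i1 i2] := iu.
  split.
    have := integrable_comb (Rpart a) (- Ipart a) i1 i2.
    by congr ((@leb2 R).-integrable D _); apply/funext => p /=; rewrite RpartM mulNr.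
  have := integrable_comb (Rpart a) (Ipart a) i2 i1.
  by congr ((@leb2 R).-integrable D _); apply/funext => p /=; rewrite IpartM.
- move=> u v hu hv; apply: Cext; rewrite ?Rpart_conj ?Ipart_conj /=.
    apply: eq_Rintegral => p _; rewrite -Rpart_conj rmorph_sum; congr Rpart.
    by apply: eq_bigr => i _; rewrite rmorphM /= conjCK mulrC.
  have [_ i2] := cintegrable_pairing hu hv.
  rewrite -mulN1r -RintegralZl //; apply: eq_Rintegral => p _; rewrite mulN1r.
  rewrite -Ipart_conj rmorph_sum; congr Ipart.
  by apply: eq_bigr => i _; rewrite rmorphM /= conjCK mulrC.
- move=> u hu; have -> : bergman_ip Om u u = ofR (nsq (@bergman_ip R Om N) u).
    apply: Cext => //=; rewrite (@eq_Rintegral _ _ _ _ _ (fun=> 0)).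
      by rewrite /Rintegral integral0.
    move=> p _; rewrite raddf_sum big1 // => i _.
    by rewrite mulJ.
  rewrite ofR_ge0 nsq_bergman; apply: Rintegral_ge0 => p _; exact: density_ge0.
Qed.

Lemma bergman_pointwise F i w (r : R) : bergman Om F -> 0 < r ->
  (forall z, in_square w (2 * r) z -> Om z) ->
  cm (F w i 0) ^+ 2 <= est_const r * nsq (@bergman_ip R Om N) F.
Proof.
move=> hF r0 sq; have [_ dF _] := hF.
have := L2_pointwise oOm r0 sq (dF i); rewrite -lee_fin => /le_trans; apply.
rewrite [leRHS]EFinM nsq_bergmanE //; apply: lee_wpmul2l.
  by rewrite lee_fin ltW // est_const_gt0.
apply: ge0_le_integral => //.
- by move=> p _; rewrite lee_fin sqr_ge0.
- apply/measurable_EFinP; apply: measurable_funX.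
  apply: (measurable_comp_plane oOm (@cm_dist R) (f := fun w => F w i 0)) => z Oz.
  exact: bergman_cont.
- exact: measurable_int (integrable_density hF).
- move=> p _; rewrite lee_fin /density (bigD1 i) //= lerDl.
  by apply: sumr_ge0 => k _; exact: sqr_ge0.
Qed.

Lemma square_in_open w : Om w -> exists2 r, 0 < r &
  forall v, cm (v - w) < r -> forall z,
  in_square v (2 * r) z -> Om z.
Proof.
move=> Ow; have [e e0 he] := open_complexP oOm Ow.
exists (e / 6%:R); first by rewrite divr_gt0.
move=> v vw z /ball_square h; apply: he.
have := cmD (z - v) (v - w); rewrite subrKA; lra.
Qed.

Lemma bergman_eq0 F : bergman Om F -> bergman_ip Om F F = 0 -> F = 0.
Proof.
move=> hF h0; apply/funext => w; have [Ow|nOw] := pselect (Om w); last exact: bergman_out hF nOw.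
apply/colP => i; rewrite mxE; have [r r0 hr] := square_in_open Ow.
apply: cm_eq0; apply/eqP; rewrite -sqrf_eq0 eq_le sqr_ge0 andbT.
have := bergman_pointwise i hF r0 (hr w _); rewrite subrr cm0 => /(_ r0).
by rewrite /nsq h0 raddf0 mulr0.
Qed.

End Bergman.

(** * Completeness of the Bergman space *)

Lemma real_cauchy (R : realType) (u : nat -> R) :
  (forall e : R, 0 < e -> exists n0, forall p q, (n0 <= p)%N -> (n0 <= q)%N -> `|u p - u q| <= e) ->
  exists l, forall e : R, 0 < e -> exists n0, forall p, (n0 <= p)%N -> `|u p - l| <= e.
Proof.
move=> cu; have cF : cauchy (u @ \oo).
  apply: cauchy_exP => e e0; have e2 : 0 < e / 2 by rewrite divr_gt0.
  have [n0 hn] := cu _ e2; exists (u n0); exists n0 => // p /= np.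
  by rewrite -ball_normE /=; apply: (le_lt_trans (hn _ _ (leqnn _) np)); lra.
have /cvg_ex[l hl] : cvg (u @ \oo) by apply: cauchy_cvg.
exists l => e e0.
have := (cvgrPdist_le _ _).1 hl e e0; move=> [n0 _ hn]; exists n0 => p np.
by have := hn p np; rewrite distrC.
Qed.

Lemma cvg_seqsum (R : realType) (I : Type) (s : seq I) (f : I -> nat -> R) (l : I -> R) :
  (forall i, f i @ \oo --> l i) ->
  (fun n => \sum_(i <- s) f i n) @ \oo --> \sum_(i <- s) l i.
Proof.
move=> h; elim: s => [|i s IH].
  rewrite big_nil (_ : (fun n => _) = fun=> 0); first exact: cvg_cst.
  by apply/funext => n; rewrite big_nil.
rewrite big_cons (_ : (fun n => _) = fun n => f i n + \sum_(i <- s) f i n).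
  by apply: cvgD.
by apply/funext => n; rewrite big_cons.
Qed.

Lemma cvg_sqr (R : realType) (f : nat -> R) (l : R) :
  f @ \oo --> l -> (fun n => f n ^+ 2) @ \oo --> l ^+ 2.
Proof.
move=> h; rewrite expr2 (_ : (fun n => _) = fun n => f n * f n).
  exact: cvgM.
by apply/funext => n; rewrite expr2.
Qed.

Section Completeness.
Variable R : realType.
Local Notation C := (Cplx R).
Local Notation RR := (measurableTypeR R * measurableTypeR R)%type.
Variable Om : set C.
Hypothesis oOm : open Om.
Let D : set RR := @toC R @^-1` Om.
Variable N : nat.
Implicit Types (F : C -> 'cV[C]_N) (f : C -> C).
Local Notation H := (@bergman R Om N).
Local Notation ip := (@bergman_ip R Om N).
Let hh := bergman_hermitian oOm N.

Lemma complex_cauchy (u : nat -> C) :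
  (forall e : R, 0 < e -> exists n0, forall p q, (n0 <= p)%N -> (n0 <= q)%N -> cm (u p - u q) <= e) ->
  exists l, complex_limit u l.
Proof.
move=> cu.
have [|a ha] := @real_cauchy R (fun n => Rpart (u n)).
  move=> e /cu[n0 hn]; exists n0 => p q np nq; rewrite -raddfB.
  exact: le_trans (Rpart_le _) (hn p q np nq).
have [|b hb] := @real_cauchy R (fun n => Ipart (u n)).
  move=> e /cu[n0 hn]; exists n0 => p q np nq; rewrite -raddfB.
  exact: le_trans (Ipart_le _) (hn p q np nq).
exists (toC (a, b)) => e e0; have e2 : 0 < e / 2 by rewrite divr_gt0.
have [n1 h1] := ha _ e2; have [n2 h2] := hb _ e2; exists (maxn n1 n2) => n.
rewrite geq_max => /andP[/h1 {}h1 /h2 {}h2]; apply: (le_trans (cm_le _)).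
by rewrite (raddfB (@Rpart R)) (raddfB (@Ipart R)) /=; lra.
Qed.

Lemma complex_limit_cm (u : nat -> C) l (b : R) : complex_limit u l ->
  (exists n0, forall n, (n0 <= n)%N -> cm (u n) <= b) -> cm l <= b.
Proof.
move=> h [n0 hb]; apply/ler_addgt0Pl => e e0; have [n1 h1] := h e e0.
have {}h1 := h1 _ (leq_maxr n0 n1); have {}hb := hb _ (leq_maxl n0 n1).
have := cmD (l - u (maxn n0 n1)) (u (maxn n0 n1)); rewrite subrK.
rewrite -[cm (l - _)]cmN opprB; lra.
Qed.

(** Point evaluations are bounded, uniformly on small squares, so a Cauchy
    sequence has a locally uniform limit, which is holomorphic by holo_limit. It
    is a limit in norm by Fatou's lemma applied to the densities of the
    differences. *)
Lemma bergman_complete (x : nat -> C -> 'cV[C]_N) : (forall n, H (x n)) ->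
  (forall e : R, 0 < e -> exists n0, forall p q, (n0 <= p)%N -> (n0 <= q)%N ->
    nsq ip (x p - x q) <= e) ->
  exists2 l, H l & strong_limit ip x l.
Proof.
move=> Hx cx.
have unif w : Om w -> exists2 r : R, 0 < r & (forall v, cm (v - w) < r -> Om v) /\
    forall e : R, 0 < e -> exists n0, forall p q v i, (n0 <= p)%N -> (n0 <= q)%N ->
      cm (v - w) < r -> cm (x p v i 0 - x q v i 0) <= e.
  move=> Ow; have [r r0 hr] := square_in_open oOm Ow; exists r => //; split.
    by move=> v vr; apply: (hr v vr); split; apply/andP; split; lra.
  move=> e e0; have K0 := est_const_gt0 r0.
  have [n0 hn] := cx _ (divr_gt0 (exprn_gt0 2 e0) K0).
  exists n0 => p q v i np nq vw; apply: (le_of_sqr (ltW e0)).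
  have := bergman_pointwise oOm i (memB hh (Hx p) (Hx q)) r0 (hr v vw).
  rewrite !mxE => /le_trans; apply.
  by rewrite -ler_pdivlMl // mulrC; exact: hn.
have /choice[L hL] : forall w, exists l : 'cV[C]_N, (~ Om w -> l = 0) /\
    (Om w -> forall i, complex_limit (fun n => x n w i 0) (l i 0)).
  move=> w; have [Ow|nOw] := pselect (Om w); last by exists 0.
  have /choice[l hl] : forall i : 'I_N, exists l, complex_limit (fun n => x n w i 0) l.
    move=> i; apply: complex_cauchy => e e0; have [r r0 [_ hu]] := unif w Ow.
    have [n0 hn] := hu e e0; exists n0 => p q np nq; apply: hn => //.
    by rewrite subrr cm0.
  by exists (\col_i l i); split=> // _ i; rewrite mxE; exact: hl.
have dL i : holomorphic_on Om (fun z => L z i 0).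
  move=> w Ow; have [r r0 [hO hu]] := unif w Ow.
  apply: (@holo_limit R (fun n z => x n z i 0) _ w r r0).
    by move=> n z zr; have [_ dx _] := Hx n; apply: dx; exact: hO.
  move=> e e0; have [n0 hn] := hu e e0; exists n0 => z zr.
  rewrite -cmN opprB; apply: (@complex_limit_cm (fun n => x n z i 0 - x n0 z i 0)).
    move=> s s0; have [n1 h1] := (hL z).2 (hO z zr) i s s0; exists n1 => n /h1.
    by rewrite opprB addrA subrK.
  by exists n0 => n nn; apply: hn.
have fat p e : (exists n0, forall q, (n0 <= q)%N -> nsq ip (x p - x q) <= e) ->
    ((\int[@leb2 R]_(t in D) (density (x p - L) t)%:E) <= e%:E)%E.
  move=> [n0 hn].
  pose g (n : nat) (t : RR) := (density (x p - x (n0 + n)%N) t)%:E.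
  have Hd n : H (x p - x (n0 + n)%N) by apply: (memB hh).
  have mg n : measurable_fun D (g n).
    exact: measurable_int (integrable_density oOm (Hd n)).
  have g0 n t : D t -> (0 <= g n t)%E by move=> _; rewrite lee_fin density_ge0.
  have := fatou (@leb2 R) (measurable_domain oOm) mg g0.
  have -> : (\int[@leb2 R]_(t in D) limn_einf (g^~ t))%E =
      (\int[@leb2 R]_(t in D) (density (x p - L) t)%:E)%E.
    apply: eq_integral => t /set_mem Dt.
    have cv : g^~ t @ \oo --> (density (x p - L) t)%:E.
      apply: cvg_EFin; first by apply: nearW.
      apply: cvg_seqsum => i; apply: cvg_sqr; apply/cvgrPdist_le => s s0.
      have [n1 h1] := (hL (toC t)).2 Dt i s s0; exists n1 => // n nn.
      apply: (le_trans (cm_dist _ _)).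
      have -> : (x p - L) (toC t) i 0 - (x p - x (n0 + n)%N) (toC t) i 0 =
          x (n0 + n)%N (toC t) i 0 - L (toC t) i 0 by rewrite !mxE; ring.
      by apply: h1; apply: leq_trans nn _; exact: leq_addl.
    by have [-> _] := cvg_limn_einf_sup cv.
  move=> /le_trans; apply.
  rewrite limn_einf_lim; apply: lime_le; first exact: is_cvg_einfs.
  apply: nearW => n; apply: (@le_trans _ _ (\int[@leb2 R]_(t in D) g n t)%E).
    by apply: ereal_inf_lbound; exists n => //=.
  by rewrite -(nsq_bergmanE oOm (Hd n)) lee_fin hn // leq_addr.
have HL : H L.
  have [n0 hn] := cx 1 ltr01.
  suff HxL : H (x n0 - L).
    by have := memB hh (Hx n0) HxL; rewrite opprB addrC subrK.
  have [_ dx _] := Hx n0; split.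
  - move=> z nOz; apply/funext => i; apply/funext => j.
    have -> : (x n0 - L) z = x n0 z - L z by [].
    by rewrite (bergman_out (Hx n0)) // (hL z).1 // subrr mxE.
  - move=> i z Oz.
    have -> : (fun w => (x n0 - L) w i 0) = (fun w => -1 * L w i 0 + x n0 w i 0).
      by apply/funext => w; rewrite !mxE mulN1r addrC.
    exact: derivable_lin (dL i z Oz) (dx i z Oz).
  - apply: (@le_lt_trans _ _ 1%:E); last exact: ltry.
    by apply: fat; exists n0 => q; exact: hn.
have HxL p : H (x p - L) by exact: (memB hh).
exists L => // e e0; have [n0 hn] := cx e e0; exists n0 => p np.
by rewrite -lee_fin nsq_bergmanE //; apply: fat; exists n0 => q; exact: hn.
Qed.

End Completeness.

(** * The complex exponential *)

Section ComplexExponential.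
Variable R : realType.
Local Notation C := (Cplx R).
Implicit Types (z w h : C) (f g : C -> C).

Lemma real_deriv_eps (f : R -> R) (x L : R) : is_derive x 1 f L ->
  forall e : R, 0 < e -> exists2 d : R, 0 < d & forall h : R, `|h| < d ->
    `|f (h + x) - f x - L * h| <= e * `|h|.
Proof.
move=> [df fL] e e0.
have hc : (fun h : R => h^-1 *: ((f \o shift x) (h *: 1) - f x)) @ 0^' --> L.
  by rewrite -fL; exact: df.
have hN : nbhs (0 : R) (fun h : R => h != 0 ->
    `|L - h^-1 *: ((f \o shift x) (h *: 1) - f x)| <= e).
  exact: ((cvgrPdist_le _ _).1 hc e e0).
have /nbhs_ballP[d /= d0 hd] := hN.
exists d => // h hh; have [->|h0] := eqVneq h 0.
  by rewrite add0r subrr mulr0 subr0 normr0 mulr0.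
have hb : ball (0 : R) d h by rewrite -ball_normE /ball_ /= sub0r normrN.
have := hd h hb h0; rewrite /= /GRing.scale /= mulr1 => H1.
have -> : f (h + x) - f x - L * h = - (h * (L - h^-1 * (f (h + x) - f x))).
  by field.
by rewrite normrN normrM mulrC ler_wpM2r.
Qed.

(** The real and imaginary parts are estimated from the derivatives of exp, cos
    and sin at 0, with a total error of six terms of size e / 12 times |w|. *)
Lemma cexp_deriv0 : has_deriv (@cexp R) 0 1.
Proof.
move=> e e0; have e12 : 0 < e / 12%:R by rewrite divr_gt0.
have [d1 d10 h1] := real_deriv_eps (is_derive_expR (0 : R)) e12.
have [d2 d20 h2] := real_deriv_eps (is_derive_cos (0 : R)) e12.
have [d3 d30 h3] := real_deriv_eps (is_derive_sin (0 : R)) e12.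
have [d4 d40 h4] := real_deriv_eps (is_derive_expR (0 : R)) ltr01.
pose d5 := Num.min (2^-1) (e / 24%:R).
have d50 : 0 < d5 by rewrite lt_min; apply/andP; split; [rewrite invr_gt0|rewrite divr_gt0].
exists (Num.min d1 (Num.min d2 (Num.min d3 (Num.min d4 d5)))).
  by do 4![rewrite lt_min; apply/andP; split => //].
move=> w; rewrite subr0 !lt_min => /andP[w1 /andP[w2 /andP[w3 /andP[w4 /andP[w5 w6]]]]].
set x := Rpart w; set y := Ipart w.
have xw : `|x| <= cm w by exact: Rpart_le.
have yw : `|y| <= cm w by exact: Ipart_le.
have {}h1 := h1 x (le_lt_trans xw w1).
have {}h2 := h2 y (le_lt_trans yw w2).
have {}h3 := h3 y (le_lt_trans yw w3).
have {}h4 := h4 x (le_lt_trans xw w4).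
rewrite addr0 expR0 mul1r in h1 h4; rewrite addr0 cos0 sin0 oppr0 mul0r subr0 in h2.
rewrite addr0 sin0 cos0 subr0 mul1r in h3.
have ex : `|expR x - 1| <= 2 * `|x|.
  have := ler_normD (expR x - 1 - x) x; rewrite subrK; lra.
have ex2 : expR x <= 2.
  have := ler_norm (expR x - 1); have := xw; lra.
have ex0 : 0 <= expR x by exact: expR_ge0.
have re : `|expR x * cos y - 1 - x| <= 3 * (e / 12%:R) * cm w.
  have -> : expR x * cos y - 1 - x = expR x * (cos y - 1) + (expR x - 1 - x) by ring.
  apply: (le_trans (ler_normD _ _)); rewrite normrM ger0_norm //.
  have : expR x * `|cos y - 1| <= 2 * (e / 12%:R * `|y|) by apply: ler_pM.
  have := ler_wpM2l (ltW e12) yw; have := ler_wpM2l (ltW e12) xw; lra.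
have im : `|expR x * sin y - y| <= 3 * (e / 12%:R) * cm w.
  have -> : expR x * sin y - y = expR x * (sin y - y) + (expR x - 1) * y by ring.
  apply: (le_trans (ler_normD _ _)); rewrite !normrM (ger0_norm ex0).
  have : expR x * `|sin y - y| <= 2 * (e / 12%:R * `|y|) by apply: ler_pM.
  have : `|expR x - 1| * `|y| <= e / 12%:R * cm w.
    apply: ler_pM => //.
    apply: (le_trans ex); apply: (le_trans (ler_wpM2l _ xw)) => //.
    have := w6; lra.
  have := ler_wpM2l (ltW e12) yw; lra.
apply: (le_trans (cm_le _)).
have c0 : cexp (0 : C) = 1.
  by rewrite /cexp /= expR0 cos0 sin0 mul1r mulr0.
rewrite c0 mul1r !(raddfB (@Rpart R)) !(raddfB (@Ipart R)) /= -/x -/y subr0.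
have ew : 0 <= e * cm w by rewrite mulr_ge0 ?cm_ge0 // ltW.
lra.
Qed.

Lemma cexpD z w : cexp (z + w) = cexp z * cexp w.
Proof.
apply: Cext; rewrite ?RpartM ?IpartM /= raddfD [Ipart _]raddfD /= expRD ?cosD ?sinD; ring.
Qed.

Lemma cexp0 : cexp (0 : C) = 1.
Proof. by rewrite /cexp /= expR0 cos0 sin0 mul1r mulr0. Qed.

Lemma cexpN z : cexp z * cexp (- z) = 1.
Proof. by rewrite -cexpD subrr cexp0. Qed.

Lemma cm_cexp z : cm (cexp z) = expR (Rpart z).
Proof.
apply/eqP; rewrite -(@eqrXn2 _ 2%N) ?cm_ge0 ?expR_ge0 //.
by rewrite cm_sqr /= !exprMn -mulrDr cos2Dsin2 mulr1.
Qed.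

Lemma cexp_neq0 z : cexp z != 0.
Proof.
apply/eqP => /(congr1 (@cm R)); rewrite cm_cexp cm0 => /eqP.
by rewrite gt_eqF // expR_gt0.
Qed.

Lemma derivable_cexp z : derivable (@cexp R) z 1.
Proof.
apply/derivableP_complex; exists (cexp z) => e e0.
have c0 : 0 < cm (cexp z) by rewrite cm_gt0 // cexp_neq0.
have [d d0 hd] := cexp_deriv0 (divr_gt0 e0 c0); exists d => // w wz.
have := hd (w - z); rewrite subr0 => /(_ wz); rewrite cexp0 mul1r => h.
have -> : cexp w - cexp z - cexp z * (w - z) = cexp z * (cexp (w - z) - 1 - (w - z)).
  have {1}-> : w = z + (w - z) by rewrite addrC subrK.
  by rewrite cexpD; ring.
by rewrite cmM -ler_pdivlMl // mulrA [_^-1 * e]mulrC.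
Qed.

Lemma derivable_chain f g z : derivable g z 1 -> derivable f (g z) 1 ->
  derivable (fun w => f (g w)) z 1.
Proof.
move=> /derivable1_diffP dg /derivable1_diffP df; apply/derivable1_diffP.
exact: (differentiable_comp dg df).
Qed.

Lemma derivable_eq_near f g z (d : R) : 0 < d -> (forall w, cm (w - z) < d -> f w = g w) ->
  derivable g z 1 -> derivable f z 1.
Proof.
move=> d0 fg /derivableP_complex[L hL]; apply/derivableP_complex; exists L => e e0.
have [d' d'0 hd] := hL e e0; exists (Num.min d d'); first by rewrite lt_min d0.
move=> w; rewrite lt_min => /andP[w1 /hd]; rewrite (fg w) // (fg z) // subrr cm0 //.
Qed.

Lemma derivable_big (I : Type) (s : seq I) (F : I -> C -> C) z :
  (forall i, derivable (F i) z 1) -> derivable (fun w => \sum_(i <- s) F i w) z 1.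
Proof.
move=> h; elim: s => [|i s IH].
  rewrite (_ : (fun w => _) = cst 0); first exact: derivable_cst.
  by apply/funext => w; rewrite big_nil.
rewrite (_ : (fun w => _) = fun w => F i w + \sum_(i <- s) F i w).
  exact: (derivableD (h i) IH).
by apply/funext => w; rewrite big_cons.
Qed.

End ComplexExponential.

(** * Sums of permutation matrices *)

Section Permutations.
Variables (d N : nat) (s : 'I_d -> 'S_N).

(** In the sum of the permutation matrices of the s j, the nonzero entries of row i
    are in the columns s j i. So the condition says that no row meets two columns
    of S. *)
Definition conflict_free (S : {set 'I_N}) :=
  [forall i, forall j, forall k, (s j i \in S) ==> (s k i \in S) ==> (s j i == s k i)].

Lemma conflict_freeP (S : {set 'I_N}) : reflect
  (forall i j k, s j i \in S -> s k i \in S -> s j i = s k i) (conflict_free S).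
Proof.
apply: (iffP forallP) => [h i j k a b | h i].
  by have /forallP/(_ j)/forallP/(_ k) := h i; rewrite a b => /eqP.
by apply/forallP => j; apply/forallP => k; apply/implyP => a; apply/implyP => b; apply/eqP; exact: h.
Qed.

(** Let S be maximal. Every b shares a row with some a in S, so it is of the form
    s k (s j)^-1 a for suitable j and k. *)
Lemma large_conflict_free : (0 < d)%N ->
  exists2 S, conflict_free S & (N <= #|S| * d ^ 2)%N.
Proof.
move=> d0; have [|S /maxsetP[fS mS] _] := @maxset_exists _ conflict_free finset.set0.
  by apply/conflict_freeP => i j k; rewrite finset.in_set0.
exists S => //; pose j0 := Ordinal d0.
pose f (t : 'I_N * ('I_d * 'I_d)) := s t.2.2 ((s t.2.1)^-1%g t.1).
pose D := finset.setX S [set: 'I_d * 'I_d]%SET.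
have cov : [set: 'I_N]%SET \subset [set f t | t in D]%SET.
  apply/fintype.subsetP => b _.
  have hit a j k : a \in S -> f (a, (j, k)) = b -> b \in [set f t | t in D]%SET.
    move=> aS <-; apply/finset.imsetP; exists (a, (j, k)) => //.
    by rewrite finset.in_setX aS finset.in_setT.
  have [bS|bS] := boolP (b \in S).
    by apply: (hit b j0 j0) => //; rewrite /f /= permKV.
  have nfree : ~~ conflict_free (b |: S)%SET.
    apply/negP => h; case/negP: bS.
    by rewrite -(mS _ h (finset.subsetUr _ _)) finset.setU11.
  have [i [j [k [jb kb jk]]]] : exists i j k,
      [/\ s j i \in (b |: S)%SET, s k i \in (b |: S)%SET & s j i <> s k i].
    apply: contrapT => no; case/negP: nfree; apply/conflict_freeP => i j k jb kb.
    by apply: contrapT => jk; apply: no; exists i, j, k.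
  move: jb kb; rewrite !finset.in_setU1 => /predU1P[jb|jS] /predU1P[kb|kS].
  - by case: jk; rewrite jb kb.
  - by apply: (hit _ k j kS); rewrite /f /= permK.
  - by apply: (hit _ j k jS); rewrite /f /= permK.
  - by case: jk; move/conflict_freeP: fS; apply.
have := subset_leq_card cov; rewrite cardsT card_ord => /leq_trans; apply.
apply: (leq_trans (leq_imset_card _ _)).
by rewrite cardsX cardsT card_prod card_ord mulnn.
Qed.

(** The row in which s j0 meets the column a has no entry in another column of S,
    so its value on v is a positive multiple of v a. *)
Lemma conflict_free_energy (R : realType) (S : {set 'I_N}) (v : 'I_N -> Cplx R) :
  (0 < d)%N -> conflict_free S -> (forall a, a \notin S -> v a = 0) ->
  \sum_a cm (v a) ^+ 2 <= \sum_i cm (\sum_j v (s j i)) ^+ 2.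
Proof.
move=> d0 /conflict_freeP fS vS; pose j0 := Ordinal d0.
rewrite [leRHS](reindex_inj (@perm_inj _ ((s j0)^-1%g))); apply: ler_sum => a _.
rewrite /=; set i := ((s j0)^-1%g) a.
have [aS|/vS ->] := boolP (a \in S); last by rewrite cm0 expr0n sqr_ge0.
have ia : s j0 i = a by rewrite /i permKV.
have -> : \sum_j v (s j i) = v a *+ #|[pred j | s j i == a]|.
  rewrite -sumr_const [RHS]big_mkcond /=; apply: eq_bigr => j _; rewrite inE.
  case: eqP => [->//|ja]; apply: vS; apply/negP => jS; apply: ja.
  by rewrite -[RHS]ia; apply: fS => //; rewrite ia.
have n0 : (0 < #|[pred j | s j i == a]|)%N by apply/card_gt0P; exists j0; rewrite inE ia.
rewrite ler_sqr ?nnegrE ?cm_ge0 // -mulr_natl -(rmorph_nat (@ofR R)) cmM cm_ofR.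
by rewrite ger0_norm ?ler0n // ler_peMl ?cm_ge0 // ler1n.
Qed.

End Permutations.

Lemma sqr_sum_le (R : realType) d (x : 'I_d -> R) :
  (\sum_j x j) ^+ 2 <= d%:R * \sum_j x j ^+ 2.
Proof.
have -> : (\sum_j x j) ^+ 2 = \sum_j \sum_k x j * x k.
  by rewrite expr2 mulr_suml; apply: eq_bigr => j _; rewrite mulr_sumr.
have -> : d%:R * \sum_j x j ^+ 2 = \sum_j \sum_k (2^-1 * x j ^+ 2 + 2^-1 * x k ^+ 2).
  have row j : \sum_k (2^-1 * x j ^+ 2 + 2^-1 * x k ^+ 2) =
      d%:R * (2^-1 * x j ^+ 2) + 2^-1 * \sum_k x k ^+ 2.
    by rewrite big_split /= sumr_const card_ord -mulr_sumr mulr_natl.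
  rewrite (eq_bigr _ (fun j _ => row j)) big_split /= sumr_const card_ord -!mulr_sumr.
  by rewrite -mulr_natl; field.
apply: ler_sum => j _; apply: ler_sum => k _.
have := sqr_ge0 (x j - x k); rewrite sqrrB; lra.
Qed.

(** * The transfer operator on the Bergman space *)

Section Transfer.
Variable R : realType.
Local Notation C := (Cplx R).
Local Notation RR := (measurableTypeR R * measurableTypeR R)%type.
Variables (Om : set C) (d : nat) (gam : 'I_d -> C -> C) (G : C -> C).
Hypothesis oOm : open Om.
Let D : set RR := @toC R @^-1` Om.
Hypothesis gam_into : forall j z, Om z -> Om (gam j z).
Hypothesis gam_holo : forall j, holomorphic_on Om (gam j).
Hypothesis G_holo : holomorphic_on Om G.
Variables (r M : R).
Hypothesis r0 : 0 < r.
Hypothesis room : forall j z, Om z -> forall w,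
  in_square (gam j z) (2 * r) w -> Om w.
Hypothesis weight : forall z, Om z -> `|Rpart (G z)| <= M.
Hypothesis finD : (@leb2 R D < +oo)%E.
Variables (N : nat) (s : {ffun 'I_d -> 'S_N}).
Implicit Types (F : C -> 'cV[C]_N).
Local Notation H := (@bergman R Om N).
Local Notation ip := (@bergman_ip R Om N).
Local Notation T := (transfer Om gam G s).
Let mD := measurable_domain oOm.
Let hh := bergman_hermitian oOm N.

Definition area := fine (@leb2 R D).

Lemma areaE : area%:E = @leb2 R D.
Proof. by rewrite /area fineK // ge0_fin_numE. Qed.

Lemma area_ge0 : 0 <= area.
Proof. exact: fine_ge0. Qed.

Lemma integral_cst_area (c : R) : (\int[@leb2 R]_(p in D) c%:E = (c * area)%:E)%E.
Proof. by rewrite (@integral_cst _ _ _ (@leb2 R) D mD c%:E) EFinM areaE. Qed.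

Lemma integrable_cst_domain (c : R) : (@leb2 R).-integrable D (EFin \o (fun=> c)).
Proof.
apply/integrableP; split; first exact/measurable_EFinP/measurable_cst.
by rewrite /= integral_cst_area ltry.
Qed.

Lemma sum_coord (I : Type) (t : seq I) (g : I -> C -> 'cV[C]_N) z i :
  (\sum_(k <- t) g k) z i 0 = \sum_(k <- t) g k z i 0.
Proof.
elim: t => [|k t IH]; first by rewrite !big_nil mxE.
by rewrite !big_cons -IH mxE.
Qed.

Lemma transferE F z i : Om z ->
  T F z i 0 = \sum_j cexp (G (gam j z)) * F (gam j z) (s j i) 0.
Proof.
move=> Oz; rewrite /transfer asboolT // summxE; apply: eq_bigr => j _.
by rewrite mxE -row_permE mxE.
Qed.

Lemma transfer_out F z : ~ Om z -> T F z = 0.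
Proof. by move=> Oz; rewrite /transfer asboolF. Qed.

Lemma transfer_linear (a : C) u v : T (a *: u + v) = a *: T u + T v.
Proof.
apply/funext => z; have -> : (a *: T u + T v) z = a *: T u z + T v z by [].
have [Oz|Oz] := pselect (Om z); last by rewrite !transfer_out // scaler0 addr0.
apply/colP => i; rewrite !mxE !transferE // mulr_sumr -big_split /=.
by apply: eq_bigr => j _; rewrite !mxE mulrDr !mulrA [a * _]mulrC.
Qed.

Lemma cm_weight j z : Om z -> cm (cexp (G (gam j z))) <= expR M.
Proof.
move=> Oz; rewrite cm_cexp ler_expR; apply: le_trans (weight (gam_into j Oz)).
exact: ler_norm.
Qed.

(** Cauchy-Schwarz for the sum over j; the permutations disappear in the sum over
    the coordinates. *)
Lemma density_transfer_le F p : D p -> density (T F) p <=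
  expR M ^+ 2 * d%:R * \sum_j \sum_i cm (F (gam j (toC p)) i 0) ^+ 2.
Proof.
move=> Dp; rewrite /density.
have term i : cm (T F (toC p) i 0) ^+ 2 <=
    expR M ^+ 2 * d%:R * \sum_j cm (F (gam j (toC p)) (s j i) 0) ^+ 2.
  rewrite transferE //.
  apply: (@le_trans _ _ ((\sum_j expR M * cm (F (gam j (toC p)) (s j i) 0)) ^+ 2)).
    rewrite ler_sqr ?nnegrE ?cm_ge0 //; last first.
      by apply: sumr_ge0 => j _; rewrite mulr_ge0 ?expR_ge0 ?cm_ge0.
    apply: (le_trans (cm_sum _ _ _)); apply: ler_sum => j _.
    by rewrite cmM ler_wpM2r ?cm_ge0 // cm_weight.
  rewrite -mulr_sumr exprMn -mulrA ler_wpM2l ?sqr_ge0 //; exact: sqr_sum_le.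
apply: (le_trans (ler_sum _ (fun i _ => term i))).
rewrite -mulr_sumr exchange_big /= ler_wpM2l ?mulr_ge0 ?sqr_ge0 ?ler0n //.
by apply: ler_sum => j _; rewrite [leRHS](reindex_inj (@perm_inj _ (s j))).
Qed.

Definition HS_const := expR M ^+ 2 * d%:R ^+ 2 * est_const r.

Lemma density_transfer_bergman F p : bergman Om F -> D p -> density (T F) p <=
  expR M ^+ 2 * d%:R * (d%:R * (N%:R * (est_const r * nsq ip F))).
Proof.
move=> hF Dp; apply: (le_trans (density_transfer_le _ Dp)).
rewrite ler_wpM2l ?mulr_ge0 ?sqr_ge0 ?ler0n //.
apply: (@le_trans _ _ (\sum_(j < d) \sum_(i < N) (est_const r * nsq ip F))).
  apply: ler_sum => j _; apply: ler_sum => i _.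
  exact: (bergman_pointwise oOm i hF r0 (@room j _ Dp)).
by rewrite !sumr_const !card_ord -[_ *+ N]mulr_natl -[_ *+ d]mulr_natl.
Qed.

Lemma transfer_bergman F : bergman Om F -> bergman Om (T F).
Proof.
move=> hF; apply: (bergman_of oOm).
- by move=> z; exact: transfer_out.
- move=> i z Oz; have [e e0 he] := open_complexP oOm Oz.
  have := @derivable_eq_near R (fun w => T F w i 0)
    (fun w => \sum_j cexp (G (gam j w)) * F (gam j w) (s j i) 0) z e e0.
  apply; first by move=> w /he /transferE.
  apply: derivable_big => j; have dg := @gam_holo j z Oz; have Ogz := @gam_into j z Oz.
  have [_ dF _] := hF.
  have d1 := derivable_chain dg (dF (s j i) _ Ogz).
  have d2 := derivable_chain (derivable_chain dg (G_holo Ogz)) (@derivable_cexp R _).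
  exact: (derivableM d2 d1).
- exists (fun=> expR M ^+ 2 * d%:R * (d%:R * (N%:R * (est_const r * nsq ip F)))).
    exact: integrable_cst_domain.
  by move=> p; exact: density_transfer_bergman.
Qed.

Lemma transfer_operator : operator_on H T.
Proof.
split=> [u|a u v _ _]; [exact: transfer_bergman|exact: transfer_linear].
Qed.

(** Apply the pointwise estimate to F = sum_k conj(f_k(w)_i) f_k: both F(w)_i and
    |F|^2 are equal to sum_k |f_k(w)_i|^2. *)
Lemma bessel_pointwise (f : nat -> C -> 'cV[C]_N) m j z i : orthonormal ip H f m -> Om z ->
  \sum_(k < m) cm (f k (gam j z) i 0) ^+ 2 <= est_const r.
Proof.
move=> hf Oz; set w := gam j z.
pose F := \sum_(k < m) (f k w i 0)^* *: f k.
have HF : bergman Om F by exact: (mem_comb hh hf (fun k => (f k w i 0)^*)).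
have := bergman_pointwise oOm i HF r0 (@room j z Oz); rewrite -/w.
have -> : nsq ip F = \sum_(k < m) cm (f k w i 0) ^+ 2.
  rewrite (nsq_comb hh hf (fun k => (f k w i 0)^*)); apply: eq_bigr => k _.
  by rewrite cm_conj.
have -> : F w i 0 = ofR (\sum_(k < m) cm (f k w i 0) ^+ 2).
  rewrite sum_coord rmorph_sum; apply: eq_bigr => k _.
  by rewrite mxE mulrC mulJ.
set S := \sum_(k < m) _; have S0 : 0 <= S by apply: sumr_ge0 => k _; exact: sqr_ge0.
rewrite cm_ofR ger0_norm // expr2.
have [->|Sn0] := eqVneq S 0; first by rewrite (ltW (est_const_gt0 r0)).
by rewrite ler_pM2r // lt_neqAle eq_sym Sn0.
Qed.

Lemma transfer_HS_bounded : HS_bounded ip H T (HS_const * area * N%:R).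
Proof.
move=> f m hf; rewrite -lee_fin -sumEFin.
have HT k : (k < m)%N -> bergman Om (T (f k)) by move=> km; apply: transfer_bergman; exact: hf.1.
rewrite (eq_bigr (fun k : 'I_m => \int[@leb2 R]_(p in D) (density (T (f k)) p)%:E)%E); last first.
  by move=> k _; exact: (nsq_bergmanE oOm (HT k (ltn_ord k))).
rewrite -ge0_integral_sum //; last 2 first.
- by move=> k; have /integrableP[] := integrable_density oOm (HT k (ltn_ord k)).
- by move=> k p _; rewrite lee_fin density_ge0.
have -> : HS_const * area * N%:R = (HS_const * N%:R) * area by ring.
rewrite -integral_cst_area; apply: ge0_le_integral => //.
- by move=> p _; rewrite sumEFin lee_fin; apply: sumr_ge0 => k _; exact: density_ge0.
- apply: emeasurable_sum => k.
  by have /integrableP[] := integrable_density oOm (HT k (ltn_ord k)).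
move=> p Dp; rewrite sumEFin lee_fin.
have term (k : 'I_m) := density_transfer_le (f k) Dp.
apply: (le_trans (ler_sum _ (fun k _ => term k))).
rewrite -mulr_sumr exchange_big /=.
under eq_bigr do rewrite exchange_big /=.
apply: (@le_trans _ _ (expR M ^+ 2 * d%:R * \sum_(j < d) \sum_(i < N) est_const r)).
  rewrite ler_wpM2l ?mulr_ge0 ?sqr_ge0 ?ler0n //.
  by apply: ler_sum => j _; apply: ler_sum => i _; exact: bessel_pointwise.
rewrite !sumr_const !card_ord -[_ *+ N]mulr_natl -[_ *+ d]mulr_natl /HS_const le_eqVlt; apply/orP; left; apply/eqP; ring.
Qed.

Section LowerBound.
Variable S : {set 'I_N}.
Hypotheses (freeS : conflict_free s S) (d0 : (0 < d)%N) (Om0 : Om !=set0).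
Implicit Types (c : 'I_#|S| -> C).

(** The factor exp(-G) cancels the weight of the transfer operator, which therefore
    acts on these functions as the sum of the permutation matrices. *)
Definition bump (a : 'I_N) : C -> 'cV[C]_N :=
  fun z => if `[< Om z >] then cexp (- G z) *: delta_mx a 0 else 0.

Definition spread c (a : 'I_N) : C := \sum_k c k * (a == enum_val k)%:R.

Local Notation comb c := (\sum_k c k *: bump (enum_val k)).

Lemma spread_val c k : spread c (enum_val k) = c k.
Proof.
rewrite /spread (bigD1 k) //= eqxx mulr1 big1 ?addr0 // => l lk.
by rewrite (inj_eq enum_val_inj) eq_sym (negbTE lk) mulr0.
Qed.

Lemma spread_out c a : a \notin S -> spread c a = 0.
Proof.
move=> aS; rewrite /spread big1 // => k _; case: eqP => [ak|_]; last by rewrite mulr0.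
by case/negP: aS; rewrite ak enum_valP.
Qed.

Lemma comb_at c z a : Om z -> comb c z a 0 = cexp (- G z) * spread c a.
Proof.
move=> Oz; rewrite sum_coord /spread mulr_sumr; apply: eq_bigr => k _.
by rewrite mxE /bump asboolT // !mxE eqxx andbT mulrCA.
Qed.

Lemma density_bump a p : D p -> density (bump a) p <= expR M ^+ 2.
Proof.
move=> Dp; rewrite /density (bigD1 a) //= big1 ?addr0 => [|b ba].
  rewrite /bump asboolT // !mxE !eqxx mulr1 cm_cexp ler_sqr ?nnegrE ?expR_ge0 // ler_expR.
  by apply: le_trans (weight Dp); rewrite raddfN -normrN ler_norm.
by rewrite /bump asboolT // !mxE (negbTE ba) mulr0 cm0 expr0n.
Qed.

Lemma bergman_bump a : bergman Om (bump a).
Proof.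
apply: (bergman_of oOm).
- by move=> z Oz; rewrite /bump asboolF.
- move=> i z Oz; have [e e0 he] := open_complexP oOm Oz.
  have := @derivable_eq_near R (fun w => bump a w i 0)
    (fun w => cexp (- G w) * (i == a)%:R) z e e0.
  apply; first by move=> w /he Ow; rewrite /bump asboolT // !mxE eqxx andbT.
  have dN := derivableN (G_holo Oz).
  exact: (derivableM (derivable_chain dN (@derivable_cexp R _)) (derivable_cst _ z 1)).
- by exists (fun=> expR M ^+ 2); [exact: integrable_cst_domain|exact: density_bump].
Qed.

Lemma bergman_comb c : bergman Om (comb c).
Proof. by apply: (mem_sum hh) => k _; apply: (memZ hh); exact: bergman_bump. Qed.

Lemma comb_free c : (exists k, c k != 0) -> comb c <> 0.
Proof.
move=> [k ck] c0; have [z Oz] := Om0; case/eqP: ck.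
have := comb_at c (enum_val k) Oz; rewrite c0 mxE spread_val => /esym/eqP.
by rewrite mulf_eq0 (negbTE (cexp_neq0 _)) => /eqP.
Qed.

Lemma transfer_comb c z i : Om z -> T (comb c) z i 0 = \sum_j spread c (s j i).
Proof.
move=> Oz; rewrite transferE //; apply: eq_bigr => j _.
by rewrite comb_at ?mulrA ?cexpN ?mul1r //; exact: gam_into.
Qed.

Lemma nsq_comb_le c : nsq ip (comb c) <= expR M ^+ 2 * (\sum_a cm (spread c a) ^+ 2) * area.
Proof.
rewrite -lee_fin (nsq_bergmanE oOm (bergman_comb c)) -integral_cst_area.
apply: ge0_le_integral => //.
- by move=> p _; rewrite lee_fin density_ge0.
- by have /integrableP[] := integrable_density oOm (bergman_comb c).
move=> p Dp; rewrite lee_fin /density mulr_sumr; apply: ler_sum => a _.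
rewrite comb_at // cmM exprMn ler_wpM2r ?sqr_ge0 // cm_cexp.
rewrite ler_sqr ?nnegrE ?expR_ge0 // ler_expR.
by apply: le_trans (weight Dp); rewrite raddfN -normrN ler_norm.
Qed.

Lemma nsq_transfer_comb c :
  nsq ip (T (comb c)) = (\sum_i cm (\sum_j spread c (s j i)) ^+ 2) * area.
Proof.
apply/EFin_inj; rewrite (nsq_bergmanE oOm (transfer_bergman (bergman_comb c))).
rewrite -integral_cst_area; apply: eq_integral => p; rewrite inE => Dp.
by rewrite /density; congr EFin; apply: eq_bigr => i _; rewrite transfer_comb.
Qed.

Lemma transfer_lower_bound c :
  expR (- M) ^+ 2 * nsq ip (comb c) <= nsq ip (T (comb c)).
Proof.
rewrite nsq_transfer_comb.
have := ler_wpM2l (sqr_ge0 (expR (- M))) (nsq_comb_le c); move=> /le_trans; apply.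
rewrite mulrA (mulrA (expR (- M) ^+ 2)) -exprMn -expRD addNr expR0 expr1n mul1r ler_wpM2r ?area_ge0 //.
by apply: conflict_free_energy d0 freeS _ => a; exact: spread_out.
Qed.

End LowerBound.

Theorem transfer_count_bounds : (0 < d)%N -> Om !=set0 ->
  (((d%:R ^+ 2)^-1 * N%:R)%:E <= transfer_count Om gam G s (expR M))%E /\
  (transfer_count Om gam G s (expR M) <= (HS_const * area * expR M ^+ 2 * N%:R)%:E)%E.
Proof.
move=> d0 Om0; have [S freeS cardS] := large_conflict_free s d0.
have rho0 := expR_gt0 (- M).
have hil := HilbertOn hh (@bergman_eq0 R Om oOm N) (@bergman_complete R Om oOm N).
have [low up] := sv_count_bounds hil transfer_operator transfer_HS_bounded rho0
  (fun k : 'I_#|S| => bergman_bump (enum_val k)) (comb_free Om0)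
  (transfer_lower_bound freeS d0).
have radius : (expR (- M))^-1 = expR M by rewrite -expRN opprK.
rewrite radius in low up; split.
  apply: le_trans low; rewrite lee_fin ler_pdivrMl ?exprn_gt0 ?ltr0n //.
  by rewrite -natrX -natrM ler_nat mulnC.
apply: (le_trans up); rewrite lee_fin -exprVn radius.
by rewrite mulrAC.
Qed.

End Transfer.

(** * Compactness and the counting theorem *)

Section Compactness.
Variable R : realType.
Local Notation C := (Cplx R).
Local Notation RR := (measurableTypeR R * measurableTypeR R)%type.
Implicit Types (Om K : set C).

Definition box (B : R) : set (R * R) := `[- B, B] `*` `[- B, B].

Lemma box_compact B : compact (toC (R:=R) @` box B).
Proof.
apply: continuous_compact; last by apply: compact_setX; exact: segment_compact.
apply: continuous_subspaceT => p A /nbhs_complexP[e e0 he].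
have e2 : 0 < e / 2 by rewrite divr_gt0.
exists (ball p.1 (e / 2), ball p.2 (e / 2)) => /=; first by split; exact: nbhsx_ballx.
move=> q [/= q1 q2]; apply: he; apply: (le_lt_trans (cm_le _)).
rewrite (raddfB (@Rpart R)) (raddfB (@Ipart R)) /= distrC [`|_ - p.2|]distrC.
move: q1 q2; rewrite -!ball_normE /=; lra.
Qed.

Lemma bounded_in_box Om : bounded_set Om -> exists B, Om `<=` toC (R:=R) @` box B.
Proof.
move=> [M [Mr hM]]; exists (Rpart (M + 1)) => z Oz.
have : cm z <= Rpart (M + 1).
  have /ge0P[_] : 0 <= M + 1 - `|z| by rewrite subr_ge0; apply: hM Oz; rewrite ltrDl.
  by rewrite (raddfB (@Rpart R)) subr_ge0.
move=> zB; exists (Rpart z, Ipart z); last by apply: Cext.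
have := le_trans (Rpart_le z) zB; have := le_trans (Ipart_le z) zB.
by rewrite !ler_norml /box => h1 h2; split; rewrite /= in_itv /=.
Qed.

(** Cplx R is handled as a normed module over itself, so compactness is brought
    over from R x R along toC. *)
Lemma bounded_closure_compact Om : bounded_set Om -> compact (closure Om).
Proof.
move=> /bounded_in_box[B OB]; have cB := box_compact (B := B).
apply: (subclosed_compact _ cB); first exact: closed_closure.
have clB : closed (toC (R:=R) @` box B) by apply: compact_closed => //; exact: norm_hausdorff.
by rewrite [X in _ `<=` X](closure_id _).1 //; exact: closureS.
Qed.

Lemma bounded_area Om : open Om -> bounded_set Om ->
  (@leb2 R (@toC R @^-1` Om : set RR) < +oo)%E.
Proof.
move=> oOm /bounded_in_box[B OB].
have mI : measurable (`[- B, B] : set (measurableTypeR R)) by exact: measurable_itv.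
apply: (@le_lt_trans _ _ (@leb2 R (box B))).
  apply: le_measure; rewrite ?inE //; first exact: measurable_domain.
    exact: measurableX.
  by move=> p /OB[q qB /(congr1 (fun z => (Rpart z, Ipart z)))]; case: p q qB => [a b] [a' b'] ? [<- <-].
rewrite /leb2 product_measure1E //.
have fI : (@lebesgue_measure R `[(- B)%R, B]%classic < +oo)%E.
  by rewrite lebesgue_measure_itv /=; case: ifP => _; rewrite ?ltry // -EFinB ltry.
by apply: lte_mul_pinfty; rewrite ?ge0_fin_numE.
Qed.

(** Every point z of K has a neighbourhood on which the squares of small
    half-side fit into Om; compactness makes the size uniform. *)
Lemma uniform_room Om K : open Om -> compact K -> K `<=` Om ->
  \forall r \near (0 : R)^'+, forall z, K z -> forall w,
    in_square z (2 * r) w -> Om w.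
Proof.
move=> oOm /compact_near_coveringP cK KO; apply: cK => z /KO Oz.
have [r r0 hr] := square_in_open oOm Oz.
exists ([set w | cm (w - z) < r], [set t | 0 < t < r]) => /=.
  split; first by apply/nbhs_complexP; exists r.
  exists r => // t /=; rewrite sub0r normrN => tr t0.
  by rewrite t0 (le_lt_trans (ler_norm t)).
move=> [w t] /= [wz /andP[t0 tr]] v [v1 v2]; apply: (hr w wz); split; lra.
Qed.

(** The continuous extension of G is locally bounded on the compact closure of Om. *)
Lemma bounded_weight Om G : bounded_set Om -> extends_continuously Om G ->
  exists M : R, forall z, Om z -> `|Rpart (G z)| <= M.
Proof.
move=> bOm [g [/subspace_continuousP cg gG]].
have /compact_near_coveringP cK := bounded_closure_compact bOm.
have [|M [Mr hM]] := cK R +oo (fun M z => closure Om z -> `|Rpart (g z)| <= M) _.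
  move=> z Kz; have /nbhs_complexP[e e0 he] : nbhs z [set w | closure Om w -> cm (g w - g z) < 1].
    have near1 : nbhs (g z) [set y | cm (y - g z) < 1] by apply/nbhs_complexP; exists 1.
    exact: (cg z Kz _ near1).
  exists ([set w | cm (w - z) < e], [set t | cm (g z) + 1 < t]) => /=.
    split; first by apply/nbhs_complexP; exists e.
    by exists (cm (g z) + 1); split; first exact: num_real.
  move=> [w t] /= [wz tz] Kw; apply: (le_trans (Rpart_le _)).
  have := cmD (g w - g z) (g z); rewrite subrK; have := he w wz Kw; lra.
exists (M + 1) => z Oz; rewrite -gG //.
have cz : closure Om z by exact: subset_closure.
by apply: (hM _ _ z cz cz); rewrite ltrDl.
Qed.

End Compactness.

Lemma perm_prob_sure (R : realType) d N (E : {ffun 'I_d -> 'S_N} -> Prop) :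
  (forall s, E s) -> perm_prob R E = 1.
Proof.
move=> allE; rewrite /perm_prob (eq_card (B := {: {ffun 'I_d -> 'S_N}})).
  rewrite divff // pnatr_eq0 -lt0n; apply/card_gt0P; by exists [ffun=> 1%g].
by move=> s; rewrite !inE asboolT.
Qed.

Theorem theorem1p3 (R : realType) (Om : set (Cplx R)) (d : nat)
    (gam : 'I_d -> Cplx R -> Cplx R) (G : Cplx R -> Cplx R)
    (Om_open : open Om) (Om_bounded : bounded_set Om)
    (Om_simply_connected : simply_connected Om) (Om_C2 : C2_boundary Om)
    (d_ge2 : (2 <= d)%N)
    (gam_into : forall j z, Om z -> Om (gam j z))
    (gam_holo : forall j, holomorphic_on Om (gam j))
    (gam_ext : forall j, extends_continuously Om (gam j))
    (gam_closure : forall j, closure (gam j @` Om) `<=` Om)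
    (G_holo : holomorphic_on Om G) (G_ext : extends_continuously Om G) :
  exists C2 r0 : R, [/\ 0 < C2, 0 < r0 &
    forall k : nat, exists2 A : R, 0 < A &
      exists N0 : nat, forall N : nat, (N0 <= N)%N ->
        1 - A / N%:R ^+ k <=
          perm_prob R (fun s : {ffun 'I_d -> 'S_N} =>
            ((C2^-1 * N%:R)%:E <= transfer_count Om gam G s r0)%E /\
            (transfer_count Om gam G s r0 <= (C2 * N%:R)%:E)%E)].
Proof.
have d0 : (0 < d)%N by exact: ltnW.
have [Om0 _ _] := Om_simply_connected.
have finOm := bounded_area Om_open Om_bounded.
have [M weight] := bounded_weight Om_bounded G_ext.
pose fits (j : 'I_d) (r : R) := forall z, Om z -> forall w,
    in_square (gam j z) (2 * r) w -> Om w.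
have near_fits : \forall r \near (0 : R)^'+, forall j, fits j r.
  apply: filter_forall => j.
  have bj : bounded_set (gam j @` Om).
    have [B [Br hB]] := Om_bounded; exists B; split=> // x /hB hx _ [z Oz <-].
    apply: hx; exact: gam_into.
  have := uniform_room Om_open (bounded_closure_compact bj) (@gam_closure j).
  apply: filterS => r hr z Oz; apply: hr; apply: subset_closure; by exists z.
have [r [r0 room]] := filter_ex (filterI (nbhs_right_gt (0 : R)) near_fits).
pose K := HS_const d r M * area Om * expR M ^+ 2.
have K0 : 0 <= K.
  apply: mulr_ge0; last exact: sqr_ge0.
  apply: mulr_ge0; last exact: area_ge0.
  by apply: mulr_ge0; [rewrite mulr_ge0 ?sqr_ge0|exact: ltW (est_const_gt0 r0)].
have d2 : 0 < d%:R ^+ 2 :> R by rewrite exprn_gt0 // ltr0n.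
pose C2 := d%:R ^+ 2 + K; have C20 : 0 < C2 by rewrite ltr_pwDl.
exists C2, (expR M); split; [exact: C20|exact: expR_gt0|].
move=> k; exists 1 => //; exists 0%N => N _; rewrite perm_prob_sure.
  by rewrite gerBl divr_ge0 // exprn_ge0.
move=> s; have [low up] := transfer_count_bounds Om_open gam_into gam_holo G_holo
  r0 room weight finOm s d0 Om0.
split; [apply: le_trans low|apply: (le_trans up)]; rewrite lee_fin ler_wpM2r //.
- by rewrite lef_pV2 ?posrE // lerDl.
- by rewrite lerDr ltW.
Qed.
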